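(* Let $d\ge4$, $\Lambda=\mathbb T^d$, $\beta>0$ and $\rho_{\mathrm c}=(4\pi\beta)^{-d/2}\zeta(d/2)$. Then there exists $C>0$ such that $$C^{-1}L^{-d}\le\mathbb P_{L,\beta,\rho_{\mathrm c}L^d}\big(\mathcal N_L=\rho_{\mathrm c}L^d\big)\le CL^{-d}.$$ Furthermore, for $x,y\in\Lambda_L$ with $\mathrm{dist}(x,y)>\varepsilon L$ for some fixed $\varepsilon>0$, as $L\to\infty$ $$\gamma_{L,\beta,\rho_{\mathrm c}}(x,y)\asymp\begin{cases}L^{-2}\sqrt{\log(L)},&d=4,\\ L^{-d/2},&d\ge5.\end{cases}$$
   Context: Setting. $\Lambda=\mathbb T^d$ is the torus of unit volume, $\Delta$ its Laplacian; $-\Delta$ has eigenvalues $0=\lambda_1<\lambda_2\le\lambda_3\le\dots$ with $L^2$-normalized eigenfunctions $\phi^{(k)}$. Put $\Lambda_L=L\Lambda$, with heat kernel (generator $\Delta$) $$p^{(L)}_t(x,y)=L^{-d}\sum_{k\ge1}e^{-\lambda_k tL^{-2}}\phi^{(k)}(x/L)\phi^{(k)}(y/L),$$ $Z(t)=\sum_{k\ge 1}e^{-\lambda_kt}$ and $t_j=\int_{\Lambda_L}p^{(L)}_{\beta j}(x,x)\,dx=Z(\beta jL^{-2})$. Loop soup. For $N\in\mathbb N$, $\mathbb P_{L,\beta,N}$ is the Poisson point process of loops with intensity measure $\sum_{j=1}^{N}\frac1j\int_{\Lambda_L}dx\,\mathbb P^{(L)}_{x,x,\beta j}$, where $\mathbb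 P^{(L)}_{x,y,t}$ is the unnormalized Brownian bridge measure from $x$ to $y$ in time $t$ on $\Lambda_L$, of total mass $p_t^{(L)}(x,y)$. A loop $\omega$ coming from the $j$-th term has length $\ell(\omega)=j$. Thus the numbers of loops of length $j$, $1\le j\le N$, are independent Poisson variables with means $t_j/j$. The total particle number is $\mathcal N_L=\sum_i\ell(\omega_i)$. For $\rho>0$ with $\rho L^d\in\mathbb N$ (only such $L$ are considered), the one-particle reduced density matrix is $$\gamma_{L,\beta,\rho}(x,y)=\sum_{r=1}^{\rho L^d}\frac{p^{(L)}_{\beta r}(x,y)\,\mathbb P_{L,\beta,\rho L^d}(\mathcal N_L=\rho L^d-r)}{\mathbb P_{L,\beta,\rho L^d}(\mathcal N_L=\rho L^d)} .$$ $A\asymp B$ means $C^{-1}A\le B\le CA$ for some constant $C>0$ not depending on $L$. *)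

(* Defs.v *)
From HB Require Import structures.
From mathcomp Require Import all_boot all_order all_algebra.
From mathcomp Require Import all_classical all_reals all_analysis.

Set Implicit Arguments.
Unset Strict Implicit.
Unset Printing Implicit Defensive.

Import Order.TTheory GRing.Theory Num.Theory.
Import numFieldNormedType.Exports.

Local Open Scope classical_set_scope.
Local Open Scope ring_scope.

(* The torus Lambda_L = R^d / (L Z)^d is represented by its fundamental domain
   [0, L)^d; functions on it are (L Z)^d-periodic functions on R^d. *)
Section torus.
Context {R : realType} {d : nat}.
Implicit Types (L : {posnum R}) (x y : 'rV[R]_d).

Definition torus L : set 'rV[R]_d :=
  [set x | forall i, 0 <= x 0 i < L%:num].

Definition enorm x : R := Num.sqrt (\sum_i x 0 i ^+ 2).

Definition torus_dist L x y : R :=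
  inf [set enorm (x - y - L%:num *: map_mx intr k) | k in [set: 'rV[int]_d]].

Definition periodic (f : 'rV[R]_d -> R) : Prop :=
  forall x i, f (x + delta_mx 0 i) = f x.

Definition partial (i : 'I_d) (f : 'rV[R]_d -> R) (x : 'rV[R]_d) : R :=
  'D_(delta_mx 0 i) f x.

Fixpoint continuously_diff (n : nat) (f : 'rV[R]_d -> R) : Prop :=
  continuous f /\
  if n is n'.+1 then
    forall i, (forall x, derivable f x (delta_mx 0 i)) /\
              continuously_diff n' (partial i f)
  else True.

Definition laplacian (f : 'rV[R]_d -> R) (x : 'rV[R]_d) : R :=
  \sum_i partial i (partial i f) x.

(* Eigenfunctions on a torus are smooth, so that restricting the domain of the
   Laplacian to C^2 functions leaves the spectrum unchanged. *)
Definition eigenfunction (mu : R) (f : 'rV[R]_d -> R) : Prop :=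
  [/\ periodic f, continuously_diff 2 f &
      forall x, - laplacian f x = mu * f x].

End torus.

(* Lebesgue integral over [0, L)^n, as an iterated integral (the two agree for
   nonnegative measurable and for bounded measurable integrands). *)
Fixpoint box_integral {R : realType} (L : {posnum R}) (n : nat) :
    ('rV[R]_n -> \bar R) -> \bar R :=
  match n with
  | 0 => fun f => f 0
  | n'.+1 => fun f =>
      (\int[lebesgue_measure]_(a in `[0%R, L%:num[%classic)
         box_integral L (fun v : 'rV[R]_n' =>
           f (row_mx (const_mx a : 'rV[R]_1) v)))%E
  end.

(* The spectral decomposition of -Laplacian on the torus of unit volume.  Only
   the index is shifted: eigval k and eigfun k are lambda_(k+1) and
   phi^(k+1).  The last field says that eigenvalues are listed with their full
   multiplicity. *)
Record torus_spectrum (R : realType) (d : nat) := TorusSpectrum {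
  eigval : nat -> R;
  eigfun : nat -> 'rV[R]_d -> R;
  eigval0 : eigval 0 = 0;
  eigval1_gt0 : 0 < eigval 1;
  eigval_ndecr : {homo eigval : j k / (j <= k)%N >-> j <= k};
  eigfunP : forall k, eigenfunction (eigval k) (eigfun k);
  eigfun_orthonormal : forall j k,
    box_integral 1%:pos (fun x => (eigfun j x * eigfun k x)%:E) =
    ((j == k)%:R)%:E;
  eigfun_span : forall mu f, eigenfunction mu f ->
    exists n (c : nat -> R), forall x, f x = \sum_(k < n) c k * eigfun k x
}.

Definition heat_kernel {R : realType} {d : nat} (S : torus_spectrum R d)
    (L : {posnum R}) (t : R) (x y : 'rV[R]_d) : R :=
  L%:num ^- d *
  limn (fun n => \sum_(k < n) expR (- (eigval S k * t * L%:num ^- 2)) *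
          eigfun S k (L%:num^-1 *: x) * eigfun S k (L%:num^-1 *: y)).

(* Continuous paths [0, t] -> Lambda_L, extended by 0 outside [0, t]. *)
Record torus_path {R : realType} (d : nat) (L : {posnum R}) (t : R) :=
  TorusPath {
  path_at :> R -> 'rV[R]_d;
  path_torus : forall s, 0 <= s <= t -> torus L (path_at s);
  path_out : forall s, ~~ (0 <= s <= t) -> path_at s = 0;
  path_continuous : forall s, 0 <= s <= t -> forall e, 0 < e ->
    exists2 eta, 0 < eta & forall s', 0 <= s' <= t -> `|s - s'| < eta ->
      torus_dist L (path_at s) (path_at s') < e
}.

Section path_space.
Context {R : realType} (d : nat) (L : {posnum R}) (t : R).

Lemma torus_dist_xx (x : 'rV[R]_d) : torus_dist L x x = 0.
Proof.
have enorm_ge0 (v : 'rV[R]_d) : 0 <= enorm v by exact: sqrtr_ge0.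
apply/eqP; rewrite eq_le; apply/andP; split; last first.
  apply: lb_le_inf; first by exists (enorm (x - x - L%:num *: map_mx intr 0)), 0.
  by move=> _ [k _ <-].
apply: ge_inf; first by exists 0 => _ [k _ <-].
exists 0 => //; rewrite subrr sub0r map_mx0 scaler0 oppr0 /enorm big1 ?sqrtr0//.
by move=> i _; rewrite mxE expr0n.
Qed.

Lemma zero_path_torus s : 0 <= s <= t -> torus L (0 : 'rV[R]_d).
Proof. by move=> _ i; rewrite mxE lexx /=. Qed.

Lemma zero_path_continuous s : 0 <= s <= t -> forall e, 0 < e ->
  exists2 eta, 0 < eta & forall s', 0 <= s' <= t -> `|s - s'| < eta ->
    torus_dist L (0 : 'rV[R]_d) 0 < e.
Proof. by move=> _ e e0; exists 1 => // s' _ _; rewrite torus_dist_xx. Qed.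

HB.instance Definition _ := gen_eqMixin (torus_path d L t).
HB.instance Definition _ := gen_choiceMixin (torus_path d L t).
HB.instance Definition _ := isPointed.Build (torus_path d L t)
  (@TorusPath R d L t (fun=> 0) zero_path_torus (fun _ _ => erefl)
    zero_path_continuous).

Definition path_cylinders : set (set (torus_path d L t)) :=
  [set A | exists s (i : 'I_d) (B : set R),
     [/\ 0 <= s <= t, measurable B & A = [set w : torus_path d L t | B (w s 0 i)]]].

End path_space.

Notation path_space d L t := (g_sigma_algebraType (@path_cylinders _ d L t)).

Section bridge.
Context {R : realType} {d : nat} (S : torus_spectrum R d) (L : {posnum R}).

Definition box (B : 'I_d -> set R) : set 'rV[R]_d :=
  [set z | forall i, B i (z 0 i)].

(* For times s < s_1 < ... < s_n < t and l = [:: (s_1, B_1); ...; (s_n, B_n)]: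
   the integral over z_1 in B_1, ..., z_n in B_n of
   p_(s_1 - s)(x, z_1) p_(s_2 - s_1)(z_1, z_2) ... p_(t - s_n)(z_n, y). *)
Fixpoint bridge_fdd (t : R) (y : 'rV[R]_d) (s : R) (x : 'rV[R]_d)
    (l : seq (R * ('I_d -> set R))) : \bar R :=
  if l is q :: l' then
    box_integral L (fun z =>
      ((\1_(box q.2) z * heat_kernel S L (q.1 - s) x z)%:E *
       bridge_fdd t y q.1 z l')%E)
  else (heat_kernel S L (t - s) x y)%:E.

Fixpoint path_hits (t : R) (l : seq (R * ('I_d -> set R)))
    (w : torus_path d L t) : Prop :=
  if l is q :: l' then box q.2 (w q.1) /\ path_hits l' w else True.

(* The unnormalized Brownian bridge measures, characterized by their
   finite-dimensional distributions; an empty list of times gives the total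
   mass p_t(x, y). *)
Record brownian_bridge := BrownianBridge {
  bridge : 'rV[R]_d -> 'rV[R]_d ->
    forall t : R, {measure set (path_space d L t) -> \bar R};
  bridgeP : forall (x y : 'rV[R]_d) (t : R) (l : seq (R * ('I_d -> set R))),
    torus L x -> torus L y ->
    path <%R 0 (rcons (map fst l) t) ->
    (forall q, q \in l -> forall i, measurable (q.2 i)) ->
    bridge x y t [set w : torus_path d L t | path_hits l w] = bridge_fdd t y 0 x l
}.

End bridge.

(* A loop of length j is a path of duration beta j. *)
Definition loop {R : realType} (d : nat) (L : {posnum R}) (beta : R) :=
  {j : nat & path_space d L (beta * j%:R)}.

Definition loop_length {R : realType} {d : nat} {L : {posnum R}} {beta : R}
  (w : loop d L beta) : nat := projT1 w.

Section loop_soup.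
Context {R : realType} {d : nat} (S : torus_spectrum R d) (L : {posnum R}).
Context (beta : R).

Definition measurable_loops (A : set (loop d L beta)) : Prop :=
  forall j, measurable [set w : path_space d L (beta * j%:R) | A (existT _ j w)].

Definition loop_intensity (W : brownian_bridge S L) (N : nat)
    (A : set (loop d L beta)) : \bar R :=
  (\sum_(1 <= j < N.+1) (j%:R^-1)%:E *
     box_integral L (fun x =>
       bridge W x x (beta * j%:R) [set w | A (existT _ j w)]))%E.

(* The library's poisson_pmf is constantly 1 at rate 0, whereas rate 0 has to
   give the point mass at 0. *)
Definition poisson (r : R) (k : nat) : R := expR (- r) * r ^+ k / k`!%:R.

(* The Poisson point process of loops.  The intensity measure is finite, so a
   configuration is a finite multiset of loops, listed here in some order. *)
Record loop_soup (N : nat) := LoopSoup {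
  soup_bridge : brownian_bridge S L;
  soup_display : measure_display;
  soup_space : measurableType soup_display;
  soup_prob : probability soup_space R;
  soup_loops : soup_space -> seq (loop d L beta);
  soup_measurable : forall A k, measurable_loops A ->
    measurable [set o | count (mem A) (soup_loops o) = k];
  soup_poisson : forall n (A : 'I_n -> set (loop d L beta)) (k : 'I_n -> nat),
    (forall i, measurable_loops (A i)) -> trivIset setT A ->
    soup_prob [set o | forall i, count (mem (A i)) (soup_loops o) = k i] =
    (\prod_(i < n) poisson (fine (loop_intensity soup_bridge N (A i))) (k i))%:E
}.

Definition particle_number (N : nat) (X : loop_soup N) (o : soup_space X) :
    nat :=
  \sum_(w <- soup_loops o) loop_length w.

Definition particle_prob (N : nat) (X : loop_soup N) (m : nat) : R :=
  fine (soup_prob X [set o | particle_number o = m]).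

(* N stands for the integer rho L^d. *)
Definition density_matrix (N : nat) (X : loop_soup N) (x y : 'rV[R]_d) : R :=
  \sum_(1 <= r < N.+1)
    heat_kernel S L (beta * r%:R) x y * particle_prob X (N - r) /
    particle_prob X N.

End loop_soup.

Definition zeta {R : realType} (s : R) : R :=
  limn (fun n => \sum_(k < n) k.+1%:R `^ (- s)).

Definition rho_c {R : realType} (d : nat) (beta : R) : R :=
  (4 * pi * beta) `^ (- (d%:R / 2)) * zeta (d%:R / 2).

Definition comparable_by {R : realType} (C A B : R) : Prop :=
  C^-1 * A <= B <= C * A.

Definition critical_decay {R : realType} (d : nat) (L : R) : R :=
  if d == 4%N then L ^- 2 * Num.sqrt (ln L) else L `^ (- (d%:R / 2)).

(* Main.v *)
(* The eigenfunctions of the torus enter only through sums over an eigenspace, which can be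
   computed with trigonometric waves instead; so the heat kernel is a product of theta
   functions and t_j = z(s_j) with s_j = beta j / L^2 and z(s) = theta(s, 0)^d.  By Poisson
   summation z(s) - 1 is (4 pi s)^(-d/2) up to O((1 + s)^-2), and decays fast for large s.

   Split the Poisson rates as t_j / j = 1 / j + b_j.  The generating function of the rates
   1 / j is 1 / (1 - x), so P(N_L = m) = exp(- (1 + 1/2 + ... + 1/N)) P(Y <= m) for m <= N,
   where Y is compound Poisson with rates b_j, and the density matrix becomes
   sum_r p_{beta r}(x, y) P(Y <= N - r) / P(Y <= N).  At the critical density Y has mean
   N + O(L^2) and variance of order L^d (L^4 log L if d = 4), which dominates L^4, and its
   fourth cumulant is bounded by the squared variance.  Hence P(Y <= N) is bounded below,
   E (N - Y)_+ = sum_{m < N} P(Y <= m) is of the order of the standard deviation, and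
   p_{beta r}(x, y) is of order L^-d for the relevant r, namely r >= L^2 / beta. *)
Require Import Defs.
From mathcomp Require Import all_boot all_order all_algebra.
From mathcomp Require Import all_classical all_reals all_analysis.
From mathcomp Require Import ring lra zify.

Set Implicit Arguments.
Unset Strict Implicit.
Unset Printing Implicit Defensive.

Import Order.TTheory GRing.Theory Num.Theory.
Import numFieldNormedType.Exports.

Local Open Scope classical_set_scope.
Local Open Scope ring_scope.

(** * Integrals over the unit box *)

Section unit_interval.
Context {R : realType}.
Implicit Types f g F : R -> R.

(** Since constants are free, no local limit theorem is needed. For dist(x, y) > eps L the theta
    product is bounded at all times, and it is at least 2^-d once beta r >= L^2. Restricting the
    lower bound to these r costs at most L^2 / beta terms of the sum of the P(Y <= m). This loss and
    the shift of the mean are harmless only because the standard deviation divided by L^2 is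
    unbounded; for d = 4 this ratio grows merely like sqrt(log L), so the errors must be O(L^2)
    without a logarithm, which fixes the exponent 2 in the error for z(s) - 1. From above, E (N -
    Y)_+ is controlled by the variance; from below the fourth moment must exclude that the variance
    comes from rare large values. Both bounds, and the one on P(Y <= N), compare the positive part
    with polynomials, so four moments suffice. On the analytic side the spectrum is any one
    satisfying the axioms: its eigenfunctions are not explicit, and a partial sum in the order of
    eigenvalues may stop inside an eigenspace. *)

Lemma continuous_sum (T : topologicalType) (I : Type) (r : seq I) (P : pred I)
    (f : I -> T -> R) : (forall i, continuous (f i)) ->
  continuous (fun x => \sum_(i <- r | P i) f i x).
Proof.
move=> cf; elim: r => [|i r IH] x.
  by under eq_fun do rewrite big_nil; exact: cst_continuous.
under eq_fun do rewrite big_cons.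
by case: (P i); [apply: cvgD; [exact: cf|exact: IH]|exact: IH].
Qed.

Definition int01 f : R := \int[lebesgue_measure]_(x in `[0%R, 1%R[) f x.

Lemma continuous_integrable01 f : continuous f ->
  (@lebesgue_measure R).-integrable `[0%R, 1%R[ (EFin \o f).
Proof.
move=> cf; apply: (@integrableS _ _ R (@lebesgue_measure R) `[0%R, 1%R]%classic) => //.
  by apply: subset_itvl; rewrite bnd_simp.
by apply: continuous_compact_integrable; [exact: segment_compact|exact: continuous_subspaceT].
Qed.

Lemma EFin_int01 f : continuous f ->
  (\int[lebesgue_measure]_(x in `[0%R, 1%R[) (f x)%:E)%E = (int01 f)%:E.
Proof.
move=> cf; rewrite /int01 /Rintegral fineK//.
by apply: integrable_fin_num => //; exact: continuous_integrable01.
Qed.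

Lemma eq_int01 f g : f =1 g -> int01 f = int01 g.
Proof. by move=> fg; apply: eq_Rintegral => x _. Qed.

Lemma int01D f g : continuous f -> continuous g ->
  int01 (fun x => f x + g x) = int01 f + int01 g.
Proof. by move=> cf cg; apply: RintegralD => //; exact: continuous_integrable01. Qed.

Lemma int01B f g : continuous f -> continuous g ->
  int01 (fun x => f x - g x) = int01 f - int01 g.
Proof. by move=> cf cg; apply: RintegralB => //; exact: continuous_integrable01. Qed.

Lemma int01Z f c : continuous f -> int01 (fun x => c * f x) = c * int01 f.
Proof. by move=> cf; apply: RintegralZl => //; exact: continuous_integrable01. Qed.

Lemma int01_cst (c : R) : int01 (fun=> c) = c.
Proof.
have mu1 : lebesgue_measure (`[0, 1[%classic : set R) = 1%E.
  by rewrite lebesgue_measure_itv/= lte_fin ltr01 oppr0 adde0.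
by rewrite /int01 Rintegral_cst//= mu1 /= mulr1.
Qed.

Lemma int01_le f g : continuous f -> continuous g ->
  (forall x, 0 <= x < 1 -> f x <= g x) -> int01 f <= int01 g.
Proof.
by move=> cf cg fg; apply: le_Rintegral => //; exact: continuous_integrable01.
Qed.

Lemma int01_norm_le f (c : R) : continuous f ->
  (forall x, 0 <= x < 1 -> `|f x| <= c) -> `|int01 f| <= c.
Proof.
move=> cf fc.
have cc (k : R) : continuous (fun _ : R => k) by move=> x; exact: cst_continuous.
rewrite ler_norml -{2}(int01_cst c) -(int01_cst (- c)).
by apply/andP; split; apply: int01_le => // x /fc; rewrite ler_norml => /andP[].
Qed.

Lemma int01_FTC f F : continuous f ->
  (forall x : R, is_derive x (1 : R) F (f x)) -> int01 f = F 1 - F 0.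
Proof.
move=> cf dF; rewrite /int01 Rintegral_itv_bndo_bndc; last exact: continuous_integrable01.
have cF : continuous F.
  by move=> x; apply: differentiable_continuous; apply/derivable1_diffP; have [] := dF x.
rewrite /Rintegral (@continuous_FTC2 _ f F)//.
- exact: continuous_subspaceT.
- split => [x _| |].
  + by have [] := dF x.
  + by apply: cvg_at_right_filter; exact: cF.
  + by apply: cvg_at_left_filter; exact: cF.
- by move=> x _; rewrite derive1E; exact: derive_val.
Qed.

Lemma int01_gt0 f (x0 : R) : continuous f -> (forall x, 0 <= x < 1 -> 0 <= f x) ->
  0 <= x0 < 1 -> 0 < f x0 -> 0 < int01 f.
Proof.
move=> cf f0 /andP[x00 x01] fx0.
have /cvgrPdist_lt /(_ (f x0 / 2)) := cf x0.
rewrite divr_gt0// => /(_ isT) [e /= e0 He].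
(* As [x0 < 1], a right neighbourhood of [x0] of positive length fits into the half-open
   interval. *)
pose b := Num.min (x0 + e) 1.
have x0b : x0 < b by rewrite lt_min x01 ltrDl e0.
have sub : `[x0, b[%classic `<=` `[0, 1[%classic.
  by apply: subset_itv; rewrite bnd_simp // /b ge_min lexx orbT.
have fi := continuous_integrable01 cf.
have fi2 : (@lebesgue_measure R).-integrable `[x0, b[ (EFin \o f) by exact: integrableS fi.
have mu1 : lebesgue_measure (`[x0, b[%classic : set R) = (b - x0)%:E.
  by rewrite lebesgue_measure_itv/= lte_fin x0b.
apply: (@lt_le_trans _ _ (\int[lebesgue_measure]_(x in `[x0, b[) f x)).
  apply: (@lt_le_trans _ _ (\int[lebesgue_measure]_(x in `[x0, b[) (f x0 / 2))).
    by rewrite Rintegral_cst//= mu1 /= mulr_gt0 ?divr_gt0// subr_gt0.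
  apply: le_Rintegral => //.
    have ci : continuous (fun _ : R => f x0 / 2) by move=> x; exact: cst_continuous.
    by have := continuous_integrable01 ci; exact: integrableS.
  move=> x /=; rewrite in_itv/= => /andP[x0x xb].
  have : `|f x0 - f x| < f x0 / 2.
    apply: He => /=; rewrite distrC ger0_norm ?subr_ge0// ltrBlDl.
    by apply: (lt_le_trans xb); rewrite /b ge_min lexx.
  by rewrite ltr_norml => /andP[_]; lra.
rewrite /int01 -[X in _ <= Rintegral _ X _](setDUK sub) Rintegral_setU//=.
- rewrite lerDl; apply: Rintegral_ge0 => x [] /=; rewrite in_itv/= => x01' _.
  exact: f0.
- by apply: measurableD.
- by rewrite setDUK.
- by apply/disj_setPS => x [] /= H [].
Qed.

End unit_interval.

(** * Averages of uniformly continuous functions over the unit cube *)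

Section box_average.
Context {R : realType}.

(** Unlike plain continuity, this property passes to slices with a common modulus, so the average
    over the remaining coordinates is continuous in the first one, and every iterated integral is
    one of a continuous function. *)
Definition unif_cont n (f : 'rV[R]_n -> R) : Prop := forall e : R, 0 < e ->
  exists2 d : R, 0 < d & forall x y : 'rV[R]_n, (forall i, `|x 0 i - y 0 i| < d) ->
    `|f x - f y| <= e.

Definition slice n (f : 'rV[R]_n.+1 -> R) (a : R) : 'rV[R]_n -> R :=
  fun v => f (row_mx (const_mx a : 'rV_1) v).

Fixpoint box_avg n : ('rV[R]_n -> R) -> R :=
  match n with
  | 0 => fun f => f 0
  | n'.+1 => fun f => int01 (fun a => box_avg (slice f a))
  end.

Lemma row_mx_close n (a b : R) (v w : 'rV[R]_n) (d : R) (i : 'I_n.+1) : `|a - b| < d ->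
  (forall j, `|v 0 j - w 0 j| < d) ->
  `|(row_mx (const_mx a : 'rV_1) v) 0 i - (row_mx (const_mx b : 'rV_1) w) 0 i| < d.
Proof.
by move=> ab vw; rewrite !mxE; case: splitP => j _; rewrite ?mxE.
Qed.

Lemma unif_cont_slice n (f : 'rV[R]_n.+1 -> R) a : unif_cont f -> unif_cont (slice f a).
Proof.
move=> uf e /uf[d d0 H]; exists d => // x y xy; apply: H => i.
by apply: row_mx_close => //; rewrite subrr normr0.
Qed.

Lemma unif_cont_lin n (f g : 'rV[R]_n -> R) (c : R) : unif_cont f -> unif_cont g ->
  unif_cont (fun x => f x + c * g x).
Proof.
move=> uf ug e e0.
have [d1 d10 H1] := uf (e / 2) (divr_gt0 e0 (ltr0n _ 2)).
have c1 : 0 < `|c| + 1 by rewrite ltr_wpDl.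
have [d2 d20 H2] := ug (e / 2 / (`|c| + 1)) (divr_gt0 (divr_gt0 e0 (ltr0n _ 2)) c1).
have [m1 m2] : Num.min d1 d2 <= d1 /\ Num.min d1 d2 <= d2 by rewrite !ge_min !lexx orbT.
exists (Num.min d1 d2); first by rewrite lt_min d10.
move=> x y xy.
have := H1 x y (fun i => lt_le_trans (xy i) m1).
have := H2 x y (fun i => lt_le_trans (xy i) m2).
rewrite ler_pdivlMr// => h2 h1.
have -> : f x + c * g x - (f y + c * g y) = (f x - f y) + c * (g x - g y) by ring.
apply: (le_trans (ler_normD _ _)); rewrite normrM.
have : `|c| * `|g x - g y| <= `|g x - g y| * (`|c| + 1).
  by rewrite mulrC ler_wpM2l// lerDl.
by lra.
Qed.

Lemma unif_cont_cst n (c : R) : unif_cont (fun _ : 'rV[R]_n => c).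
Proof. by move=> e e0; exists 1 => // x y _; rewrite subrr normr0 ltW. Qed.

Lemma unif_cont_sum n (I : eqType) (r : seq I) (P : pred I) (f : I -> 'rV[R]_n -> R) :
  (forall i, unif_cont (f i)) -> unif_cont (fun x => \sum_(i <- r | P i) f i x).
Proof.
move=> uf; elim: r => [|i r IH].
  by under eq_fun do rewrite big_nil; exact: unif_cont_cst.
rewrite (_ : (fun _ => _) = fun x => \sum_(j <- r | P j) f j x + (P i)%:R * f i x).
  exact: unif_cont_lin.
by apply/funext => x; rewrite big_cons; case: (P i); rewrite ?mul1r ?mul0r ?addr0// addrC.
Qed.

Lemma unif_cont_mul n (f g : 'rV[R]_n -> R) (A B : R) : unif_cont f -> unif_cont g ->
  (forall x, `|f x| <= A) -> (forall x, `|g x| <= B) ->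
  unif_cont (fun x => f x * g x).
Proof.
move=> uf ug fA gB e e0.
have A0 : 0 <= A := le_trans (normr_ge0 _) (fA 0).
have B0 : 0 <= B := le_trans (normr_ge0 _) (gB 0).
have e'0 : 0 < e / (A + B + 1) by rewrite divr_gt0//; lra.
have [d1 d10 H1] := uf _ e'0; have [d2 d20 H2] := ug _ e'0.
have [m1 m2] : Num.min d1 d2 <= d1 /\ Num.min d1 d2 <= d2 by rewrite !ge_min !lexx orbT.
exists (Num.min d1 d2); first by rewrite lt_min d10.
move=> x y xy.
have h1 := H1 x y (fun i => lt_le_trans (xy i) m1).
have h2 := H2 x y (fun i => lt_le_trans (xy i) m2).
have -> : f x * g x - f y * g y = (f x - f y) * g x + f y * (g x - g y) by ring.
apply: (le_trans (ler_normD _ _)); rewrite !normrM.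
apply: (@le_trans _ _ (e / (A + B + 1) * B + A * (e / (A + B + 1)))).
  by rewrite lerD// ler_pM.
have -> : e / (A + B + 1) * B + A * (e / (A + B + 1)) = e * ((A + B) / (A + B + 1)) by ring.
rewrite -[leRHS]mulr1 ler_wpM2l ?(ltW e0)// ler_pdivrMr; lra.
Qed.

Lemma box_avg_diff n (f g : 'rV[R]_n -> R) (e : R) : unif_cont f -> unif_cont g ->
  (forall x, `|f x - g x| <= e) -> `|box_avg f - box_avg g| <= e.
Proof.
elim: n f g e => [|n IH] f g e uf ug fg /=; first exact: fg.
(* The induction hypothesis, applied to two slices of the same function, makes the inner average
   continuous in the outer coordinate. *)
have cont (h : 'rV[R]_n.+1 -> R) : unif_cont h -> continuous (fun a => box_avg (slice h a)).
  move=> uh x; apply/cvgrPdist_le => e0 e00.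
  have [d d0 H] := uh _ e00.
  near=> y; apply: IH; [exact: unif_cont_slice|exact: unif_cont_slice|].
  move=> v; apply: H => i; apply: row_mx_close; last by move=> j; rewrite subrr normr0.
  by near: y; apply: cvgr_dist_lt => //; exact: cvg_id.
rewrite -int01B; [|exact: cont|exact: cont].
apply: int01_norm_le.
  by move=> x; apply: cvgB; exact: cont.
move=> x _; apply: IH; [exact: unif_cont_slice|exact: unif_cont_slice|].
by move=> v; exact: fg.
Unshelve. all: by end_near. Qed.

Lemma box_avg_slice_continuous n (f : 'rV[R]_n.+1 -> R) : unif_cont f ->
  continuous (fun a => box_avg (slice f a)).
Proof.
move=> uf x; apply/cvgrPdist_le => e e0; have [d d0 H] := uf _ e0.
near=> y; apply: box_avg_diff; [exact: unif_cont_slice|exact: unif_cont_slice|].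
move=> v; apply: H => i; apply: row_mx_close; last by move=> j; rewrite subrr normr0.
by near: y; apply: cvgr_dist_lt => //; exact: cvg_id.
Unshelve. all: by end_near. Qed.

Lemma box_integral_avg n (f : 'rV[R]_n -> R) : unif_cont f ->
  box_integral 1%:pos (fun x => (f x)%:E) = (box_avg f)%:E.
Proof.
elim: n f => [//|n IH] f uf /=.
rewrite -EFin_int01; last exact: box_avg_slice_continuous.
by apply: eq_integral => a _; rewrite -IH//; exact: unif_cont_slice.
Qed.

Lemma eq_box_avg n (f g : 'rV[R]_n -> R) : f =1 g -> box_avg f = box_avg g.
Proof. by move=> /funext ->. Qed.

Lemma box_avg_lin n (f g : 'rV[R]_n -> R) (c : R) : unif_cont f -> unif_cont g ->
  box_avg (fun x => f x + c * g x) = box_avg f + c * box_avg g.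
Proof.
elim: n f g => [//|n IH] f g uf ug /=.
have cf := box_avg_slice_continuous uf; have cg := box_avg_slice_continuous ug.
rewrite -int01Z// -int01D//.
  by apply: eq_int01 => a; rewrite -IH//; exact: unif_cont_slice.
by move=> x; apply: cvgM; [exact: cvg_cst|exact: cg].
Qed.

Lemma box_avg_cst n (c : R) : box_avg (fun _ : 'rV[R]_n => c) = c.
Proof.
elim: n => [//|n IH] /=; rewrite -[RHS]int01_cst; apply: eq_int01 => a.
exact: IH.
Qed.

Lemma box_avgZ n (f : 'rV[R]_n -> R) (c : R) : unif_cont f ->
  box_avg (fun x => c * f x) = c * box_avg f.
Proof.
move=> uf; rewrite -[RHS]add0r -[X in X + _](box_avg_cst n 0) -box_avg_lin//.
  by apply: eq_box_avg => x; rewrite add0r.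
exact: unif_cont_cst.
Qed.

Lemma box_avg_sum n (I : eqType) (r : seq I) (P : pred I) (f : I -> 'rV[R]_n -> R) :
  (forall i, unif_cont (f i)) ->
  box_avg (fun x => \sum_(i <- r | P i) f i x) = \sum_(i <- r | P i) box_avg (f i).
Proof.
move=> uf; elim: r => [|i r IH].
  by under eq_fun do rewrite big_nil; rewrite big_nil box_avg_cst.
rewrite (_ : (fun _ => _) = fun x => \sum_(j <- r | P j) f j x + (P i)%:R * f i x).
  rewrite box_avg_lin//; last exact: unif_cont_sum.
  by rewrite IH big_cons; case: (P i); rewrite ?mul1r ?mul0r ?addr0// addrC.
by apply/funext => x; rewrite big_cons; case: (P i); rewrite ?mul1r ?mul0r ?addr0// addrC.
Qed.

Lemma box_avg_le n (f g : 'rV[R]_n -> R) : unif_cont f -> unif_cont g ->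
  (forall x, f x <= g x) -> box_avg f <= box_avg g.
Proof.
elim: n f g => [|n IH] f g uf ug fg /=; first exact: fg.
apply: int01_le; [exact: box_avg_slice_continuous|exact: box_avg_slice_continuous|].
by move=> a _; apply: IH; [exact: unif_cont_slice|exact: unif_cont_slice|move=> v; exact: fg].
Qed.

Lemma box_avg_gt0 n (f : 'rV[R]_n -> R) (x0 : 'rV[R]_n) : unif_cont f -> (forall x, 0 <= f x) ->
  (forall i, 0 <= x0 0 i < 1) -> 0 < f x0 -> 0 < box_avg f.
Proof.
elim: n f x0 => [|n IH] f x0 uf f0 x01 fx0 /=.
  by rewrite (_ : 0 = x0)//; apply/rowP => -[].
pose u : 'rV[R]_(1 + n) := x0.
have ux : u = row_mx (const_mx (x0 0 ord0)) (rsubmx u).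
  rewrite -[LHS]hsubmxK; congr row_mx; apply/rowP => i; rewrite !mxE ord1.
  by congr (x0 _ _); apply/val_inj.
apply: (@int01_gt0 _ _ (x0 0 ord0)) => //; first exact: box_avg_slice_continuous.
  move=> a _; rewrite -(box_avg_cst n 0); apply: box_avg_le => //.
  - exact: unif_cont_cst.
  - exact: unif_cont_slice.
  - by move=> v; exact: f0.
apply: (IH _ (rsubmx u)) => //; first exact: unif_cont_slice.
- by move=> v; exact: f0.
- by move=> i; rewrite mxE; exact: x01.
- by rewrite /slice -ux.
Qed.

End box_average.

(** * Trigonometric waves *)

Section derivatives.
Context {R : realType}.
Implicit Types (f g : R -> R) (x c df dg : R).

Lemma is_derive_val x f df df' : is_derive x (1 : R) f df -> df = df' ->
  is_derive x (1 : R) f df'.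
Proof. by move=> H <-. Qed.

Lemma is_derive_fun_cst x c : is_derive x (1 : R) (fun=> c) 0.
Proof. exact: is_derive_cst. Qed.

Lemma is_derive_fun_id x : is_derive x (1 : R) (fun y : R => y) 1.
Proof. exact: is_derive_id. Qed.

Lemma is_derive_funD x f g df dg : is_derive x (1 : R) f df -> is_derive x (1 : R) g dg ->
  is_derive x (1 : R) (fun y => f y + g y) (df + dg).
Proof. by move=> Hf Hg; exact: is_deriveD. Qed.

Lemma is_derive_funM x f g df dg : is_derive x (1 : R) f df -> is_derive x (1 : R) g dg ->
  is_derive x (1 : R) (fun y => f y * g y) (df * g x + f x * dg).
Proof.
move=> Hf Hg; have := @is_deriveM _ _ f g x 1 df dg Hf Hg.
by move=> H; apply: (is_derive_eq H); rewrite addrC -![_ *: _]/(_ * _) (mulrC df).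
Qed.

Lemma is_derive_fun_comp x f g df dg : is_derive (g x) (1 : R) f df ->
  is_derive x (1 : R) g dg -> is_derive x (1 : R) (fun y => f (g y)) (df * dg).
Proof. by move=> Hf Hg; exact: is_derive1_comp. Qed.

Lemma is_derive_fun_sum x (I : Type) (r : seq I) (f : I -> R -> R) (df : I -> R) :
  (forall i, is_derive x (1 : R) (f i) (df i)) ->
  is_derive x (1 : R) (fun y => \sum_(i <- r) f i y) (\sum_(i <- r) df i).
Proof.
move=> H; elim: r => [|i r IH].
  rewrite big_nil (_ : (fun _ => _) = fun=> 0); first exact: is_derive_fun_cst.
  by apply/funext => y; rewrite big_nil.
rewrite big_cons (_ : (fun _ => _) = fun y => f i y + \sum_(j <- r) f j y).
  exact: is_derive_funD.
by apply/funext => y; rewrite big_cons.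
Qed.

Lemma is_derive_fun_affine x (a b : R) : is_derive x (1 : R) (fun y => a * y + b) a.
Proof.
apply: (is_derive_val (is_derive_funD (is_derive_funM (is_derive_fun_cst x a)
  (is_derive_fun_id x)) (is_derive_fun_cst x b))).
by rewrite mul0r add0r mulr1 addr0.
Qed.

End derivatives.

Section trigonometry.
Context {R : realType}.

Lemma MVT_norm_le (f df : R -> R) (c a b : R) :
  (forall x, is_derive x (1 : R) f (df x)) ->
  (forall x, Num.min a b <= x <= Num.max a b -> `|df x| <= c) ->
  `|f b - f a| <= c * `|b - a|.
Proof.
move=> fdf.
have cf : continuous f.
  by move=> x; apply: differentiable_continuous; apply/derivable1_diffP; have [] := fdf x.
wlog ab : a b / a <= b.
  move=> H dfc; have [ab|/ltW ba] := leP a b; first exact: H.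
  by rewrite distrC [X in _ * X]distrC; apply: H => // x xba; apply: dfc; rewrite minC maxC.
move=> dfc.
have [t tab ->] := @MVT_segment _ f df a b ab (fun x _ => fdf x) (continuous_subspaceT cf).
rewrite normrM ler_wpM2r//; apply: dfc.
by rewrite (min_idPl ab) (max_idPr ab); move: tab; rewrite in_itv.
Qed.

Lemma cos_lipschitz (a b : R) : `|cos a - cos b| <= `|a - b|.
Proof.
rewrite -[leRHS]mul1r; apply: (@MVT_norm_le cos (fun x => - sin x)) => x _.
by rewrite normrN sin_max.
Qed.

Lemma cosD2piz (x : R) (k : int) : cos (x + 2 * pi * k%:~R) = cos x.
Proof.
have pos (y : R) (n : nat) : cos (y + 2 * pi * n%:R) = cos y.
  have -> : 2 * pi * n%:R = pi *+ 2 *+ n :> R by rewrite -[RHS]mulr_natr -[pi *+ 2]mulr_natr (mulrC pi).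
  exact: (periodicn (@cosD2pi R)).
case: k => n; first by rewrite -pmulrn pos.
rewrite NegzE mulrNz mulrN -(pos (x - _) n.+1).
by congr cos; rewrite -pmulrn subrK.
Qed.

Lemma sinD2piz (x : R) (k : int) : sin (x + 2 * pi * k%:~R) = sin x.
Proof.
by rewrite -cosBpihalf -[RHS]cosBpihalf -(cosD2piz (x - _) k); congr cos; ring.
Qed.

(** The cosine decreases on [0, pi], so a large value of cos (2 pi t) bounds the distance from t to
    its nearest integer, floor (t + 1/2). *)
Lemma cos2pi_near_int (t e : R) : 0 < e < 1 / 2 -> cos (2 * pi * e) < cos (2 * pi * t) ->
  exists k : int, `|t - k%:~R| < e.
Proof.
move=> /andP[e0 e1] H; pose k := Num.floor (t + 1 / 2).
have := floor_itv (t + 1 / 2); rewrite -/k intrD => /andP[k1 k2].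
exists k; rewrite ltNge; apply/negP => ek.
have tk : `|t - k%:~R| <= 1 / 2 by rewrite ler_norml; lra.
have ct : cos (2 * pi * t) = cos (2 * pi * `|t - k%:~R|).
  rewrite -(cosD2piz (2 * pi * `|t - k%:~R|) 0) mulr0 addr0 -cos_norm.
  rewrite -[RHS]cos_norm !normrM normr_id -!normrM !cos_norm mulrBr.
  by rewrite -(cosD2piz (_ - _) k) subrK.
move: H; rewrite ct ltNge => /negP; apply.
have pi0 := pi_gt0 R.
have [->//|ne] := eqVneq `|t - k%:~R| e.
have lt : e < `|t - k%:~R| by rewrite lt_neqAle eq_sym ne.
have h1 : 2 * pi * e <= pi.
  by rewrite -[leRHS]mulr1 -mulrA mulrCA ler_wpM2l ?ltW//; lra.
have h2 : 2 * pi * `|t - k%:~R| <= pi.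
  rewrite -[leRHS]mulr1 -mulrA mulrCA ler_wpM2l ?(ltW pi0)//.
  by move: tk; set u := `|_|; lra.
apply/ltW; rewrite ltr_cos ?in_itv/= ?h1 ?h2 ?andbT.
- by rewrite ltr_pM2l// mulr_gt0.
- by rewrite !mulr_ge0// ltW.
- by rewrite !mulr_ge0// ltW.
Qed.

End trigonometry.

(** * Orthogonality and completeness of the waves *)

Section waves.
Context {R : realType}.

Lemma row_mx_head (T : Type) n (a : T) (v : 'rV[T]_n) :
  (row_mx (const_mx a : 'rV_1) v) 0 (ord0 : 'I_n.+1) = a.
Proof.
have -> : (ord0 : 'I_n.+1) = lshift n (ord0 : 'I_1) by apply/val_inj.
by rewrite row_mxEl mxE.
Qed.

Lemma row_mx_tail (T : Type) n (a : T) (v : 'rV[T]_n) (i : 'I_n) :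
  (row_mx (const_mx a : 'rV_1) v) 0 (lift ord0 i : 'I_n.+1) = v 0 i.
Proof.
have -> : (lift ord0 i : 'I_n.+1) = rshift 1 i by apply/val_inj.
by rewrite row_mxEr.
Qed.

(** The phase lets real cosines do the work of complex exponentials: the phase [- (pi / 2)] gives
    the sine, and differentiation shifts the phase by [pi / 2]. *)
Definition wave n (m : 'rV[int]_n) (p : R) (x : 'rV[R]_n) : R :=
  cos (2 * pi * (\sum_i (m 0 i)%:~R * x 0 i) + p).

Lemma wave_le1 n (m : 'rV[int]_n) (p : R) x : `|wave m p x| <= 1.
Proof. exact: cos_max. Qed.

Lemma unif_cont_wave n (m : 'rV[int]_n) (p : R) : unif_cont (wave m p).
Proof.
move=> e e0; pose M := 2 * pi * (\sum_i `|(m 0 i)%:~R : R|) + 1.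
have M0 : 0 < M.
  by rewrite ltr_wpDl// mulr_ge0 ?sumr_ge0// mulr_ge0// pi_ge0.
exists (e / M); first by rewrite divr_gt0.
move=> x y xy; apply: (le_trans (cos_lipschitz _ _)).
have -> : 2 * pi * (\sum_i (m 0 i)%:~R * x 0 i) + p - (2 * pi * (\sum_i (m 0 i)%:~R * y 0 i) + p)
   = 2 * pi * (\sum_i (m 0 i)%:~R * (x 0 i - y 0 i)).
  under [in RHS]eq_bigr do rewrite mulrBr.
  by rewrite sumrB; ring.
rewrite normrM ger0_norm ?mulr_ge0 ?pi_ge0//.
apply: (@le_trans _ _ (2 * pi * ((\sum_i `|(m 0 i)%:~R : R|) * (e / M)))).
  rewrite ler_wpM2l ?mulr_ge0 ?pi_ge0//; apply: (le_trans (ler_norm_sum _ _ _)).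
  by rewrite mulr_suml; apply: ler_sum => i _; rewrite normrM ler_wpM2l// ltW.
rewrite mulrA mulrCA ger_pMr// ler_pdivrMr// mul1r.
by rewrite /M lerDl.
Qed.

Lemma box_avg_wave n (m : 'rV[int]_n) (p : R) : box_avg (wave m p) = (m == 0)%:R * cos p.
Proof.
elim: n m p => [|n IH] m p /=.
  rewrite /wave big_ord0 mulr0 add0r (_ : m == 0) ?mul1r//.
  by apply/eqP/rowP => -[].
pose t : 'rV[int]_n := \row_i m 0 (lift ord0 i).
have sl a : slice (wave m p) a =1 wave t (2 * pi * ((m 0 ord0)%:~R * a) + p).
  move=> v; rewrite /slice /wave big_ord_recl row_mx_head; congr cos.
  under eq_bigr do rewrite row_mx_tail.
  by under [in RHS]eq_bigr do rewrite mxE; ring.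
under eq_int01 do rewrite (eq_box_avg (sl _)) IH.
have -> : (m == 0) = (m 0 ord0 == 0) && (t == 0).
  apply/eqP/andP => [m0|[/eqP m0 /eqP t0]].
    by split; [rewrite m0 mxE|apply/eqP/rowP => i; rewrite !mxE m0 mxE].
  apply/rowP => i; rewrite mxE; have [j ->|->//] := unliftP ord0 i.
  by move/rowP : t0 => /(_ j); rewrite !mxE.
have cc (a b : R) : continuous (fun x : R => cos (a * x + b)).
  move=> x; apply: (@continuous_comp _ _ _ (fun x : R => a * x + b) cos); last exact: continuous_cos.
  by apply: cvgD; [apply: cvgM; [exact: cvg_cst|exact: cvg_id]|exact: cvg_cst].
rewrite (eq_int01 (g := fun a => (t == 0)%:R * cos (2 * pi * (m 0 ord0)%:~R * a + p))); last first.
  by move=> a; rewrite mulrA.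
rewrite int01Z//; have [m0|m0] := eqVneq (m 0 ord0) 0 => /=.
  under eq_int01 do rewrite m0 mulr0 mul0r add0r.
  by rewrite int01_cst.
set w : R := 2 * pi * (m 0 ord0)%:~R.
have w0 : w != 0 by rewrite mulf_neq0 ?mulf_neq0 ?intr_eq0// gt_eqF// pi_gt0.
have dF (x : R) : is_derive x (1 : R) (fun x => w^-1 * sin (w * x + p)) (cos (w * x + p)).
  apply: (is_derive_val (is_derive_funM (is_derive_fun_cst x w^-1)
    (is_derive_fun_comp (is_derive_sin _) (is_derive_fun_affine x w p)))).
  by field.
rewrite mul0r (int01_FTC (cc w p) dF).
by rewrite mulr1 mulr0 add0r (addrC w) sinD2piz subrr mulr0.
Qed.

Lemma waveM n (m m' : 'rV[int]_n) (p p' : R) x :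
  wave m p x * wave m' p' x = 2^-1 * wave (m + m') (p + p') x + 2^-1 * wave (m - m') (p - p') x.
Proof.
rewrite /wave.
set A := 2 * pi * (\sum_i (m 0 i)%:~R * x 0 i) + p.
set C := 2 * pi * (\sum_i (m' 0 i)%:~R * x 0 i) + p'.
have -> : 2 * pi * (\sum_i ((m + m') 0 i)%:~R * x 0 i) + (p + p') = A + C.
  under eq_bigr do rewrite mxE intrD mulrDl.
  by rewrite big_split/= /A /C; ring.
have -> : 2 * pi * (\sum_i ((m - m') 0 i)%:~R * x 0 i) + (p - p') = A - C.
  under eq_bigr do rewrite !mxE intrB mulrBl.
  by rewrite sumrB /A /C; ring.
by rewrite (cosD A C) (cosB A C); field.
Qed.

Lemma periodic_int n (f : 'rV[R]_n -> R) : Defs.periodic f ->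
  forall x (k : 'rV[int]_n), f (x + map_mx intr k) = f x.
Proof.
move=> pf x k.
have pz (i : 'I_n) (z : int) y : f (y + z%:~R *: delta_mx 0 i) = f y.
  have pn (j : nat) y' : f (y' + j%:R *: delta_mx 0 i) = f y'.
    elim: j y' => [|j IH] y'; first by rewrite scale0r addr0.
    by rewrite -[j.+1%:R]natr1 scalerDl scale1r addrA pf IH.
  case: z => j; first by rewrite -pmulrn pn.
  rewrite NegzE mulrNz scaleNr -(pn j.+1 (y - _)).
  by rewrite -pmulrn subrK.
have -> : map_mx intr k = \sum_(i <- enum 'I_n) (k 0 i)%:~R *: delta_mx 0 i :> 'rV[R]_n.
  by rewrite big_enum/= [LHS]row_sum_delta; apply: eq_bigr => i _; rewrite mxE.
elim: (enum 'I_n) x => [|i r IH] x; first by rewrite big_nil addr0.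
by rewrite big_cons addrA IH pz.
Qed.

Lemma continuous_periodic_unif_cont n (f : 'rV[R]_n -> R) : continuous f ->
  Defs.periodic f -> unif_cont f.
Proof.
move=> cf pf e e0.
have cK : compact [set x : 'rV[R]_n | forall i, `[0, 1]%classic (x 0 i)].
  by apply: (@rV_compact R n (fun=> `[0, 1]%classic)) => i; exact: segment_compact.
move/compact_near_coveringP : cK => /(_ R (0:R)^'+ (fun d x => forall y : 'rV[R]_n,
  (forall i, `|x 0 i - y 0 i| < d) -> `|f x - f y| <= e)) H.
have {}H : \forall d \near (0:R)^'+, [set x : 'rV[R]_n | forall i, `[0, 1]%classic (x 0 i)] `<=`
    (fun x => forall y : 'rV[R]_n, (forall i, `|x 0 i - y 0 i| < d) -> `|f x - f y| <= e).
  apply: H => x _.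
  have /cvgrPdist_lt /(_ (e / 2)) := cf x.
  rewrite divr_gt0// => /(_ isT) /nbhs_ballP[r /= r0 Hr].
  exists (ball x (r / 2), [set d | d < r / 2]); first split => /=.
  - by apply: nbhsx_ballx; rewrite divr_gt0.
  - by apply: nbhs_right_lt; rewrite divr_gt0.
  - move=> [x' d] /= [[_ Bx] dr] y xy.
    have xx' i : `|x 0 i - x' 0 i| < r / 2 by have := Bx 0 i.
    have h1 : `|f x - f x'| < e / 2.
      apply: Hr; split => // i j; rewrite (ord1 i) /ball/=.
      by apply: (lt_le_trans (xx' j)); lra.
    have h2 : `|f x - f y| < e / 2.
      apply: Hr; split => // i j; rewrite (ord1 i) /ball/=.
      rewrite -(subrK (x' 0 j) (x 0 j)) -addrA.
      apply: (le_lt_trans (ler_normD _ _)).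
      by have := xx' j; have := lt_trans (xy j) dr; lra.
    rewrite -(subrK (f x) (f x')) -addrA; apply: (le_trans (ler_normD _ _)).
    by rewrite distrC; lra.
have [d [/= d0 {}H]] := filter_ex (filterI (nbhs_right_gt (0 : R)) H).
exists d => // x y xy.
(* Both points are moved by the integer vector that brings [x] into the unit cube; the translate of
   [y] may leave the cube, which [H] allows. *)
pose k : 'rV[int]_n := \row_i - Num.floor (x 0 i).
rewrite -(periodic_int pf x k) -(periodic_int pf y k); apply: H.
  move=> i /=; rewrite !mxE in_itv/= mulrNz subr_ge0.
  have /andP[-> ] := floor_itv (x 0 i); rewrite intrD /= => /ltW.
  by rewrite lerBlDl.
by move=> i; rewrite !mxE opprD addrACA subrr addr0.
Qed.

Lemma continuous_periodic_bounded n (f : 'rV[R]_n -> R) : continuous f ->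
  Defs.periodic f -> exists B, forall x, `|f x| <= B.
Proof.
move=> cf pf.
have cK : compact [set x : 'rV[R]_n | forall i, `[0, 1]%classic (x 0 i)].
  by apply: (@rV_compact R n (fun=> `[0, 1]%classic)) => i; exact: segment_compact.
have /compact_bounded[M [_ Mf]] := continuous_compact (continuous_subspaceT cf) cK.
exists (M + 1) => x.
pose k : 'rV[int]_n := \row_i - Num.floor (x 0 i).
rewrite -(periodic_int pf x k); apply: (Mf (M + 1)); first by rewrite ltrDl.
exists (x + map_mx intr k) => // i /=; rewrite !mxE in_itv/= mulrNz subr_ge0.
have /andP[-> ] := floor_itv (x 0 i); rewrite intrD /= => /ltW.
by rewrite lerBlDl.
Qed.

(** A concentrating kernel: K = prod_i (1 + cos (2 pi (x_i - a_i))) / 2 and its powers are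
    trigonometric polynomials, so f K^k averages to zero for every k. If f a > 0, the region near
    the integer translates of a contributes at least a multiple of p^k, whereas elsewhere K <= Q < p
    and the contribution is O(Q^k): a contradiction for large k. *)
Lemma wave_orth_le0 n (f : 'rV[R]_n -> R) (B : R) (a : 'rV[R]_n) : unif_cont f ->
  Defs.periodic f -> (forall x, `|f x| <= B) ->
  (forall m p, box_avg (fun x => f x * wave m p x) = 0) ->
  (forall i, 0 <= a 0 i < 1) -> f a <= 0.
Proof.
move=> uf pf fB f_orth a01; rewrite leNgt; apply/negP => fa.
pose q i (x : 'rV[R]_n) := (1 + cos (2 * pi * (x 0 i - a 0 i))) / 2.
have qE i x : q i x = 2^-1 + 2^-1 * wave (delta_mx 0 i) (- (2 * pi * a 0 i)) x.
  rewrite /wave (bigD1 i)//= big1 ?addr0 => [|j ji]; last first.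
    by rewrite mxE (negbTE ji) andbF mul0r.
  by rewrite mxE !eqxx mul1r /q -mulrBr; field.
have q01 i x : 0 <= q i x <= 1.
  by rewrite /q; have := cos_geN1 (2 * pi * (x 0 i - a 0 i));
     have := cos_le1 (2 * pi * (x 0 i - a 0 i)); lra.
have uq i : unif_cont (q i).
  rewrite (_ : q i = fun x => 2^-1 + 2^-1 * wave (delta_mx 0 i) (- (2 * pi * a 0 i)) x).
    by apply: unif_cont_lin; [exact: unif_cont_cst|exact: unif_cont_wave].
  by apply/funext => x; exact: qE.
(* Multiplying by [q i] preserves orthogonality because a product of two waves is a half-sum of
   waves; uniform continuity and the bounds are carried along so that averages stay linear. *)
pose orth (h : 'rV[R]_n -> R) := [/\ unif_cont h, (forall x, 0 <= h x <= 1) &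
  forall m p, box_avg (fun x => f x * h x * wave m p x) = 0].
have b1 (h : 'rV[R]_n -> R) : (forall x, 0 <= h x <= 1) -> forall x, `|h x| <= 1.
  by move=> h01 x; have /andP[h0 h1] := h01 x; rewrite ger0_norm.
have orthM h i : orth h -> orth (fun x => h x * q i x).
  move=> [uh h01 hf]; split.
  - by apply: (@unif_cont_mul _ _ _ _ 1 1) => //; exact: b1.
  - move=> x; have /andP[h0 h1] := h01 x; have /andP[q0 q1] := q01 i x.
    by rewrite mulr_ge0//= mulr_ile1.
  - move=> m p.
    have ufh : unif_cont (fun x => f x * h x).
      by apply: (@unif_cont_mul _ _ _ _ B 1) => //; exact: b1.
    have uw m' p' : unif_cont (fun x => f x * h x * wave m' p' x).
      apply: (@unif_cont_mul _ _ _ _ B 1) => //; [exact: unif_cont_wave| |by move=> x; exact: wave_le1].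
      move=> x; rewrite normrM -[leRHS]mulr1.
      by apply: ler_pM => //; exact: b1.
    rewrite (eq_box_avg (g := fun x => (2^-1 * (f x * h x * wave m p x) +
       4^-1 * (f x * h x * wave (delta_mx 0 i + m) (- (2 * pi * a 0 i) + p) x)) +
       4^-1 * (f x * h x * wave (delta_mx 0 i - m) (- (2 * pi * a 0 i) - p) x))).
      rewrite box_avg_lin//; last first.
        apply: unif_cont_lin => //.
        rewrite (_ : (fun _ => _) = fun x => 0 + 2^-1 * (f x * h x * wave m p x)).
          by apply: unif_cont_lin => //; exact: unif_cont_cst.
        by apply/funext => x; rewrite add0r.
      rewrite box_avg_lin//; last first.
        rewrite (_ : (fun _ => _) = fun x => 0 + 2^-1 * (f x * h x * wave m p x)).
          by apply: unif_cont_lin => //; exact: unif_cont_cst.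
        by apply/funext => x; rewrite add0r.
      by rewrite box_avgZ// !hf !mulr0 !addr0.
    move=> x.
    have -> : f x * (h x * q i x) * wave m p x = 2^-1 * (f x * h x * wave m p x) +
        2^-1 * (f x * h x) * (wave (delta_mx 0 i) (- (2 * pi * a 0 i)) x * wave m p x).
      by rewrite qE; ring.
    by rewrite waveM; field.
have orth1 : orth (fun=> 1).
  split; [exact: unif_cont_cst|by move=> x; rewrite ler01 lexx|].
  by move=> m p; under eq_box_avg do rewrite mulr1.
have orth_prod h (r : seq 'I_n) : orth h -> orth (fun x => h x * \prod_(i <- r) q i x).
  elim: r h => [|i r IH] h oh.
    by rewrite (_ : (fun _ => _) = h)//; apply/funext => x; rewrite big_nil mulr1.
  rewrite (_ : (fun _ => _) = fun x => (h x * q i x) * \prod_(j <- r) q j x).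
    by apply: IH; exact: orthM.
  by apply/funext => x; rewrite big_cons mulrA.
pose K x := \prod_i q i x.
have orthK k : orth (fun x => K x ^+ k).
  elim: k => [//|k IH].
  rewrite (_ : (fun _ => _) = fun x => K x ^+ k * \prod_(i <- index_enum 'I_n) q i x).
    exact: orth_prod.
  by apply/funext => x; rewrite exprSr.
have avgK k : box_avg (fun x => f x * K x ^+ k) = 0.
  have [_ _ /(_ 0 0) <-] := orthK k.
  apply: eq_box_avg => x; rewrite /wave big1 ?mulr0 ?addr0 ?cos0 ?mulr1// => i _.
  by rewrite mxE mul0r.
have K01 x : 0 <= K x <= 1.
  by have [_ /(_ x)] := orthK 1%N; rewrite expr1.
have [d0 d00 Hd] := uf (f a / 2) (divr_gt0 fa (ltr0n _ 2)).
(* The cap 1/4 keeps [2 pi d] below [pi], where the cosine is strictly monotone, and meets the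
   condition [d < 1 / 2] of [cos2pi_near_int]. *)
pose d := Num.min d0 4^-1.
have dd : 0 < d < 1 / 2.
  rewrite lt_min d00 invr_gt0 ltr0n/= gt_min; apply/orP; right; lra.
pose Q : R := (1 + cos (2 * pi * d)) / 2.
have pi0 := pi_gt0 R.
have cd1 : -1 < cos (2 * pi * d) < 1.
  have h1 : 0 < 2 * pi * d by rewrite !mulr_gt0//; case/andP: dd.
  have h2 : 2 * pi * d < pi.
    by rewrite -[ltRHS]mulr1 -mulrA mulrCA ltr_pM2l//; lra.
  have e1 := @ltr_cos R (2 * pi * d) pi; have e2 := @ltr_cos R 0 (2 * pi * d).
  rewrite -cospi -[X in _ && (_ < X)]cos0 e1 ?e2 ?h1 ?h2// ?in_itv/= ?lexx ?ltW//.
have Q01 : 0 < Q < 1 by rewrite /Q; lra.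
have near x : Q < K x -> f a / 2 <= f x.
  move=> QK; have Qq i : Q < q i x.
    apply: (lt_le_trans QK); rewrite /K (bigD1 i)//= ler_piMr//; first by case/andP: (q01 i x).
    by apply: prodr_ile1 => j _.
  have [k Hk] : exists k : 'I_n -> int, forall i, `|(x 0 i - a 0 i) - (k i)%:~R| < d.
    have H i : exists k : int, `|(x 0 i - a 0 i) - k%:~R| < d.
      apply: cos2pi_near_int => //.
      by have := Qq i; rewrite /Q /q; lra.
    by exists (fun i => projT1 (cid (H i))) => i; exact: (projT2 (cid (H i))).
  rewrite -(periodic_int pf x (\row_i - k i)).
  have : `|f a - f (x + map_mx intr (\row_i - k i))| <= f a / 2.
    apply: Hd => i; rewrite !mxE mulrNz distrC addrAC.
    by apply: (lt_le_trans (Hk i)); rewrite ge_min lexx.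
  by rewrite ler_norml => /andP[]; lra.
(* Where [K x <= Q] only [f >= - B] is known; the term in [Q ^+ k] pays for this and for the term
   [f a / 2 * K x ^+ k] asserted there too. *)
have fK_ge k x : f a / 2 * K x ^+ k + (- (f a / 2 + B)) * Q ^+ k <= f x * K x ^+ k.
  have /andP[K0 K1] := K01 x.
  have Kk0 : 0 <= K x ^+ k by rewrite exprn_ge0.
  have B0 : 0 <= B := le_trans (normr_ge0 _) (fB 0).
  have Qk0 : 0 <= Q ^+ k by rewrite exprn_ge0// ltW//; case/andP: Q01.
  have [/near fx|KQ] := ltP Q (K x).
    apply: (@le_trans _ _ (f a / 2 * K x ^+ k)); last by rewrite ler_wpM2r.
    by rewrite gerDl mulNr oppr_le0 mulr_ge0// addr_ge0// divr_ge0// ltW.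
  have KQk : K x ^+ k <= Q ^+ k by rewrite lerXn2r ?nnegrE// ltW//; case/andP: Q01.
  have fx : - B <= f x by have := fB x; rewrite ler_norml => /andP[].
  apply: (@le_trans _ _ (- B * K x ^+ k)); last by rewrite ler_wpM2r.
  have : (f a / 2 + B) * K x ^+ k <= (f a / 2 + B) * Q ^+ k.
    by rewrite ler_wpM2l// addr_ge0// divr_ge0// ltW.
  by lra.
pose p := (1 + Q) / 2.
have p01 : 0 < p < 1 by rewrite /p; lra.
(* A minorant independent of k up to a factor: [p ^+ k * g x <= K x ^+ k], and [g] has positive
   average since [K a = 1]. *)
pose g x := Num.max (K x - p) 0.
have uK k : unif_cont (fun x => K x ^+ k) by case: (orthK k).
have ug : unif_cont g.
  move=> e e0; have [r r0 Hr] := uK 1%N _ e0; exists r => // x y xy.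
  have := Hr x y xy; rewrite !expr1 /g; set u := K x; set v := K y => uv.
  rewrite /Num.max; move: uv; rewrite !ler_norml.
  by case: ifPn; case: ifPn; rewrite -?leNgt ?subr_lt0 ?subr_ge0; lra.
have g0 x : 0 <= g x by rewrite /g le_max lexx orbT.
have g1 x : g x <= 1 by rewrite /g ge_max ler01 andbT; have := K01 x; lra.
have gK k x : p ^+ k * g x <= K x ^+ k.
  have /andP[K0 K1] := K01 x; have p0 : 0 <= p by lra.
  have [Kp|pK] := leP (K x) p.
    by rewrite /g (max_idPr _) ?subr_le0// mulr0 exprn_ge0.
  apply: (@le_trans _ _ (p ^+ k)); first by rewrite ler_piMr// exprn_ge0.
  by rewrite lerXn2r// ?nnegrE// ltW.
have Jg : 0 < box_avg g.
  apply: (@box_avg_gt0 _ _ _ a) => //; rewrite /g /K big1 => [|i _].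
    by rewrite lt_max; apply/orP; left; lra.
  by rewrite /q subrr mulr0 cos0; lra.
have main k : f a / 2 * box_avg g * p ^+ k <= (f a / 2 + B) * Q ^+ k.
  have : box_avg (fun x => f a / 2 * K x ^+ k + (- (f a / 2 + B)) * Q ^+ k) <= 0.
    rewrite -(avgK k); apply: box_avg_le => //.
      rewrite (_ : (fun _ => _) = fun x => - (f a / 2 + B) * Q ^+ k + f a / 2 * K x ^+ k).
        by apply: unif_cont_lin => //; exact: unif_cont_cst.
      by apply/funext => x; rewrite addrC.
    apply: (@unif_cont_mul _ _ _ _ B 1) => //; apply: b1 => x.
    by case: (orthK k).
  rewrite (eq_box_avg (g := fun x => - (f a / 2 + B) * Q ^+ k + f a / 2 * K x ^+ k)); last first.
    by move=> x; rewrite addrC.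
  rewrite box_avg_lin ?box_avg_cst//; last exact: unif_cont_cst.
  have : p ^+ k * box_avg g <= box_avg (fun x => K x ^+ k).
    rewrite -box_avgZ//; apply: box_avg_le => //.
    rewrite (_ : (fun _ => _) = fun x => 0 + p ^+ k * g x).
      by apply: unif_cont_lin => //; exact: unif_cont_cst.
    by apply/funext => x; rewrite add0r.
  move=> /(ler_wpM2l (ltW (divr_gt0 fa (ltr0n _ 2)))).
  by rewrite mulrA [f a / 2 * _ * box_avg g]mulrAC; lra.
have c0 : 0 < f a / 2 * box_avg g by rewrite mulr_gt0// divr_gt0.
have r01 : `|Q / p| < 1.
  have p0 : 0 < p by lra.
  rewrite ger0_norm; last by rewrite divr_ge0//; lra.
  by rewrite ltr_pdivrMr// mul1r /p; lra.
have /cvgrPdist_lt := cvg_expr r01.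
have e0 : 0 < f a / 2 * box_avg g / (f a / 2 + B + 1).
  have B0 : 0 <= B := le_trans (normr_ge0 _) (fB 0).
  by rewrite divr_gt0//; lra.
move=> /(_ _ e0)[k _ /(_ k (leqnn k))]; rewrite /= sub0r normrN.
have pk : 0 < p ^+ k by rewrite exprn_gt0//; lra.
rewrite ger0_norm; last by rewrite exprn_ge0// divr_ge0//; lra.
have B0 : 0 <= B := le_trans (normr_ge0 _) (fB 0).
rewrite exprMn exprVn ltr_pdivrMr// mulrAC ltr_pdivlMr; last lra.
have Qk : 0 < Q ^+ k by rewrite exprn_gt0//; lra.
by have := main k; lra.
Qed.

Lemma wave_orth_eq0 n (f : 'rV[R]_n -> R) : unif_cont f -> Defs.periodic f ->
  (exists B, forall x, `|f x| <= B) ->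
  (forall m p, box_avg (fun x => f x * wave m p x) = 0) -> forall x, f x = 0.
Proof.
move=> uf pf [B fB] fo x.
pose k : 'rV[int]_n := \row_i - Num.floor (x 0 i).
have x01 i : 0 <= (x + map_mx intr k) 0 i < 1.
  rewrite !mxE mulrNz subr_ge0; have /andP[-> ] := floor_itv (x 0 i).
  by rewrite intrD ltrBlDl.
rewrite -(periodic_int pf x k); apply/eqP; rewrite eq_le.
rewrite (wave_orth_le0 uf pf fB fo x01)/= -oppr_le0.
have uf' : unif_cont (fun x => - f x).
  rewrite (_ : (fun _ => _) = fun x => 0 + (-1) * f x).
    by apply: unif_cont_lin => //; exact: unif_cont_cst.
  by apply/funext => y; rewrite add0r mulN1r.
apply: (@wave_orth_le0 _ (fun x => - f x) B _ uf') => //.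
- by move=> y i; rewrite pf.
- by move=> y; rewrite normrN.
- move=> m p; rewrite (eq_box_avg (g := fun x => -1 * (f x * wave m p x))).
    rewrite box_avgZ ?fo ?mulr0//.
    by apply: (@unif_cont_mul _ _ _ _ B 1) => //; [exact: unif_cont_wave|exact: wave_le1].
  by move=> y; rewrite mulN1r mulNr.
Qed.

End waves.

(** * Eigenfunctions on the torus *)

Section directional.
Context {R : realType}.

Lemma continuous_funM (T : topologicalType) (f g : T -> R) : continuous f ->
  continuous g -> continuous (fun x => f x * g x).
Proof. by move=> cf cg x; exact: (@cvgM _ T (nbhs x) _ f g _ _ (cf x) (cg x)). Qed.

Lemma continuous_funD (T : topologicalType) (f g : T -> R) : continuous f ->
  continuous g -> continuous (fun x => f x + g x).
Proof. by move=> cf cg x; exact: cvgD (cf x) (cg x). Qed.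

Lemma continuous_fun_cst (T : topologicalType) (c : R) : continuous (fun _ : T => c).
Proof. by move=> x; exact: cst_continuous. Qed.

Lemma is_derive_line n (f : 'rV[R]_n -> R) (x v : 'rV[R]_n) (df : R) :
  is_derive (0 : R) (1 : R) (fun h : R => f (h *: v + x)) df -> is_derive x v f df.
Proof.
move=> [].
have E : (fun h : R => h^-1 *: ((((fun h : R => f (h *: v + x)) \o shift (0 : R)) (h *: (1:R))) - f (0 *: v + x))) =
    (fun h : R => h^-1 *: (((f \o shift x) (h *: v)) - f x)).
  by apply/funext => h /=; rewrite addr0 scale0r add0r -[h *: 1]/(h * 1) mulr1.
rewrite /derivable /derive E => d1 d2.
by split; rewrite /derivable /derive.
Qed.

Lemma is_derive_wave n (m : 'rV[int]_n) (p : R) x i :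
  is_derive x (delta_mx 0 i) (wave m p) (2 * pi * (m 0 i)%:~R * wave m (p + pi / 2) x).
Proof.
apply: is_derive_line.
pose A : R := 2 * pi * (m 0 i)%:~R.
pose B : R := 2 * pi * (\sum_j (m 0 j)%:~R * x 0 j) + p.
have E : (fun h : R => wave m p (h *: delta_mx 0 i + x)) = (fun h : R => cos (A * h + B)).
  apply/funext => h; rewrite /wave /A /B; congr cos.
  under eq_bigr do rewrite mxE mulrDr.
  rewrite big_split/= (bigD1 i)//= big1 ?addr0 => [|j ji].
    by rewrite !mxE !eqxx mulr1; ring.
  by rewrite !mxE (negbTE ji) andbF !mulr0.
rewrite E; apply: (is_derive_val (is_derive_fun_comp (is_derive_cos _) (is_derive_fun_affine 0 A B))).
by rewrite mulr0 add0r /wave addrA cosDpihalf -/B mulrC /A.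
Qed.

Lemma continuous_wave n (m : 'rV[int]_n) (p : R) : continuous (wave m p).
Proof.
have c1 : continuous (fun x : 'rV[R]_n => \sum_i (m 0 i)%:~R * x 0 i : R).
  apply: continuous_sum => i; apply: continuous_funM; first exact: continuous_fun_cst.
  by move=> x; exact: coord_continuous.
move=> x; apply: (@continuous_comp _ _ _
  (fun x : 'rV[R]_n => 2 * pi * (\sum_i (m 0 i)%:~R * x 0 i) + p) cos); last exact: continuous_cos.
apply: continuous_funD; last exact: continuous_fun_cst.
by apply: continuous_funM => //; exact: continuous_fun_cst.
Qed.

Lemma continuously_diff_wave n k (m : 'rV[int]_n) (c p : R) :
  continuously_diff k (fun x => c * wave m p x).
Proof.
have cw (c' p' : R) : continuous (fun x => c' * wave m p' x).
  by apply: continuous_funM; [exact: continuous_fun_cst|exact: continuous_wave].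
have dw (c' p' : R) x i : is_derive x (delta_mx 0 i) (fun x => c' * wave m p' x)
    (c' * (2 * pi * (m 0 i)%:~R) * wave m (p' + pi / 2) x).
  have H : is_derive x (delta_mx 0 i) (fun x => c' * wave m p' x)
    (c' *: (2 * pi * (m 0 i)%:~R * wave m (p' + pi / 2) x)) := is_deriveZ c' (is_derive_wave m p' x i).
  by apply: (is_derive_eq H); exact: mulrA.
elim: k c p => [|k IH] c p; first by split.
split => // i; split; first by move=> x; have [] := dw c p x i.
rewrite (_ : partial i _ = fun x => c * (2 * pi * (m 0 i)%:~R) * wave m (p + pi / 2) x)//.
by apply/funext => x; rewrite /partial; have [_ ->] := dw c p x i.
Qed.

(** With values in [nat], so that eigenvalues 4 pi^2 r are grouped into levels indexed by natural
    numbers. *)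
Definition normsq n (m : 'rV[int]_n) : nat := (\sum_i absz (m 0%R i) ^ 2)%N.

Lemma normsqE n (m : 'rV[int]_n) : (normsq m)%:R = \sum_i ((m 0 i)%:~R : R) ^+ 2.
Proof.
rewrite /normsq natr_sum; apply: eq_bigr => i _.
by rewrite natrX natr_absz intr_norm real_normK ?num_real.
Qed.

Lemma wave_periodic n (m : 'rV[int]_n) (p : R) : Defs.periodic (wave m p).
Proof.
move=> x i; rewrite /wave.
have H : \sum_j (m 0 j)%:~R * (delta_mx 0 i : 'rV[R]_n) 0 j = (m 0 i)%:~R :> R.
  rewrite (bigD1 i)//= big1 ?addr0 => [|j ji]; first by rewrite mxE !eqxx mulr1.
  by rewrite mxE (negbTE ji) andbF mulr0.
under eq_bigr do rewrite mxE mulrDr; rewrite big_split/= H.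
by rewrite mulrDr addrAC cosD2piz.
Qed.

Lemma wave_eigenfunction n (m : 'rV[int]_n) (p : R) :
  eigenfunction (4 * pi ^+ 2 * (normsq m)%:R) (wave m p).
Proof.
split; first exact: wave_periodic.
  rewrite (_ : wave m p = fun x => 1 * wave m p x); first exact: continuously_diff_wave.
  by apply/funext => x; rewrite mul1r.
move=> x; rewrite /laplacian normsqE mulr_sumr mulr_suml -sumrN.
apply: eq_bigr => i _.
have -> : partial i (wave m p) = (2 * pi * (m 0 i)%:~R) *: wave m (p + pi / 2).
  by apply/funext => y; rewrite /partial; have [_ ->] := is_derive_wave m p y i.
rewrite /partial; have [_ ->] := is_deriveZ (2 * pi * (m 0 i)%:~R) (is_derive_wave m (p + pi / 2) x i).
by rewrite /wave -[_ *: _]/(_ * _) !addrA cosDpihalf sinDpihalf; ring.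
Qed.

Definition twice_derivable n (f : 'rV[R]_n -> R) := forall i x,
  derivable f x (delta_mx 0 i) /\ derivable (partial i f) x (delta_mx 0 i).

Lemma derive_lin n (f g : 'rV[R]_n -> R) (c : R) x v :
  derivable f x v -> derivable g x v ->
  derivable (fun x => f x + c * g x) x v /\
  'D_v (fun x => f x + c * g x) x = 'D_v f x + c * 'D_v g x.
Proof.
move=> df dg; have dcg : derivable (c *: g) x v by exact: derivableZ.
split; first exact: (derivableD df dcg).
by have := deriveD df dcg; rewrite deriveZ.
Qed.

Lemma twice_derivable_lin n (f g : 'rV[R]_n -> R) (c : R) :
  twice_derivable f -> twice_derivable g ->
  twice_derivable (fun x => f x + c * g x) /\
  forall x, laplacian (fun x => f x + c * g x) x = laplacian f x + c * laplacian g x.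
Proof.
move=> df dg.
have pE i : partial i (fun x => f x + c * g x) = fun x => partial i f x + c * partial i g x.
  by apply/funext => x; exact: (derive_lin c (df i x).1 (dg i x).1).2.
split.
  move=> i x; split; first exact: (derive_lin c (df i x).1 (dg i x).1).1.
  by rewrite pE; exact: (derive_lin c (df i x).2 (dg i x).2).1.
move=> x; rewrite /laplacian mulr_sumr -big_split; apply: eq_bigr => i _ /=.
by rewrite pE; exact: (derive_lin c (df i x).2 (dg i x).2).2.
Qed.

Lemma eigenfunction_twice_derivable n mu (f : 'rV[R]_n -> R) :
  eigenfunction mu f -> twice_derivable f.
Proof. by case=> _ [_ H] _ i x; have [h1 [_ /(_ i)[h2 _]]] := H i. Qed.

End directional.

(** * Orthogonality relations for the given eigenfunctions *)

Section spectrum.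
Context {R : realType} {d : nat} (S : torus_spectrum R d).
Local Notation phi := (eigfun S).
Local Notation lam := (eigval S).

Lemma eigfun_unif_cont k : unif_cont (phi k).
Proof.
by have [pf [cf _] _] := eigfunP S k; exact: continuous_periodic_unif_cont.
Qed.

Lemma eigfun_bounded k : exists B, forall x, `|phi k x| <= B.
Proof.
by have [pf [cf _] _] := eigfunP S k; exact: continuous_periodic_bounded.
Qed.

Lemma unif_cont_eigfunM k (f : 'rV[R]_d -> R) (B : R) : unif_cont f ->
  (forall x, `|f x| <= B) -> unif_cont (fun x => f x * phi k x).
Proof.
move=> uf fB; have [C phiC] := eigfun_bounded k.
by apply: (@unif_cont_mul _ _ _ _ B C) => //; exact: eigfun_unif_cont.
Qed.

Lemma box_avg_eigfunM j k : box_avg (fun x => phi j x * phi k x) = (j == k)%:R.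
Proof.
have [B phiB] := eigfun_bounded j.
have := eigfun_orthonormal S j k; rewrite box_integral_avg.
  by case.
by apply: unif_cont_eigfunM phiB; exact: eigfun_unif_cont.
Qed.

Lemma box_avg_eigfun_sum n (c : nat -> R) k :
  box_avg (fun x => (\sum_(j < n) c j * phi j x) * phi k x) = (k < n)%:R * c k.
Proof.
rewrite (eq_box_avg (g := fun x => \sum_(j < n) c j * (phi j x * phi k x))); last first.
  by move=> x; rewrite mulr_suml; apply: eq_bigr => j _; rewrite mulrA.
have u (j : nat) : unif_cont (fun x => phi j x * phi k x).
  have [B phiB] := eigfun_bounded j.
  by apply: unif_cont_eigfunM phiB; exact: eigfun_unif_cont.
rewrite (@box_avg_sum _ _ _ _ _ (fun (j : 'I_n) x => c j * (phi j x * phi k x))); last first.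
  move=> j; rewrite (_ : (fun _ => _) = fun x => 0 + c j * (phi j x * phi k x)).
    by apply: unif_cont_lin => //; exact: unif_cont_cst.
  by apply/funext => x; rewrite add0r.
under eq_bigr do rewrite box_avgZ// box_avg_eigfunM.
have [kn|nk] := ltnP k n.
  rewrite (bigD1 (Ordinal kn))//= eqxx mulr1 big1 ?addr0 ?mul1r// => j jk.
  by rewrite (_ : (j == k :> nat) = false) ?mulr0//; apply: contraNF jk => /eqP jk; apply/eqP/val_inj.
rewrite big1 ?mul0r// => j _.
by rewrite (_ : (j == k :> nat) = false) ?mulr0//; apply/negbTE; rewrite neq_ltn (leq_trans (ltn_ord j)).
Qed.

(** No integration by parts: [f] is a finite combination of the [phi i] with coefficients [c i];
    applying -Laplacian - mu gives sum_i c_i (lam_i - mu) phi_i = 0, and orthonormality forces c_k =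
    0 unless lam_k = mu. *)
Lemma eigenfunction_orth mu (f : 'rV[R]_d -> R) k : eigenfunction mu f ->
  lam k != mu -> box_avg (fun x => f x * phi k x) = 0.
Proof.
move=> ef lm; have [n [c fE]] := eigfun_span S ef.
have [kn|nk] := ltnP k n; last first.
  by under eq_box_avg do rewrite fE; rewrite box_avg_eigfun_sum ltnNge nk mul0r.
have comb j : twice_derivable (fun x => \sum_(i < j) c i * phi i x) /\
    forall x, laplacian (fun x => \sum_(i < j) c i * phi i x) x =
      - \sum_(i < j) c i * lam i * phi i x.
  elim: j => [|j [IH1 IH2]].
    have z : (fun x : 'rV[R]_d => \sum_(i < 0) c i * phi i x) = fun=> 0.
      by apply/funext => x; rewrite big_ord0.
    rewrite z; split.
      move=> i x; rewrite (_ : partial i (fun=> 0) = fun=> 0); first by split; exact: derivable_cst.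
      by apply/funext => y; rewrite /partial derive_cst.
    move=> x; rewrite big_ord0 oppr0 /laplacian big1// => i _.
    rewrite (_ : partial i (fun=> 0) = fun=> 0); first by rewrite /partial derive_cst.
    by apply/funext => y; rewrite /partial derive_cst.
  have z : (fun x : 'rV[R]_d => \sum_(i < j.+1) c i * phi i x) =
      fun x => \sum_(i < j) c i * phi i x + c j * phi j x.
    by apply/funext => x; rewrite big_ord_recr.
  have [h1 h2] := twice_derivable_lin (c j) IH1 (eigenfunction_twice_derivable (eigfunP S j)).
  rewrite z; split => // x; rewrite h2 IH2 big_ord_recr/= opprD; congr (_ + _).
  by have [_ _ /(_ x) E] := eigfunP S j; rewrite -mulrA -E mulrN opprK.
have fE' : f = fun x => \sum_(k < n) c k * phi k x by apply/funext.
have [_ _ Lf] := ef.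
have main x : \sum_(i < n) (c i * (lam i - mu)) * phi i x = 0.
  have := Lf x; rewrite fE' (comb n).2 opprK mulr_sumr => H.
  under eq_bigr do rewrite mulrBr mulrBl; rewrite sumrB H -sumrB big1// => i _.
  by ring.
have := box_avg_eigfun_sum n (fun i => c i * (lam i - mu)) k.
rewrite (eq_box_avg (g := fun=> 0)) => [|x]; last by rewrite main mul0r.
rewrite box_avg_cst kn mul1r => /esym/eqP; rewrite mulf_eq0 subr_eq0 (negbTE lm) orbF => /eqP ck.
by under eq_box_avg do rewrite fE; rewrite box_avg_eigfun_sum ck mulr0.
Qed.

End spectrum.

(** * Theta functions *)

Fixpoint zrange (N : nat) : seq int :=
  if N is N'.+1 then [:: N'.+1%:Z, - N'.+1%:Z & zrange N'] else [:: 0].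

Lemma mem_zrange N (j : int) : (j \in zrange N) = (`|j| <= N)%N.
Proof.
elim: N => [|N IH] /=; first by rewrite inE leqn0 absz_eq0.
by rewrite !inE IH; lia.
Qed.

Lemma uniq_zrange N : uniq (zrange N).
Proof.
elim: N => [//|N IH]; rewrite /= !inE IH !mem_zrange; apply/and3P; split => //; lia.
Qed.

(** Cubes rather than balls, because sums of product weights over a cube factor into one-dimensional
    sums. *)
Fixpoint cube (n N : nat) : seq 'rV[int]_n :=
  match n with
  | 0 => [:: 0]
  | n'.+1 => [seq (row_mx (const_mx j : 'rV_1) m : 'rV_(n'.+1)) | j <- zrange N, m <- cube n' N]
  end.

Lemma mem_cube n N (m : 'rV[int]_n) : (m \in cube n N) = [forall i, (`|m 0%R i| <= N)%N].
Proof.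
elim: n m => [|n IH] m /=.
  rewrite inE; have -> : m == 0 by apply/eqP/rowP => -[].
  by apply/esym/forallP => -[].
apply/allpairsP/forallP => [[[j m'] /= [jN m'N ->]] i|H].
  have [k ->|->] := unliftP ord0 i; last by rewrite row_mx_head -mem_zrange.
  by rewrite row_mx_tail; move: m'N; rewrite IH => /forallP; exact.
exists (m 0 ord0, \row_i m 0 (lift ord0 i)); split => /=.
- by rewrite mem_zrange.
- by rewrite IH; apply/forallP => i; rewrite mxE.
- apply/rowP => i; have [k ->|->] := unliftP ord0 i; last by rewrite row_mx_head.
  by rewrite row_mx_tail mxE.
Qed.

Lemma uniq_cube n N : uniq (cube n N).
Proof.
elim: n => [//|n IH] /=; apply: allpairs_uniq => //; first exact: uniq_zrange.
move=> [j m] [j' m'] _ _ /= /rowP E; congr (_, _).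
  by have := E ord0; rewrite !row_mx_head.
by apply/rowP => i; have := E (lift ord0 i); rewrite !row_mx_tail.
Qed.

Lemma mem_cube_normsq n N (m : 'rV[int]_n) : (normsq m <= N)%N -> m \in cube n N.
Proof.
move=> mN; rewrite mem_cube; apply/forallP => i; apply: leq_trans mN.
rewrite /normsq (bigD1 i)//=; apply: leq_trans (leq_addr _ _).
by case: (absz _) => // k; rewrite expnS expn1 leq_pmulr.
Qed.

Lemma normsqN n (m : 'rV[int]_n) : normsq (- m) = normsq m.
Proof. by apply: eq_bigr => i _; rewrite mxE abszN. Qed.

Section zsum.
Context {R : realType}.
Implicit Types F w : int -> R.

Definition zsum F (N : nat) : R := \sum_(j <- zrange N) F j.

Lemma zsumS F N : zsum F N.+1 = F N.+1%:Z + F (- N.+1%:Z) + zsum F N.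
Proof. by rewrite /zsum /= !big_cons addrA. Qed.

Lemma zsum0 F : zsum F 0 = F 0.
Proof. by rewrite /zsum big_seq1. Qed.

Lemma zsumD F G N : zsum (fun j => F j + G j) N = zsum F N + zsum G N.
Proof. exact: big_split. Qed.

Lemma zsumZ (c : R) F N : zsum (fun j => c * F j) N = c * zsum F N.
Proof. by rewrite /zsum mulr_sumr. Qed.

Lemma ler_zsum F G N : (forall j, F j <= G j) -> zsum F N <= zsum G N.
Proof. by move=> FG; apply: ler_sum. Qed.

Lemma zsum_norm_le F G N : (forall j, `|F j| <= G j) -> `|zsum F N| <= zsum G N.
Proof. by move=> FG; apply: (le_trans (ler_norm_sum _ _ _)); apply: ler_sum. Qed.

Lemma zsum_tail F (C q : R) N k : 0 <= q < 1 -> (forall j, `|F j| <= C * q ^+ `|j|%N) ->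
  `|zsum F (N + k) - zsum F N| <= 2 * C / (1 - q) * q ^+ N.
Proof.
move=> /andP[q0 q1] FC.
have C0 : 0 <= C by have := FC 0; rewrite expr0 mulr1; exact: le_trans.
have q1' : 0 < 1 - q by rewrite subr_gt0.
(* Strengthened by the exact geometric remainder, so that the induction on [k] telescopes. *)
suff : `|zsum F (N + k) - zsum F N| <= 2 * C / (1 - q) * (q ^+ N - q ^+ (N + k)).
  move=> /le_trans; apply; apply: ler_wpM2l; last by rewrite gerBl exprn_ge0.
  by rewrite divr_ge0 ?mulr_ge0// ltW.
elim: k => [|k IH]; first by rewrite addn0 !subrr normr0 mulr0.
rewrite addnS zsumS -addrA; apply: (le_trans (ler_normD _ _)).
have h : `|F (N + k).+1%:Z + F (- (N + k).+1%:Z)| <= 2 * C * q ^+ (N + k).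
  apply: (le_trans (ler_normD _ _)).
  have h1 := FC (N + k).+1%:Z; have h2 := FC (- (N + k).+1%:Z).
  have : q ^+ (N + k).+1 <= q ^+ (N + k) by rewrite exprS ler_piMl ?exprn_ge0// ltW.
  move=> /(ler_wpM2l C0).
  by rewrite abszN /= in h1 h2; rewrite -mulrA mulr2n mulrDl mul1r; lra.
apply: (le_trans (lerD h IH)).
rewrite [leRHS](_ : _ = 2 * C / (1 - q) * (q ^+ N - q ^+ (N + k)) + 2 * C * q ^+ (N + k)).
  by rewrite addrC.
by rewrite exprS; field; rewrite gt_eqF.
Qed.

Lemma zsum_cvg F (C q : R) : 0 <= q < 1 -> (forall j, `|F j| <= C * q ^+ `|j|%N) ->
  cvgn (zsum F).
Proof.
move=> q01 FC; have q1 : `|q| < 1 by rewrite ger0_norm; case/andP: q01.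
apply/cauchy_cvgP; apply: cauchy_exP => e e0.
have : 2 * C / (1 - q) * q ^+ n @[n --> \oo] --> 2 * C / (1 - q) * 0.
  by apply: cvgM; [exact: cvg_cst|exact: cvg_expr].
rewrite mulr0 => /cvgrPdist_lt /(_ e e0)[N _ HN].
exists (zsum F N); exists N => // n /= Nn.
have := HN N (leqnn N); rewrite /= sub0r normrN => qN.
rewrite /ball/= distrC -(subnKC Nn); apply: le_lt_trans (zsum_tail _ _ q01 FC) _.
exact: le_lt_trans (ler_norm _) qN.
Qed.

Lemma limn_norm_le (u : nat -> R) (l a b : R) : u n @[n --> \oo] --> l ->
  (exists N, forall n, (N <= n)%N -> `|u n - a| <= b) -> `|l - a| <= b.
Proof.
move=> ul [N uab].
have cl : `|u n - a| @[n --> \oo] --> `|l - a|.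
  by apply: cvg_norm; apply: cvgB => //; exact: cvg_cst.
rewrite -(cvg_lim _ cl)//; apply: limr_le; first by apply/cvg_ex; exists `|l - a|.
by exists N => // n /=; exact: uab.
Qed.

Lemma zsum_lim_tail F (C q : R) N : 0 <= q < 1 -> (forall j, `|F j| <= C * q ^+ `|j|%N) ->
  `|limn (zsum F) - zsum F N| <= 2 * C / (1 - q) * q ^+ N.
Proof.
move=> q01 FC; apply: limn_norm_le (zsum_cvg q01 FC) _; exists N => n Nn.
by rewrite -(subnKC Nn); exact: zsum_tail.
Qed.

Lemma cvg_prod_seq (I : Type) (r : seq I) (u : I -> nat -> R) (l : I -> R) :
  (forall i, u i n @[n --> \oo] --> l i) ->
  \prod_(i <- r) u i n @[n --> \oo] --> \prod_(i <- r) l i.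
Proof.
move=> ul; elim: r => [|i r IH].
  by rewrite big_nil; under eq_fun do rewrite big_nil; exact: cvg_cst.
by rewrite big_cons; under eq_fun do rewrite big_cons; exact: cvgM.
Qed.

End zsum.

Section theta.
Context {R : realType}.

Definition theta_weight (s : R) (j : int) : R := expR (- (4 * pi ^+ 2 * j%:~R ^+ 2 * s)).

(** The heat kernel of the circle of length 1 at time s, between points at displacement u. *)
Definition theta (s u : R) : R :=
  limn (zsum (fun j => theta_weight s j * cos (2 * pi * (j%:~R * u)))).

Lemma natr_absz_sqr (j : int) : (`|j| ^ 2)%N%:R = j%:~R ^+ 2 :> R.
Proof. by rewrite natrX natr_absz intr_norm real_normK ?num_real. Qed.

Lemma theta_weight_le (s : R) j : 0 <= s ->
  theta_weight s j <= expR (- (4 * pi ^+ 2 * s)) ^+ `|j|%N.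
Proof.
move=> s0; rewrite /theta_weight -expRM_natl ler_expR mulrN lerN2.
have h : `|j|%N%:R <= j%:~R ^+ 2 :> R.
  rewrite -natr_absz_sqr natrX; case: (absz j) => [|k]; first by rewrite expr0n.
  by rewrite expr2 ler_peMl// ler1n.
rewrite [leRHS](_ : _ = j%:~R ^+ 2 * (4 * pi ^+ 2 * s)); last by ring.
by rewrite ler_wpM2r// !mulr_ge0 ?exprn_ge0 ?pi_ge0.
Qed.

Lemma theta_weight_gt0 (s : R) j : 0 < theta_weight s j.
Proof. exact: expR_gt0. Qed.

Lemma theta_weightN (s : R) j : theta_weight s (- j) = theta_weight s j.
Proof. by rewrite /theta_weight mulrNz sqrrN. Qed.

Lemma theta_ratio (s : R) : 0 < s -> 0 <= expR (- (4 * pi ^+ 2 * s)) < 1.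
Proof.
move=> s0; rewrite expR_ge0/= expR_lt1 oppr_lt0.
by rewrite !mulr_gt0 ?exprn_gt0 ?pi_gt0.
Qed.

Lemma theta_term_le (s u : R) j : 0 < s ->
  `|theta_weight s j * cos (2 * pi * (j%:~R * u))| <=
    1 * expR (- (4 * pi ^+ 2 * s)) ^+ `|j|%N.
Proof.
move=> s0; rewrite normrM mul1r gtr0_norm ?theta_weight_gt0//.
apply: le_trans (theta_weight_le j (ltW s0)).
by rewrite ler_piMr ?cos_max// ltW// theta_weight_gt0.
Qed.

Lemma theta_cvg (s u : R) : 0 < s ->
  zsum (fun j => theta_weight s j * cos (2 * pi * (j%:~R * u))) n @[n --> \oo] --> theta s u.
Proof.
by move=> s0; exact: (zsum_cvg (theta_ratio s0) (fun j => theta_term_le u j s0)).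
Qed.

Lemma zsum_cosD (w : int -> R) (u p : R) N : (forall j, w (- j) = w j) ->
  zsum (fun j => w j * cos (2 * pi * (j%:~R * u) + p)) N =
  zsum (fun j => w j * cos (2 * pi * (j%:~R * u))) N * cos p.
Proof.
move=> wN; elim: N => [|N IH]; first by rewrite !zsum0 mul0r mulr0 add0r cos0; ring.
rewrite !zsumS IH !wN !mulrNz !mulNr !mulrN cosN.
rewrite cosD (addrC (- _)) cosB.
by ring.
Qed.

Lemma wave_cube_sum n N (w : int -> R) (p : R) (u : 'rV[R]_n) : (forall j, w (- j) = w j) ->
  \sum_(m <- cube n N) (\prod_i w (m 0 i)) * wave m p u =
  (\prod_i zsum (fun j => w j * cos (2 * pi * (j%:~R * u 0 i))) N) * cos p.
Proof.
move=> wN; elim: n p u => [|n IH] p u /=.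
  by rewrite big_seq1 !big_ord0 /wave big_ord0 mulr0 add0r.
pose v : 'rV[R]_n := \row_i u 0 (lift ord0 i).
rewrite big_allpairs_dep/= big_ord_recl.
transitivity (\sum_(j <- zrange N) w j * ((\prod_i zsum (fun j => w j * cos (2 * pi * (j%:~R * v 0 i))) N) * cos (2 * pi * (j%:~R * u 0 ord0) + p))).
  apply: eq_bigr => j _; rewrite -IH mulr_sumr; apply: eq_bigr => m _.
  rewrite big_ord_recl row_mx_head -mulrA; congr (_ * (_ * _)).
    by apply: eq_bigr => i _; rewrite row_mx_tail.
  rewrite /wave big_ord_recl row_mx_head; congr cos.
  under eq_bigr do rewrite row_mx_tail.
  by under [in RHS]eq_bigr do rewrite mxE; ring.
set P := \prod_(i < n) _.
rewrite (eq_bigr (fun j => P * (w j * cos (2 * pi * (j%:~R * u 0 ord0) + p)))); last first.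
  by move=> j _; rewrite mulrCA.
rewrite -mulr_sumr -/(zsum (fun j => w j * cos (2 * pi * (j%:~R * u 0 ord0) + p)) N) zsum_cosD//.
rewrite mulrA [P * _]mulrC; congr (_ * _ * _).
by apply: eq_bigr => i _; rewrite mxE.
Qed.

Lemma theta_weight_prod n (s : R) (m : 'rV[int]_n) :
  \prod_i theta_weight s (m 0 i) = expR (- (4 * pi ^+ 2 * (normsq m)%:R * s)).
Proof.
rewrite /theta_weight -expR_sum; congr expR; rewrite sumrN; congr (- _).
by rewrite normsqE mulr_sumr mulr_suml.
Qed.

Lemma theta_prod_cvg n (s : R) (u : 'rV[R]_n) : 0 < s ->
  \sum_(m <- cube n N) expR (- (4 * pi ^+ 2 * (normsq m)%:R * s)) * wave m 0 u @[N --> \oo]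
    --> \prod_i theta s (u 0 i).
Proof.
move=> s0.
have -> : (fun N => \sum_(m <- cube n N) expR (- (4 * pi ^+ 2 * (normsq m)%:R * s)) * wave m 0 u) =
    (fun N => \prod_i zsum (fun j => theta_weight s j * cos (2 * pi * (j%:~R * u 0 i))) N).
  apply/funext => N; have := wave_cube_sum N 0 u (theta_weightN s); rewrite cos0 mulr1 => <-.
  by apply: eq_bigr => m _; rewrite theta_weight_prod.
by apply: cvg_prod_seq => i; exact: theta_cvg.
Qed.

End theta.

(** * The heat kernel as a product of theta functions *)

Section levels.
Context {R : realType} {d : nat} (S : torus_spectrum R d).
Local Notation phi := (eigfun S).
Local Notation lam := (eigval S).
Local Notation dot m x := (\sum_i (m 0 i)%:~R * x 0 i).

Lemma sum_delta (I : eqType) (s : seq I) (P : pred I) (F : I -> R) (a : I) : uniq s ->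
  \sum_(i <- s | P i) F i * (i == a)%:R = ((a \in s) && P a)%:R * F a.
Proof.
elim: s => [|i s IH]; first by rewrite big_nil mul0r.
rewrite /= => /andP[si us]; rewrite big_cons IH// inE.
rewrite (eq_sym a i); have [<-|ai] := eqVneq i a; last by rewrite /= mulr0 add0r; case: (P i).
by rewrite (negbTE si) mul0r addr0 mulr1; case: (P i); rewrite ?mul1r ?mul0r.
Qed.

(** Two Kronecker terms, since indices [m] and [- m] describe the same functions up to the phase. *)
Lemma box_avg_waveM n (m m' : 'rV[int]_n) (q p : R) :
  box_avg (fun x => wave m q x * wave m' p x) =
  2^-1 * cos (q + p) * (m == - m')%:R + 2^-1 * cos (q - p) * (m == m')%:R.
Proof.
have u c (k : 'rV[int]_n) (s : R) : unif_cont (fun x => c * wave k s x).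
  rewrite (_ : (fun _ => _) = fun x => 0 + c * wave k s x).
    by apply: unif_cont_lin; [exact: unif_cont_cst|exact: unif_cont_wave].
  by apply/funext => x; rewrite add0r.
rewrite (eq_box_avg (waveM m m' q p)) box_avg_lin ?box_avgZ ?box_avg_wave//; try exact: unif_cont_wave.
by rewrite addr_eq0 subr_eq0; ring.
Qed.

Lemma wave_split n (m : 'rV[int]_n) (x y : 'rV[R]_n) :
  wave m (- (2 * pi * dot m x)) y =
  wave m 0 x * wave m 0 y + wave m (- (pi / 2)) x * wave m (- (pi / 2)) y.
Proof. by rewrite /wave !addr0 !cosBpihalf addrC -cosB -cosN opprD opprK addrC. Qed.

Lemma wave_phase n (m : 'rV[int]_n) (p : R) (y : 'rV[R]_n) :
  wave m p y = cos p * wave m 0 y - sin p * wave m (- (pi / 2)) y.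
Proof. by rewrite /wave !addr0 !cosBpihalf cosD; ring. Qed.

Lemma wave0N n (m : 'rV[int]_n) (y : 'rV[R]_n) : wave (- m) 0 y = wave m 0 y.
Proof.
rewrite /wave !addr0 -[RHS]cosN; congr cos.
by under eq_bigr do rewrite mxE mulrNz mulNr; rewrite sumrN mulrN.
Qed.

Lemma wave_sinN n (m : 'rV[int]_n) (y : 'rV[R]_n) :
  wave (- m) (- (pi / 2)) y = - wave m (- (pi / 2)) y.
Proof.
rewrite /wave !cosBpihalf -sinN; congr sin.
by under eq_bigr do rewrite mxE mulrNz mulNr; rewrite sumrN mulrN.
Qed.

Lemma unif_cont_waveM k n (f : 'rV[R]_d -> R) : f = wave k n -> forall j, unif_cont (fun x => f x * phi j x).
Proof.
move=> -> j; apply: (@unif_cont_eigfunM _ _ S j (wave k n) 1); first exact: unif_cont_wave.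
exact: wave_le1.
Qed.

(** The left side is the projection [P] of [phi k] to the waves of level [r]. The difference
    [phi k - P] is orthogonal to waves of level [r] by [box_avg_waveM] and to all others by
    [eigenfunction_orth], hence vanishes by completeness. The condition [r <= N] makes the cube
    contain the whole level. *)
Lemma eigfun_reproducing r N k (x : 'rV[R]_d) : (r <= N)%N -> lam k = 4 * pi ^+ 2 * r%:R ->
  \sum_(m <- cube d N | normsq m == r)
     box_avg (fun y => wave m (- (2 * pi * dot m x)) y * phi k y) = phi k x.
Proof.
move=> rN lamk.
have uw m p : unif_cont (fun y => wave m p y * phi k y) by exact: unif_cont_waveM.
pose A m := box_avg (fun y => wave m 0 y * phi k y).
pose B m := box_avg (fun y => wave m (- (pi / 2)) y * phi k y).
have uZ c m p : unif_cont (fun y => c * (wave m p y * phi k y)).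
  rewrite (_ : (fun _ => _) = fun y => 0 + c * (wave m p y * phi k y)).
    by apply: unif_cont_lin => //; exact: unif_cont_cst.
  by apply/funext => y; rewrite add0r.
have avgE (c e : R) m : box_avg (fun y => (c * wave m 0 y + e * wave m (- (pi / 2)) y) * phi k y) = c * A m + e * B m.
  rewrite (eq_box_avg (g := fun y => c * (wave m 0 y * phi k y) + e * (wave m (- (pi / 2)) y * phi k y))).
    by rewrite box_avg_lin// box_avgZ.
  by move=> y; ring.
pose P y := \sum_(m <- cube d N | normsq m == r) (wave m 0 y * A m + wave m (- (pi / 2)) y * B m).
transitivity (P x).
  by apply: eq_bigr => m _; rewrite -avgE; apply: eq_box_avg => y; rewrite wave_split.
apply/eqP; rewrite eq_sym -subr_eq0; apply/eqP.
have [[phi_per [phi_cont _] _] [C phiC]] := (eigfunP S k, eigfun_bounded S k).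
have uterm m : unif_cont (fun y => wave m 0 y * A m + wave m (- (pi / 2)) y * B m).
  rewrite (_ : (fun _ => _) = fun y => (0 + A m * wave m 0 y) + B m * wave m (- (pi / 2)) y).
    apply: unif_cont_lin; last exact: unif_cont_wave.
    by apply: unif_cont_lin; [exact: unif_cont_cst|exact: unif_cont_wave].
  by apply/funext => y; ring.
have uP : unif_cont P by exact: unif_cont_sum.
pose D := \sum_(m <- cube d N | normsq m == r) (`|A m| + `|B m|).
have PD y : `|P y| <= D.
  apply: (le_trans (ler_norm_sum _ _ _)); apply: ler_sum => m _.
  apply: (le_trans (ler_normD _ _)); rewrite !normrM.
  by apply: lerD; rewrite ler_piMl// wave_le1.
have ug : unif_cont (fun y => phi k y - P y).
  rewrite (_ : (fun _ => _) = fun y => phi k y + (-1) * P y).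
    by apply: unif_cont_lin => //; exact: eigfun_unif_cont.
  by apply/funext => y; ring.
apply: (wave_orth_eq0 ug) => [y i||].
- rewrite phi_per; congr (_ - _); apply: eq_bigr => m _.
  by rewrite !wave_periodic.
- exists (C + D) => y; apply: (le_trans (ler_normB _ _)).
  by apply: lerD.
move=> m' p.
have uWW m q : unif_cont (fun y => wave m q y * wave m' p y).
  by apply: (@unif_cont_mul _ _ _ _ 1 1); [exact: unif_cont_wave|exact: unif_cont_wave|exact: wave_le1|exact: wave_le1].
rewrite (eq_box_avg (g := fun y => wave m' p y * phi k y + (-1) * (P y * wave m' p y))); last by move=> y; ring.
rewrite box_avg_lin//; last first.
  by apply: (@unif_cont_mul _ _ _ _ D 1) => //; [exact: unif_cont_wave|exact: wave_le1].
have -> : box_avg (fun y => P y * wave m' p y) =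
    \sum_(m <- cube d N | normsq m == r) (A m * box_avg (fun y => wave m 0 y * wave m' p y) +
       B m * box_avg (fun y => wave m (- (pi / 2)) y * wave m' p y)).
  have uZW c m q : unif_cont (fun y => c * (wave m q y * wave m' p y)).
    rewrite (_ : (fun _ => _) = fun y => 0 + c * (wave m q y * wave m' p y)).
      by apply: unif_cont_lin => //; exact: unif_cont_cst.
    by apply/funext => y; rewrite add0r.
  rewrite (eq_box_avg (g := fun y => \sum_(m <- cube d N | normsq m == r)
     (A m * (wave m 0 y * wave m' p y) + B m * (wave m (- (pi / 2)) y * wave m' p y)))).
    rewrite box_avg_sum; last by move=> m; exact: unif_cont_lin.
    by apply: eq_bigr => m _; rewrite box_avg_lin// box_avgZ.
  by move=> y; rewrite /P mulr_suml; apply: eq_bigr => m _; ring.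
have -> : \sum_(m <- cube d N | normsq m == r) (A m * box_avg (fun y => wave m 0 y * wave m' p y) +
       B m * box_avg (fun y => wave m (- (pi / 2)) y * wave m' p y)) =
    \sum_(m <- cube d N | normsq m == r) (2^-1 * (A m * cos (0 + p) + B m * cos (- (pi / 2) + p))) * (m == - m')%:R +
    \sum_(m <- cube d N | normsq m == r) (2^-1 * (A m * cos (0 - p) + B m * cos (- (pi / 2) - p))) * (m == m')%:R.
  by rewrite -big_split/=; apply: eq_bigr => m _; rewrite !box_avg_waveM; ring.
rewrite !sum_delta ?uniq_cube// normsqN.
have [mr|mr] := eqVneq (normsq m') r; last first.
  rewrite !andbF !mul0r addr0 mulr0 addr0; apply: (eigenfunction_orth (wave_eigenfunction m' p)).
  apply: contraNN mr; rewrite lamk => /eqP.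
  have c0 : 4 * pi ^+ 2 != 0 :> R by rewrite mulf_neq0 ?expf_neq0 ?gt_eqF ?pi_gt0.
  by move=> /(mulfI c0) /eqP; rewrite eqr_nat eq_sym.
rewrite !mem_cube_normsq ?normsqN ?mr// !mul1r.
have -> : A (- m') = A m' by apply: eq_box_avg => y; rewrite wave0N.
have -> : B (- m') = - B m'.
  rewrite /B (eq_box_avg (g := fun y => -1 * (wave m' (- (pi / 2)) y * phi k y))).
    by rewrite box_avgZ// mulN1r.
  by move=> y; rewrite wave_sinN mulN1r mulNr.
have -> : box_avg (fun y => wave m' p y * phi k y) = cos p * A m' - sin p * B m'.
  rewrite -mulNr -avgE; apply: eq_box_avg => y.
  by rewrite [in LHS]wave_phase mulNr.
rewrite add0r sub0r cosN (addrC (- (pi / 2)) p) cosBpihalf (addrC (- (pi / 2)) (- p)) cosBpihalf sinN.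
by field.
Qed.

Lemma eigenfunction_expand mu (f : 'rV[R]_d -> R) : eigenfunction mu f ->
  exists n0, forall n, (n0 <= n)%N -> forall x,
    f x = \sum_(k < n) box_avg (fun x => f x * phi k x) * phi k x.
Proof.
move=> ef; have [n0 [c fE]] := eigfun_span S ef; exists n0 => n n0n x.
have cE k : box_avg (fun x => f x * phi k x) = (k < n0)%:R * c k.
  by under eq_box_avg do rewrite fE; exact: box_avg_eigfun_sum.
rewrite [LHS]fE (big_ord_widen n (fun k => c k * phi k x) n0n) big_mkcond/=.
apply: eq_bigr => k _; rewrite cE; case: (k < n0)%N; by rewrite ?mul1r ?mul0r.
Qed.

Definition level_fun r N (x : 'rV[R]_d) : R := \sum_(m <- cube d N | normsq m == r) wave m 0 x.

(** Both sides are the reproducing kernel of the same eigenspace: expand every wave of the level in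
    the [phi k], exchange the sums and apply [eigfun_reproducing]. The threshold is the largest
    number of eigenfunctions used by one of the finitely many waves. *)
Lemma level_sum r N y : (r <= N)%N -> exists n0, forall n, (n0 <= n)%N -> forall x,
  \sum_(k < n | lam k == 4 * pi ^+ 2 * r%:R) phi k x * phi k y = level_fun r N (x - y).
Proof.
move=> rN.
have [nm Hnm] : exists nm : 'rV[int]_d -> nat, forall m n, (nm m <= n)%N -> forall x,
    wave m (- (2 * pi * dot m y)) x =
    \sum_(k < n) box_avg (fun x => wave m (- (2 * pi * dot m y)) x * phi k x) * phi k x.
  have H m := cid (eigenfunction_expand (wave_eigenfunction m (- (2 * pi * dot m y)))).
  by exists (fun m => projT1 (H m)) => m; exact: (projT2 (H m)).
exists (\max_(m <- cube d N) nm m)%N => n nn x.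
transitivity (\sum_(m <- cube d N | normsq m == r) \sum_(k < n)
    box_avg (fun x => wave m (- (2 * pi * dot m y)) x * phi k x) * phi k x); last first.
  rewrite /level_fun big_seq_cond [RHS]big_seq_cond; apply: eq_bigr => m /andP[mN _].
  rewrite -Hnm; last by apply: leq_trans nn; exact: leq_bigmax_seq.
  rewrite /wave addr0; congr cos.
  by under [in RHS]eq_bigr do rewrite mxE mxE mulrDr mulrN; rewrite sumrB mulrBr.
rewrite exchange_big/= big_mkcond/=; apply: eq_bigr => k _; rewrite -mulr_suml.
case: ifPn => [/eqP lamk|lamk]; first by rewrite mulrC eigfun_reproducing.
rewrite big1 ?mul0r// => m /eqP mr; apply: eigenfunction_orth (wave_eigenfunction m _) _.
by rewrite mr.
Qed.

(** At any other eigenvalue [phi k] would be orthogonal to all waves, hence zero, against its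
    normalization. *)
Lemma eigval_form k : exists r : nat, lam k = 4 * pi ^+ 2 * r%:R.
Proof.
apply: contrapT => H.
have phi0 x : phi k x = 0.
  have [[phi_per [phi_cont _] _] B] := (eigfunP S k, eigfun_bounded S k).
  apply: (wave_orth_eq0 (eigfun_unif_cont S k)) => // m p.
  rewrite (eq_box_avg (g := fun x => wave m p x * phi k x)); last by move=> y; rewrite mulrC.
  apply: (eigenfunction_orth (wave_eigenfunction m p)).
  by apply/eqP => E; apply: H; exists (normsq m).
have := box_avg_eigfunM S k k; rewrite eqxx.
under eq_box_avg do rewrite phi0 mulr0.
by rewrite box_avg_cst => /esym/eqP; rewrite oner_eq0.
Qed.

Lemma wave00 n (m : 'rV[int]_n) : wave m 0 0 = 1 :> R.
Proof. by rewrite /wave big1 ?mulr0 ?addr0 ?cos0// => i _; rewrite mxE mulr0. Qed.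

(** Diagonal terms are squares, so an incomplete level is dominated by the complete one, whose value
    is the same at every point. This handles partial sums that stop inside a level. *)
Lemma level_sum_sqr_le r N n y : (r <= N)%N ->
  \sum_(k < n | lam k == 4 * pi ^+ 2 * r%:R) phi k y ^+ 2 <= level_fun r N 0.
Proof.
move=> rN; have [n0 Hn0] := level_sum y rN.
rewrite -(subrr y) -(Hn0 (maxn n0 n) (leq_maxl _ _)).
rewrite (big_ord_widen_cond (maxn n0 n) (fun k => lam k == 4 * pi ^+ 2 * r%:R) (fun k => phi k y ^+ 2) (leq_maxr _ _)).
under [leRHS]eq_bigr do rewrite -expr2.
rewrite big_mkcondr/=; apply: ler_sum => k _; case: ifP => // _; exact: sqr_ge0.
Qed.

Lemma level_sum_le r N n x y : (r <= N)%N ->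
  `|\sum_(k < n | lam k == 4 * pi ^+ 2 * r%:R) phi k x * phi k y| <= level_fun r N 0.
Proof.
move=> rN; apply: (le_trans (ler_norm_sum _ _ _)).
apply: (@le_trans _ _ (\sum_(k < n | lam k == 4 * pi ^+ 2 * r%:R) 2^-1 * (phi k x ^+ 2 + phi k y ^+ 2))).
  apply: ler_sum => k _; rewrite ler_norml; have := sqr_ge0 (phi k x - phi k y).
  by have := sqr_ge0 (phi k x + phi k y); rewrite sqrrB sqrrD; lra.
rewrite -mulr_sumr big_split/=.
by have := level_sum_sqr_le n x rN; have := level_sum_sqr_le n y rN; lra.
Qed.

(** If no eigenvalue were equal to 4 pi^2 j^2, the kernel of that level would vanish at the origin,
    where it counts the waves of the level; there is at least the wave with index (j, 0, ..., 0). *)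
Lemma eigval_unbounded : (0 < d)%N -> forall M : R, exists n, M < lam n.
Proof.
move=> d0 M; pose j := (Num.Def.truncn `|M|).+1.
pose m : 'rV[int]_d := \row_i (if i == Ordinal d0 then j%:Z else 0).
have mj : normsq m = (j ^ 2)%N.
  rewrite /normsq (bigD1 (Ordinal d0))//= big1 ?addn0 => [|i i0]; first by rewrite mxE eqxx.
  by rewrite mxE (negbTE i0).
have [n0 /(_ n0 (leqnn n0) 0)] := level_sum 0 (leqnn (j ^ 2)%N).
rewrite subr0; case: (pickP (fun k : 'I_n0 => lam k == 4 * pi ^+ 2 * (j ^ 2)%:R)) => [k /eqP lamk _|H].
  exists k; rewrite lamk; apply: (le_lt_trans (ler_norm M)).
  apply: (@lt_le_trans _ _ j%:R); first exact: truncnS_gt.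
  apply: (@le_trans _ _ (j ^ 2)%:R); first by rewrite ler_nat expnS expn1 leq_pmulr.
  rewrite ler_peMl//; have := pi_ge2 R => p2.
  by have : 2 ^+ 2 <= pi ^+ 2 :> R; [rewrite lerXn2r ?nnegrE ?pi_ge0|lra].
rewrite big_pred0// /level_fun; under eq_bigr do rewrite wave00.
have mc : m \in [seq m <- cube d (j ^ 2) | normsq m == (j ^ 2)%N].
  by rewrite mem_filter mj eqxx mem_cube_normsq// mj.
rewrite -big_filter big_const_seq count_predT iter_addr_0 => /esym/eqP.
by rewrite pnatr_eq0 size_eq0 => /eqP E; rewrite E in mc.
Qed.

Lemma sum_by_level (s : seq 'rV[int]_d) N (F : 'rV[int]_d -> R) :
  \sum_(m <- s) F m = \sum_(r < N.+1) \sum_(m <- s | normsq m == r) F m +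
    \sum_(m <- s | (N < normsq m)%N) F m.
Proof.
under [X in X + _]eq_bigr do rewrite big_mkcond.
rewrite exchange_big/= [X in _ + X]big_mkcond -big_split/=; apply: eq_bigr => m _.
have [Nm|mN] := ltnP N (normsq m).
  rewrite big1 ?add0r// => r _; case: eqP => // E.
  by have := ltn_ord r; rewrite -E ltnS leqNgt Nm.
rewrite addr0 (bigD1 (Ordinal (mN : (normsq m < N.+1)%N)))//= eqxx big1 ?addr0// => r rm.
by case: eqP => // E; case/eqP: rm; apply/val_inj.
Qed.

(** Compares partial sums [s n] in the order of eigenvalues with cube sums [W N]. Levels strictly
    below [lam n] agree exactly; on the others both sums are bounded by complete levels, and these
    carry a factor exp (- lam_n t / 2). Letting [N] grow first and [n] afterwards gives the
    limit. *)
Lemma heat_series_cvg (t : R) (x y : 'rV[R]_d) : (0 < d)%N -> 0 < t ->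
  \sum_(k < n) expR (- (lam k * t)) * phi k x * phi k y @[n --> \oo] -->
    \prod_i theta t (x 0 i - y 0 i).
Proof.
move=> d0 t0.
have t20 : 0 < t / 2 by rewrite divr_gt0.
set T := \prod_i _.
pose W N := \sum_(m <- cube d N) expR (- (4 * pi ^+ 2 * (normsq m)%:R * t)) * wave m 0 (x - y).
have WT : W N @[N --> \oo] --> T.
  have -> : T = \prod_i theta t ((x - y) 0 i) by apply: eq_bigr => i _; rewrite !mxE.
  exact: theta_prod_cvg.
pose V N := \sum_(m <- cube d N) expR (- (4 * pi ^+ 2 * (normsq m)%:R * (t / 2))).
have [B [N1 HN1]] : exists B, exists N1, forall N, (N1 <= N)%N -> V N <= B.
  have /cvgrPdist_lt /(_ 1 ltr01)[N1 _ H] := @theta_prod_cvg R d (t / 2) 0 t20.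
  exists (\prod_i theta (t / 2) ((0 : 'rV[R]_d) 0 i) + 1), N1 => N N1N.
  have := H N N1N; rewrite /= (eq_bigr (fun m => expR (- (4 * pi ^+ 2 * (normsq m)%:R * (t / 2))))); last first.
    by move=> m _; rewrite wave00 mulr1.
  by rewrite -/(V N) ltr_norml => /andP[]; lra.
have B0 : 0 <= B by apply: le_trans (HN1 _ (leqnn _)); apply: sumr_ge0 => m _; exact: expR_ge0.
pose s n := \sum_(k < n) expR (- (lam k * t)) * phi k x * phi k y.
have key n N : (forall k : 'I_n, exists2 r : nat, (r <= N)%N & lam k = 4 * pi ^+ 2 * r%:R) ->
    lam n <= 4 * pi ^+ 2 * N%:R -> `|s n - W N| <= 2 * expR (- (lam n * t / 2)) * V N.
  move=> kN nN.
  pose a r := \sum_(k < n | lam k == 4 * pi ^+ 2 * r%:R) phi k x * phi k y.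
  have sE : s n = \sum_(r < N.+1) expR (- (4 * pi ^+ 2 * r%:R * t)) * a r.
    transitivity (\sum_(r < N.+1) \sum_(k < n | lam k == 4 * pi ^+ 2 * r%:R)
        expR (- (lam k * t)) * phi k x * phi k y).
      rewrite (exchange_big_dep xpredT)//=; apply: eq_bigr => k _.
      have [r rN lamk] := kN k.
      rewrite (bigD1 (Ordinal (rN : (r < N.+1)%N))) /= ?lamk// big1 ?addr0// => r' /andP[/eqP E].
      case/eqP; apply/val_inj => /=; apply/eqP; rewrite -(@eqr_nat R) eq_sym; apply/eqP.
      by move: E; apply: mulfI; rewrite mulf_neq0 ?expf_neq0 ?gt_eqF ?pi_gt0.
    apply: eq_bigr => r _; rewrite /a mulr_sumr; apply: eq_bigr => k /eqP ->.
    by rewrite mulrA.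
  (* As eigenvalues are listed in order, a level strictly below [lam n] has all its members among
     the first [n]. *)
  have lt_level (r : nat) : (r <= N)%N -> 4 * pi ^+ 2 * r%:R < lam n -> a r = level_fun r N (x - y).
    move=> rN rn; have [n0 Hn0] := level_sum y rN.
    rewrite -(Hn0 _ (leq_maxl n0 n)) /a.
    rewrite (big_ord_widen_cond (maxn n0 n) (fun k => lam k == 4 * pi ^+ 2 * r%:R) (fun k => phi k x * phi k y) (leq_maxr _ _)).
    apply: eq_bigl => k; have [kn|nk] := ltnP k n; first by rewrite andbT.
    rewrite andbF; apply/esym/negbTE; rewrite gt_eqF//.
    exact: (lt_le_trans rn (eigval_ndecr S nk)).
  (* Half of the time yields smallness, the other half keeps the sum over levels bounded by
     [V N]. *)
  have decay (u : R) : lam n <= u -> expR (- (u * t)) <= expR (- (lam n * t / 2)) * expR (- (u * (t / 2))).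
    move=> nu; rewrite -expRD ler_expR.
    by have := ler_wpM2r (ltW t0) nu; lra.
  have c0 (r : nat) : 0 <= level_fun r N 0.
    by apply: sumr_ge0 => m _; rewrite wave00.
  rewrite sE /W (sum_by_level _ N) opprD addrA -sumrB.
  apply: (@le_trans _ _ (2 * expR (- (lam n * t / 2)) *
    (\sum_(r < N.+1) \sum_(m <- cube d N | normsq m == r) expR (- (4 * pi ^+ 2 * (normsq m)%:R * (t / 2))) +
     \sum_(m <- cube d N | (N < normsq m)%N) expR (- (4 * pi ^+ 2 * (normsq m)%:R * (t / 2)))))); last first.
    by rewrite -sum_by_level.
  rewrite mulrDr; apply: (le_trans (ler_normB _ _)); apply: lerD.
    apply: (le_trans (ler_norm_sum _ _ _)); rewrite mulr_sumr; apply: ler_sum => r _.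
    have rN : (r <= N)%N by rewrite -ltnS.
    rewrite (eq_bigr (fun m => expR (- (4 * pi ^+ 2 * r%:R * t)) * wave m 0 (x - y))); last first.
      by move=> m /eqP ->.
    rewrite [X in _ <= _ * X](eq_bigr (fun m => expR (- (4 * pi ^+ 2 * r%:R * (t / 2))) * wave m 0 0)); last first.
      by move=> m /eqP ->; rewrite wave00 mulr1.
    rewrite -mulr_sumr -/(level_fun r N _) -mulr_sumr -/(level_fun r N _) -mulrBr normrM gtr0_norm ?expR_gt0//.
    have [rn|nr] := ltP (4 * pi ^+ 2 * r%:R) (lam n).
      rewrite lt_level// subrr normr0 mulr0 !mulr_ge0 ?expR_ge0//.
    have h1 : `|a r - level_fun r N (x - y)| <= 2 * level_fun r N 0.
      apply: (le_trans (ler_normB _ _)); rewrite mulr2n mulrDl mul1r; apply: lerD.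
        exact: level_sum_le.
      apply: (le_trans (ler_norm_sum _ _ _)); apply: ler_sum => m _.
      by rewrite wave00 wave_le1.
    apply: (@le_trans _ _ (expR (- (lam n * t / 2)) * expR (- (4 * pi ^+ 2 * r%:R * (t / 2))) * (2 * level_fun r N 0))).
      by apply: ler_pM => //; exact: decay.
    by rewrite le_eqVlt; apply/orP; left; apply/eqP; ring.
  apply: (le_trans (ler_norm_sum _ _ _)); rewrite mulr_sumr; apply: ler_sum => m Nm.
  rewrite normrM gtr0_norm ?expR_gt0//.
  apply: (@le_trans _ _ (expR (- (4 * pi ^+ 2 * (normsq m)%:R * t)))).
    by rewrite ler_piMr ?expR_ge0// wave_le1.
  apply: (le_trans (decay _ _)).
    apply: (le_trans nN); rewrite ler_wpM2l ?mulr_ge0 ?exprn_ge0 ?pi_ge0//.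
    by rewrite ler_nat ltnW.
  set y1 := expR _; set y2 := expR _.
  by have : 0 <= y1 * y2; [rewrite mulr_ge0 ?expR_ge0|lra].
have sT n : `|T - s n| <= 2 * expR (- (lam n * t / 2)) * B.
  apply: (limn_norm_le WT).
  have [r Hr] : exists r : nat -> nat, forall k, lam k = 4 * pi ^+ 2 * (r k)%:R.
    by exists (fun k => projT1 (cid (eigval_form k))) => k; exact: (projT2 (cid (eigval_form k))).
  exists (maxn N1 (\max_(k < n.+1) r k)) => N; rewrite geq_max => /andP[N1N /bigmax_leqP HN].
  rewrite distrC; apply: (le_trans (key n N _ _)).
  - move=> k; exists (r k) => //; exact: (HN (widen_ord (leqnSn n) k) isT).
  - by rewrite Hr ler_wpM2l ?mulr_ge0 ?exprn_ge0 ?pi_ge0// ler_nat; exact: (HN ord_max isT).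
  - by rewrite ler_wpM2l ?mulr_ge0 ?expR_ge0// HN1.
apply/cvgrPdist_le => e e0.
(* Makes z = lam_n' t / 2 exceed 2 (B + 1) / e for later n'; then z < exp z turns the bound 2 B exp
   (- z) into at most e. *)
have [n Hn] := eigval_unbounded d0 (2 / t * (2 * (B + 1) / e)).
exists n => // n' /= nn'; apply: (le_trans (sT n')).
set z := lam n' * t / 2.
have zb : 2 * (B + 1) / e < z.
  rewrite /z; have := lt_le_trans Hn (eigval_ndecr S nn').
  by rewrite mulrC mulrA ltr_pdivrMr// -ltr_pdivlMr.
have z1 : z < expR z by apply: lt_le_trans (expR_ge1Dx z); rewrite ltrDr.
rewrite expRN mulrAC ler_pdivrMr ?expR_gt0//.
have : 2 * (B + 1) < z * e by rewrite -ltr_pdivrMr.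
have := ler_wpM2l (ltW e0) (ltW z1).
by lra.
Qed.

Lemma heat_kernel_theta (L : {posnum R}) (t : R) (x y : 'rV[R]_d) : (0 < d)%N -> 0 < t ->
  heat_kernel S L t x y =
  L%:num ^- d * \prod_i theta (t * L%:num ^- 2) ((x 0 i - y 0 i) / L%:num).
Proof.
move=> d0 t0; rewrite /heat_kernel; congr (_ * _).
have tL : 0 < t * L%:num ^- 2 by rewrite mulr_gt0// invr_gt0 exprn_gt0.
have -> : \prod_i theta (t * L%:num ^- 2) ((x 0 i - y 0 i) / L%:num) =
    \prod_i theta (t * L%:num ^- 2) ((L%:num^-1 *: x) 0 i - (L%:num^-1 *: y) 0 i).
  by apply: eq_bigr => i _; congr (theta _ _); rewrite !mxE -mulrBr mulrC.
apply/cvg_lim => //.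
have := @heat_series_cvg _ (L%:num^-1 *: x) (L%:num^-1 *: y) d0 tL.
by under eq_fun do under eq_bigr do rewrite mulrA.
Qed.

End levels.

(** * Poisson summation for Gaussians *)

Section poisson_tools.
Context {R : realType}.

Lemma derive_int01 (h g : R -> R -> R) (a u v K : R) : u < a < v ->
  (forall x, u < x < v -> continuous (h x)) ->
  (forall x y, u < x < v -> is_derive x (1 : R) (fun x => h x y) (g x y)) ->
  (forall x y, u < x < v -> 0 <= y < 1 -> `|g x y| <= K) ->
  is_derive a (1 : R) (fun x => int01 (h x)) (int01 (g a)).
Proof.
move=> uav ch dh gK.
have Ia : `]u, v[%classic a by rewrite /= in_itv.
have i1 (x : R) : `]u, v[%classic x ->
    (@lebesgue_measure R).-integrable `[0%R, 1%R[ (EFin \o h x).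
  by rewrite /= in_itv/= => /ch; exact: continuous_integrable01.
have i2 (x y : R) : `]u, v[%classic x -> `[0%R, 1%R[%classic y -> derivable (h ^~ y) x 1.
  by rewrite /= in_itv/= => ux _; have [] := dh x y ux.
have ck : continuous (fun _ : R => K) by exact: continuous_fun_cst.
have K0 (y : R) : 0 <= K.
  apply: le_trans (gK a 0 uav _) => //; first by rewrite lexx ltr01.
have i3 := continuous_integrable01 ck.
have dE x y : u < x < v -> partial1of2 h x y = g x y.
  by move=> ux; rewrite partial1of2E; have [_ <-] := dh x y ux.
have i4 (x y : R) : `]u, v[%classic x -> `[0%R, 1%R[%classic y -> `|partial1of2 h x y| <= K.
  by rewrite /= !in_itv/= => ux y01; rewrite dE//; exact: gK.
have D := @derivable_under_integral _ _ _ lebesgue_measure h `[0%R, 1%R[%classic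
  (measurable_itv _) a u v Ia i1 i2 (fun=> K) K0 i3 i4.
have V := @differentiation_under_integral _ _ _ lebesgue_measure h `[0%R, 1%R[%classic
  (measurable_itv _) a u v Ia i1 i2 (fun=> K) K0 i3 i4.
split; first exact: D.
rewrite -derive1E [LHS]V; apply: eq_Rintegral => y _.
by rewrite dE.
Qed.

Lemma continuous_zsum (F : int -> R -> R) N : (forall j, continuous (F j)) ->
  continuous (fun u => zsum (F ^~ u) N).
Proof. by move=> cF; exact: continuous_sum. Qed.

Lemma int01_zsum (F : int -> R -> R) N : (forall j, continuous (F j)) ->
  int01 (fun u => zsum (F ^~ u) N) = zsum (fun j => int01 (F j)) N.
Proof.
move=> cF; elim: N => [|N IH].
  by rewrite zsum0; apply: eq_int01 => u; rewrite zsum0.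
have c1 : continuous (fun u => F N.+1%:Z u + F (- N.+1%:Z) u) by exact: continuous_funD.
rewrite zsumS -IH -(int01D (cF _) (cF _)) -(int01D c1 (continuous_zsum cF)).
by apply: eq_int01 => u; rewrite zsumS.
Qed.

Lemma continuous_zsum_lim (F : int -> R -> R) : (forall j, continuous (F j)) ->
  (forall M, exists C q : R, 0 <= q < 1 /\ forall j u, `|u| <= M -> `|F j u| <= C * q ^+ `|j|%N) ->
  continuous (fun u => limn (zsum (F ^~ u))).
Proof.
move=> cF FC x; apply/cvgrPdist_le => e e0.
have [C [q [q01 H]]] := FC (`|x| + 1).
have q1 : `|q| < 1 by rewrite ger0_norm; case/andP: q01.
have : 2 * C / (1 - q) * q ^+ n @[n --> \oo] --> 2 * C / (1 - q) * 0.
  by apply: cvgM; [exact: cvg_cst|exact: cvg_expr].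
have e3 : 0 < e / 3 by rewrite divr_gt0.
rewrite mulr0 => /cvgrPdist_lt /(_ _ e3)[N _ /(_ N (leqnn N))].
rewrite /= sub0r normrN => /(le_lt_trans (ler_norm _)) qN.
have tail u : `|u| <= `|x| + 1 -> `|limn (zsum (F ^~ u)) - zsum (F ^~ u) N| <= e / 3.
  move=> ux; apply/ltW; apply: le_lt_trans qN.
  by apply: zsum_lim_tail => // j; exact: H.
have cN : continuous (fun u => zsum (F ^~ u) N) by exact: continuous_zsum.
have /cvgrPdist_lt /(_ _ e3) := cN x.
move=> near1; near=> y.
have y1 : `|y| <= `|x| + 1.
  have : `|x - y| < 1 by near: y; apply: cvgr_dist_lt => //; exact: cvg_id.
  move=> xy; rewrite -(subrK x y) addrC; apply: (le_trans (ler_normD _ _)).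
  by rewrite lerD2l distrC ltW.
have h1 := tail x; have h2 := tail y y1.
have {}h1 : `|limn (zsum (F ^~ x)) - zsum (F ^~ x) N| <= e / 3 by apply: h1; rewrite lerDl.
have h3 : `|zsum (F ^~ x) N - zsum (F ^~ y) N| < e / 3 by near: y; exact: near1.
move: h1 h2 h3; rewrite !ler_norml ltr_norml.
by lra.
Unshelve. all: by end_near. Qed.

Lemma int01_zsum_lim (F : int -> R -> R) (C q : R) : (forall j, continuous (F j)) ->
  continuous (fun u => limn (zsum (F ^~ u))) -> 0 <= q < 1 ->
  (forall j u, 0 <= u < 1 -> `|F j u| <= C * q ^+ `|j|%N) ->
  zsum (fun j => int01 (F j)) N @[N --> \oo] --> int01 (fun u => limn (zsum (F ^~ u))).
Proof.
move=> cF cl q01 FC; apply/cvgrPdist_le => e e0.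
have q1 : `|q| < 1 by rewrite ger0_norm; case/andP: q01.
have : 2 * C / (1 - q) * q ^+ n @[n --> \oo] --> 2 * C / (1 - q) * 0.
  by apply: cvgM; [exact: cvg_cst|exact: cvg_expr].
rewrite mulr0 => /cvgrPdist_lt /(_ _ e0)[N _ HN]; exists N => // n /= Nn.
have := HN n Nn; rewrite /= sub0r normrN => /(le_lt_trans (ler_norm _)) qN.
rewrite -int01_zsum// -int01B//; last exact: continuous_zsum.
apply: int01_norm_le.
  by move=> x; apply: cvgB; [exact: cl|exact: continuous_zsum].
move=> u u01; apply/ltW; apply: le_lt_trans qN.
by apply: zsum_lim_tail => // j; exact: FC.
Qed.

Lemma zsum_telescope (f : int -> R) N :
  zsum (fun j => f (j + 1)) N - zsum f N = f (N%:Z + 1) - f (- N%:Z).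
Proof.
elim: N => [|N IH]; first by rewrite !zsum0 add0r oppr0.
rewrite !zsumS.
have -> : - N.+1%:Z + 1 = - N%:Z by lia.
have -> : N.+1%:Z = N%:Z + 1 by lia.
by move: IH; lra.
Qed.

End poisson_tools.

(** * Periodized Gaussians and a flow of Gaussian waves *)

Section gauss_sum.
Context {R : realType}.
Implicit Types (a u x c p t : R).

Definition gauss_sum a u : R := limn (zsum (fun j => expR (- (a * (u + j%:~R) ^+ 2)))).

(** From (u + j)^2 = (2 u + j)^2 / 2 + j^2 / 2 - u^2 and j^2 >= |j|. A bound linear in |j| turns
    Gaussian terms into geometric ones, uniformly for bounded u. *)
Lemma sqr_shift_ge u (j : int) : `|j|%N%:R / 2 - u ^+ 2 <= (u + j%:~R) ^+ 2.
Proof.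
have h : `|j|%N%:R <= j%:~R ^+ 2 :> R.
  rewrite -natr_absz_sqr natrX; case: (absz j) => [|k]; first by rewrite expr0n.
  by rewrite expr2 ler_peMl// ler1n.
have := sqr_ge0 (u * 2 + j%:~R).
by rewrite !sqrrD exprMn; lra.
Qed.

Lemma gauss_term_le a u (j : int) : 0 <= a ->
  `|expR (- (a * (u + j%:~R) ^+ 2))| <= expR (a * u ^+ 2) * expR (- (a / 2)) ^+ `|j|%N.
Proof.
move=> a0; rewrite gtr0_norm ?expR_gt0// -expRM_natl -expRD ler_expR.
by have := ler_wpM2l a0 (sqr_shift_ge u j); lra.
Qed.

Lemma gauss_ratio a : 0 < a -> 0 <= expR (- (a / 2)) < 1.
Proof. by move=> a0; rewrite expR_ge0 expR_lt1 oppr_lt0 divr_gt0. Qed.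

Lemma gauss_sum_cvg a u : 0 < a ->
  zsum (fun j => expR (- (a * (u + j%:~R) ^+ 2))) N @[N --> \oo] --> gauss_sum a u.
Proof.
by move=> a0; exact: (zsum_cvg (gauss_ratio a0) (fun j => gauss_term_le u j (ltW a0))).
Qed.

Lemma continuous_gauss_term a c p (j : int) :
  continuous (fun u => expR (- (a * (u + j%:~R) ^+ 2)) * cos (c * u + p)).
Proof.
apply: continuous_funM => u.
  apply: (@continuous_comp _ _ _ (fun u : R => - (a * (u + j%:~R) ^+ 2)) expR); last exact: continuous_expR.
  apply: cvgN; apply: cvgM; first exact: cvg_cst.
  have cD : continuous (fun u : R => u + j%:~R) by move=> v; apply: cvgD; [exact: cvg_id|exact: cvg_cst].
  by apply: (continuous_funM cD cD).
apply: (@continuous_comp _ _ _ (fun u : R => c * u + p) cos); last exact: continuous_cos.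
by apply: cvgD; [apply: cvgM; [exact: cvg_cst|exact: cvg_id]|exact: cvg_cst].
Qed.

Lemma gauss_cos_term_le a c p u (j : int) : 0 <= a ->
  `|expR (- (a * (u + j%:~R) ^+ 2)) * cos (c * u + p)| <= expR (a * u ^+ 2) * expR (- (a / 2)) ^+ `|j|%N.
Proof.
move=> a0; rewrite normrM; apply: le_trans (gauss_term_le u j a0).
by rewrite ler_piMr// cos_max.
Qed.

Lemma gauss_cos_lim a c p u : 0 < a ->
  limn (zsum (fun j => expR (- (a * (u + j%:~R) ^+ 2)) * cos (c * u + p))) = gauss_sum a u * cos (c * u + p).
Proof.
move=> a0; apply/cvg_lim => //.
have -> : zsum (fun j => expR (- (a * (u + j%:~R) ^+ 2)) * cos (c * u + p)) =
    (fun N => zsum (fun j => expR (- (a * (u + j%:~R) ^+ 2))) N * cos (c * u + p)).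
  by apply/funext => N; rewrite /zsum mulr_suml.
by apply: cvgM; [exact: gauss_sum_cvg|exact: cvg_cst].
Qed.

Lemma continuous_gauss_cos a c p : 0 < a ->
  continuous (fun u => gauss_sum a u * cos (c * u + p)).
Proof.
move=> a0.
rewrite (_ : (fun _ => _) = fun u => limn (zsum (fun j => expR (- (a * (u + j%:~R) ^+ 2)) * cos (c * u + p)))).
  apply: (@continuous_zsum_lim _ (fun j u => expR (- (a * (u + j%:~R) ^+ 2)) * cos (c * u + p))).
    by move=> j; exact: continuous_gauss_term.
  move=> M; exists (expR (a * M ^+ 2)), (expR (- (a / 2))); split; first exact: gauss_ratio.
  move=> j u uM; apply: (le_trans (gauss_cos_term_le c p u j (ltW a0))).
  rewrite ler_wpM2r ?exprn_ge0 ?expR_ge0// ler_expR ler_wpM2l ?(ltW a0)//.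
  by rewrite -(real_normK (num_real u)) lerXn2r ?nnegrE//; exact: le_trans uM.
by apply/funext => u; rewrite gauss_cos_lim.
Qed.

Definition gauss_coef a (k : int) p : R :=
  int01 (fun u => gauss_sum a u * cos (2 * pi * k%:~R * u + p)).

Lemma gauss_coef_cvg a k p : 0 < a ->
  int01 (fun u => zsum (fun j => expR (- (a * (u + j%:~R) ^+ 2)) * cos (2 * pi * k%:~R * (u + j%:~R) + p)) N)
    @[N --> \oo] --> gauss_coef a k p.
Proof.
move=> a0; rewrite /gauss_coef.
have E u (j : int) : cos (2 * pi * k%:~R * (u + j%:~R) + p) = cos (2 * pi * k%:~R * u + p).
  rewrite -[RHS](cosD2piz _ (k * j)); congr cos; rewrite intrM; ring.
have -> : (fun u => gauss_sum a u * cos (2 * pi * k%:~R * u + p)) =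
    fun u => limn (zsum (fun j => expR (- (a * (u + j%:~R) ^+ 2)) * cos (2 * pi * k%:~R * u + p))).
  by apply/funext => u; rewrite gauss_cos_lim.
have -> : (fun N => int01 (fun u => zsum (fun j => expR (- (a * (u + j%:~R) ^+ 2)) * cos (2 * pi * k%:~R * (u + j%:~R) + p)) N)) =
    (fun N => zsum (fun j => int01 (fun u => expR (- (a * (u + j%:~R) ^+ 2)) * cos (2 * pi * k%:~R * u + p))) N).
  apply/funext => N.
  rewrite -(int01_zsum (F := fun j u => expR (- (a * (u + j%:~R) ^+ 2)) * cos (2 * pi * k%:~R * u + p))).
    by apply: eq_int01 => u; rewrite /zsum; apply: eq_bigr => j _; rewrite E.
  by move=> j; exact: continuous_gauss_term.
apply: (@int01_zsum_lim _ (fun j u => expR (- (a * (u + j%:~R) ^+ 2)) * cos (2 * pi * k%:~R * u + p)) (expR a) (expR (- (a / 2)))).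
- by move=> j; exact: continuous_gauss_term.
- rewrite (_ : (fun _ => _) = (fun u => gauss_sum a u * cos (2 * pi * k%:~R * u + p))).
    exact: continuous_gauss_cos.
  by apply/funext => u; rewrite gauss_cos_lim.
- exact: gauss_ratio.
- move=> j u /andP[u0 u1]; apply: (le_trans (gauss_cos_term_le _ _ _ _ (ltW a0))).
  rewrite ler_wpM2r ?exprn_ge0 ?expR_ge0// ler_expR ger_pMr//.
  by rewrite expr_le1// ltW.
Qed.

(* A rescaled Gaussian wave whose t-derivative is an exact x-derivative, so that its
   integral over R does not depend on t; letting t tend to infinity evaluates the Fourier
   transform of the Gaussian. *)
Definition gauss_flow c p t x : R :=
  expR (c ^+ 2 / 4 * expR (- 2 * t) + t - expR (2 * t) * x ^+ 2) * cos (c * x + p).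

Definition gauss_flow_dt c p t x : R :=
  expR (c ^+ 2 / 4 * expR (- 2 * t) + t - expR (2 * t) * x ^+ 2) *
  (1 - c ^+ 2 / 2 * expR (- 2 * t) - 2 * expR (2 * t) * x ^+ 2) * cos (c * x + p).

Definition gauss_flow_potential c p t x : R :=
  expR (c ^+ 2 / 4 * expR (- 2 * t) + t - expR (2 * t) * x ^+ 2) *
  (x * cos (c * x + p) - c / 2 * expR (- 2 * t) * sin (c * x + p)).

Lemma is_derive_funN x (f : R -> R) (df : R) : is_derive x (1 : R) f df ->
  is_derive x (1 : R) (fun y => - f y) (- df).
Proof. by move=> H; exact: is_deriveN. Qed.

Lemma is_derive_fun_scale x (k : R) : is_derive x (1 : R) (fun y => k * y) k.
Proof.
apply: (is_derive_val (is_derive_funM (is_derive_fun_cst x k) (is_derive_fun_id x))).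
by rewrite mul0r add0r mulr1.
Qed.

Lemma is_derive_gauss_flow c p t x :
  is_derive t (1 : R) (fun t => gauss_flow c p t x) (gauss_flow_dt c p t x).
Proof.
have e1 k : is_derive t (1 : R) (fun t => expR (k * t)) (expR (k * t) * k).
  exact: (is_derive_fun_comp (g := fun t => k * t) (is_derive_expR (k * t)) (is_derive_fun_scale t k)).
have e2 : is_derive t (1 : R) (fun t => c ^+ 2 / 4 * expR (- 2 * t) + t - expR (2 * t) * x ^+ 2)
    (c ^+ 2 / 4 * (expR (- 2 * t) * - 2) + 1 + - (expR (2 * t) * 2 * x ^+ 2)).
  apply: (is_derive_val (is_derive_funD (is_derive_funD (is_derive_funM (is_derive_fun_cst t (c ^+ 2 / 4)) (e1 (- 2))) (is_derive_fun_id t))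
    (is_derive_funN (is_derive_funM (e1 2) (is_derive_fun_cst t (x ^+ 2)))))).
  by ring.
apply: (is_derive_val (is_derive_funM (is_derive_fun_comp (is_derive_expR _) e2) (is_derive_fun_cst t (cos (c * x + p))))).
by rewrite /gauss_flow_dt; field.
Qed.

Lemma is_derive_gauss_flow_potential c p t x :
  is_derive x (1 : R) (gauss_flow_potential c p t) (gauss_flow_dt c p t x).
Proof.
have e2 : is_derive x (1 : R) (fun x => c ^+ 2 / 4 * expR (- 2 * t) + t - expR (2 * t) * x ^+ 2)
    (- (expR (2 * t) * (2 * x))).
  apply: (is_derive_val (is_derive_funD (is_derive_fun_cst x (c ^+ 2 / 4 * expR (- 2 * t) + t))
    (is_derive_funN (is_derive_funM (is_derive_fun_cst x (expR (2 * t))) (is_derive_funM (is_derive_fun_id x) (is_derive_fun_id x)))))).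
  by ring.
have e3 := is_derive_fun_comp (g := fun x => c * x + p) (is_derive_cos (c * x + p)) (is_derive_fun_affine x c p).
have e4 := is_derive_fun_comp (g := fun x => c * x + p) (is_derive_sin (c * x + p)) (is_derive_fun_affine x c p).
apply: (is_derive_val (is_derive_funM (is_derive_fun_comp (is_derive_expR _) e2)
  (is_derive_funD (is_derive_funM (is_derive_fun_id x) e3)
   (is_derive_funN (is_derive_funM (is_derive_fun_cst x (c / 2 * expR (- 2 * t))) e4))))).
rewrite /gauss_flow_dt.
have E : expR (- 2 * t) = (expR (2 * t))^-1 by rewrite mulNr expRN.
rewrite E; have := expR_gt0 (2 * t); set A := expR (2 * t) => A0.
set X := expR _; set C := cos _; set D := sin _.
field.
by rewrite gt_eqF.
Qed.

(** Half of the Gaussian exponent, [z], absorbs the factor linear in x; the other half gives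
    geometric decay in N, uniformly for t between s0 and s1. *)
Lemma gauss_flow_potential_le c p t x (s0 s1 : R) (N : nat) : s0 <= t <= s1 -> N%:R <= `|x| ->
  `|gauss_flow_potential c p t x| <=
   expR (c ^+ 2 / 4 * expR (- 2 * s0) + s1) *
     (1 + `|c| / 2 * expR (- 2 * s0) + 2 / expR (2 * s0)) * expR (- (expR (2 * s0) / 2)) ^+ N.
Proof.
move=> /andP[s0t ts1] Nx.
set A0 := expR (2 * s0); set B0 := expR (- 2 * s0); set K := `|c| / 2 * B0.
have A00 : 0 < A0 by exact: expR_gt0.
have K0 : 0 <= K by rewrite mulr_ge0 ?divr_ge0 ?expR_ge0.
have x2N : N%:R <= x ^+ 2.
  rewrite -(real_normK (num_real x)); apply: (@le_trans _ _ (N%:R ^+ 2)); last by rewrite lerXn2r ?nnegrE.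
  by case: (N) => [|k]; rewrite ?expr0n// expr2 ler_peMl// ler1n.
have A0t : A0 <= expR (2 * t) by rewrite ler_expR ler_pM2l.
have B0t : expR (- 2 * t) <= B0 by rewrite ler_expR !mulNr lerN2 ler_pM2l.
pose z := expR (A0 * x ^+ 2 / 2).
have z0 : 0 < z by exact: expR_gt0.
have z1 : 1 <= z by rewrite -expR0 ler_expR divr_ge0// mulr_ge0 ?sqr_ge0 ?(ltW A00).
have zx : x ^+ 2 <= 2 / A0 * z.
  rewrite mulrAC ler_pdivlMr// mulrC (mulrC 2) -ler_pdivrMr//.
  by apply: le_trans (expR_ge1Dx _); rewrite lerDr.
have h1 : `|x * cos (c * x + p) - c / 2 * expR (- 2 * t) * sin (c * x + p)| <= (1 + K + 2 / A0) * z.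
  apply: (@le_trans _ _ (`|x| + K)).
    apply: (le_trans (ler_normB _ _)); rewrite !normrM; apply: lerD.
      by rewrite ler_piMr// cos_max.
    rewrite (gtr0_norm (expR_gt0 _)) -[leRHS]mulr1; apply: ler_pM => //.
    - have -> : `|2^-1| = 2^-1 :> R by rewrite ger0_norm ?invr_ge0.
      by rewrite /K ler_wpM2l ?divr_ge0.
    - exact: sin_max.
  have xx : `|x| <= 1 + x ^+ 2.
    by rewrite -(real_normK (num_real x)); have := sqr_ge0 (`|x| - 1); rewrite sqrrB; have := normr_ge0 x; lra.
  have : K <= K * z by rewrite ler_peMr.
  by rewrite !mulrDl mul1r; lra.
have h2 : expR (c ^+ 2 / 4 * expR (- 2 * t) + t - expR (2 * t) * x ^+ 2) <=
    expR (c ^+ 2 / 4 * B0 + s1) * expR (- (A0 * x ^+ 2)).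
  rewrite -expRD ler_expR; have c2 : 0 <= c ^+ 2 / 4 by rewrite divr_ge0// sqr_ge0.
  have := ler_wpM2l c2 B0t; have := ler_wpM2r (sqr_ge0 x) A0t; lra.
rewrite normrM gtr0_norm ?expR_gt0//.
apply: (le_trans (ler_pM (expR_ge0 _) (normr_ge0 _) h2 h1)).
have -> : expR (c ^+ 2 / 4 * B0 + s1) * expR (- (A0 * x ^+ 2)) * ((1 + K + 2 / A0) * z) =
   expR (c ^+ 2 / 4 * B0 + s1) * (1 + K + 2 / A0) * (expR (- (A0 * x ^+ 2)) * z) by ring.
rewrite ler_wpM2l//.
  by rewrite mulr_ge0 ?expR_ge0// !addr_ge0// divr_ge0// ltW.
rewrite -expRD -expRM_natl ler_expR.
have := ler_wpM2l (ltW A00) x2N; lra.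
Qed.

Lemma continuous_gauss_flow c p t : continuous (gauss_flow c p t).
Proof.
rewrite (_ : gauss_flow c p t = fun x => expR (c ^+ 2 / 4 * expR (- 2 * t) + t) *
  (expR (- (expR (2 * t) * (x + 0%:~R) ^+ 2)) * cos (c * x + p))).
  by apply: continuous_funM; [exact: continuous_fun_cst|exact: continuous_gauss_term].
by apply/funext => x; rewrite /gauss_flow addr0 expRD mulrA.
Qed.

Lemma continuous_gauss_flow_dt c p t : continuous (gauss_flow_dt c p t).
Proof.
rewrite (_ : gauss_flow_dt c p t = fun x =>
  (1 - c ^+ 2 / 2 * expR (- 2 * t) + (- (2 * expR (2 * t))) * (x * x)) * gauss_flow c p t x).
  apply: continuous_funM; last exact: continuous_gauss_flow.
  apply: continuous_funD; first exact: continuous_fun_cst.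
  apply: continuous_funM; first exact: continuous_fun_cst.
  by apply: continuous_funM => x; exact: cvg_id.
by apply/funext => x; rewrite /gauss_flow_dt /gauss_flow; ring.
Qed.

Lemma continuous_shift (f : R -> R) (b : R) : continuous f -> continuous (fun u => f (u + b)).
Proof.
move=> cf u; apply: (@continuous_comp _ _ _ (fun u : R => u + b) f); last exact: cf.
by apply: cvgD; [exact: cvg_id|exact: cvg_cst].
Qed.

(** The integral of the flow over [-N, N + 1], folded onto the unit interval. *)
Definition gauss_flow_int c p (N : nat) t : R :=
  int01 (fun u => zsum (fun j => gauss_flow c p t (u + j%:~R)) N).

Lemma gauss_flow_dt_le c p t x (s0 s1 M : R) : s0 <= t <= s1 -> `|x| <= M ->
  `|gauss_flow_dt c p t x| <= expR (c ^+ 2 / 4 * expR (- 2 * s0) + s1) *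
    (1 + c ^+ 2 / 2 * expR (- 2 * s0) + 2 * expR (2 * s1) * M ^+ 2).
Proof.
move=> /andP[s0t ts1] xM.
have c2 : 0 <= c ^+ 2 by exact: sqr_ge0.
have x2 : x ^+ 2 <= M ^+ 2.
  by rewrite -(real_normK (num_real x)) lerXn2r ?nnegrE//; exact: le_trans xM.
have e0 : 0 < expR (2 * t) by exact: expR_gt0.
have e0' : 0 < expR (- 2 * t) by exact: expR_gt0.
have A1 : expR (2 * t) <= expR (2 * s1) by rewrite ler_expR ler_pM2l.
have B0 : expR (- 2 * t) <= expR (- 2 * s0) by rewrite ler_expR !mulNr lerN2 ler_pM2l.
have h3 : expR (2 * t) * x ^+ 2 <= expR (2 * s1) * M ^+ 2 by rewrite ler_pM// ?sqr_ge0// ltW.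
have h4 := ler_wpM2l c2 B0.
have h5 : 0 <= expR (2 * t) * x ^+ 2 by rewrite mulr_ge0 ?sqr_ge0 ?ltW.
have h6 : 0 <= c ^+ 2 * expR (- 2 * t) by rewrite mulr_ge0// ltW.
rewrite !normrM gtr0_norm ?expR_gt0// -[leRHS]mulr1.
apply: ler_pM; [by rewrite mulr_ge0 ?expR_ge0|by []| |exact: cos_max].
apply: ler_pM => //; first by rewrite ler_expR; lra.
by rewrite ler_norml; lra.
Qed.

(** Differentiation under the integral produces [gauss_flow_dt]; the fundamental theorem in every
    unit cell and telescoping over the cells leave only the two ends. *)
Lemma is_derive_gauss_flow_int c p N t :
  is_derive t (1 : R) (gauss_flow_int c p N)
    (gauss_flow_potential c p t (N%:Z + 1)%:~R - gauss_flow_potential c p t (- N%:Z)%:~R).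
Proof.
have cdt s (j : int) : continuous (fun u => gauss_flow_dt c p s (u + j%:~R)).
  by apply: continuous_shift; exact: continuous_gauss_flow_dt.
have ->: gauss_flow_potential c p t (N%:Z + 1)%:~R - gauss_flow_potential c p t (- N%:Z)%:~R =
    int01 (fun u => zsum (fun j => gauss_flow_dt c p t (u + j%:~R)) N).
  have dF (x : R) : is_derive x (1 : R) (fun u => zsum (fun j => gauss_flow_potential c p t (u + j%:~R)) N)
      (zsum (fun j => gauss_flow_dt c p t (x + j%:~R)) N).
    apply: is_derive_fun_sum => j.
    have H := is_derive_fun_affine x 1 j%:~R.
    have E : (fun y : R => 1 * y + j%:~R) = (fun y => y + j%:~R) by apply/funext => y; rewrite mul1r.
    rewrite E in H.
    apply: (is_derive_val (is_derive_fun_comp (g := fun y => y + j%:~R)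
      (is_derive_gauss_flow_potential c p t (x + j%:~R)) H)).
    by rewrite mulr1.
  rewrite (int01_FTC _ dF); last first.
    exact: (continuous_zsum (F := fun j u => gauss_flow_dt c p t (u + j%:~R))).
  rewrite -(zsum_telescope (fun j => gauss_flow_potential c p t j%:~R)); congr (_ - _).
    by apply: eq_bigr => j _; rewrite intrD addrC.
  by apply: eq_bigr => j _; rewrite add0r.
pose M : R := N%:R + 1.
pose K := expR (c ^+ 2 / 4 * expR (- 2 * (t - 1)) + (t + 1)) *
    (1 + c ^+ 2 / 2 * expR (- 2 * (t - 1)) + 2 * expR (2 * (t + 1)) * M ^+ 2).
apply: (@derive_int01 _ (fun s u => zsum (fun j => gauss_flow c p s (u + j%:~R)) N)
  (fun s u => zsum (fun j => gauss_flow_dt c p s (u + j%:~R)) N) t (t - 1) (t + 1) (zsum (fun=> K) N)).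
- by rewrite ltrDl ltr01 ltrBlDr ltrDl ltr01.
- move=> s _; apply: (continuous_zsum (F := fun j u => gauss_flow c p s (u + j%:~R))) => j.
  by apply: continuous_shift; exact: continuous_gauss_flow.
- move=> s y _; apply: is_derive_fun_sum => j; exact: is_derive_gauss_flow.
- move=> s y /andP[/ltW s1 /ltW s2] /andP[y0 y1].
  rewrite /zsum; apply: (le_trans (ler_norm_sum _ _ _)).
  rewrite big_seq [leRHS]big_seq; apply: ler_sum => j; rewrite mem_zrange => jN.
  apply: gauss_flow_dt_le; first by rewrite s1.
  apply: (le_trans (ler_normD _ _)); rewrite /M addrC lerD//.
    by rewrite -intr_norm -natr_absz ler_nat.
  by rewrite ger0_norm// ltW.
Qed.

Definition gauss_flow_lim k p t : R :=
  expR ((2 * pi * k%:~R) ^+ 2 / 4 * expR (- 2 * t) + t) * gauss_coef (expR (2 * t)) k p.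

Lemma gauss_flow_int_cvg k p t :
  gauss_flow_int (2 * pi * k%:~R) p N t @[N --> \oo] --> gauss_flow_lim k p t.
Proof.
rewrite /gauss_flow_int /gauss_flow_lim.
have -> : (fun N => int01 (fun u => zsum (fun j => gauss_flow (2 * pi * k%:~R) p t (u + j%:~R)) N)) =
    (fun N => expR ((2 * pi * k%:~R) ^+ 2 / 4 * expR (- 2 * t) + t) *
      int01 (fun u => zsum (fun j => expR (- (expR (2 * t) * (u + j%:~R) ^+ 2)) * cos (2 * pi * k%:~R * (u + j%:~R) + p)) N)).
  apply/funext => N; rewrite -int01Z.
    by apply: eq_int01 => u; rewrite -zsumZ; apply: eq_bigr => j _; rewrite /gauss_flow expRD mulrA.
  apply: (continuous_zsum (F := fun j u => expR (- (expR (2 * t) * (u + j%:~R) ^+ 2)) * cos (2 * pi * k%:~R * (u + j%:~R) + p))) => j.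
  apply: (@continuous_shift (fun x => expR (- (expR (2 * t) * x ^+ 2)) * cos (2 * pi * k%:~R * x + p))).
  rewrite (_ : (fun _ => _) = fun x => expR (- (expR (2 * t) * (x + 0%:~R) ^+ 2)) * cos (2 * pi * k%:~R * x + p)).
    exact: continuous_gauss_term.
  by apply/funext => x; rewrite addr0.
by apply: cvgM; [exact: cvg_cst|apply: gauss_coef_cvg; exact: expR_gt0].
Qed.

(** By the mean value theorem in t, the truncated integrals at s0 and s1 differ by end terms that
    vanish geometrically as N grows. *)
Lemma gauss_flow_lim_const k p s0 s1 : s0 <= s1 -> gauss_flow_lim k p s1 = gauss_flow_lim k p s0.
Proof.
move=> s01; apply/eqP; rewrite -subr_eq0 -normr_le0.
pose c : R := 2 * pi * k%:~R.
set q := expR (- (expR (2 * s0) / 2)).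
have q01 : 0 <= q < 1 by apply: gauss_ratio; exact: expR_gt0.
have q1 : `|q| < 1 by rewrite ger0_norm; case/andP: q01.
set K := expR (c ^+ 2 / 4 * expR (- 2 * s0) + s1) *
     (1 + `|c| / 2 * expR (- 2 * s0) + 2 / expR (2 * s0)).
have K0 : 0 <= K.
  by rewrite mulr_ge0 ?expR_ge0// !addr_ge0// ?mulr_ge0 ?divr_ge0 ?expR_ge0.
have H N : `|gauss_flow_int c p N s1 - gauss_flow_int c p N s0| <= 2 * K * (s1 - s0) * q ^+ N.
  have -> : 2 * K * (s1 - s0) * q ^+ N = (2 * K * q ^+ N) * `|s1 - s0|.
    by rewrite ger0_norm ?subr_ge0//; ring.
  apply: (MVT_norm_le (is_derive_gauss_flow_int c p N)) => t.
  rewrite (min_idPl s01) (max_idPr s01) => ts.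
  rewrite -mulrA mulr2n mulrDl mul1r; apply: (le_trans (ler_normB _ _)); apply: lerD.
    apply: gauss_flow_potential_le => //.
    by rewrite ger0_norm ?ler0z// intrD lerDl.
  apply: gauss_flow_potential_le => //.
  by rewrite mulrNz normrN ger0_norm.
have c1 : `|gauss_flow_int c p N s1 - gauss_flow_int c p N s0| @[N --> \oo] -->
    `|gauss_flow_lim k p s1 - gauss_flow_lim k p s0|.
  by apply: cvg_norm; apply: cvgB; exact: gauss_flow_int_cvg.
have c2 : 2 * K * (s1 - s0) * q ^+ N @[N --> \oo] --> 2 * K * (s1 - s0) * 0.
  by apply: cvgM; [exact: cvg_cst|exact: cvg_expr].
rewrite mulr0 in c2; rewrite -(cvg_lim _ c1)// -(cvg_lim _ c2)//.
apply: ler_lim; [by apply/cvg_ex; eexists; exact: c1|by apply/cvg_ex; eexists; exact: c2|].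
exact: nearW.
Qed.

End gauss_sum.

(** * The Fourier transform of the Gaussian and the summation formula *)

Section poisson.
Context {R : realType}.
Implicit Types (a u c p t s : R).

(** The Gaussian integral over the real line, left unevaluated until [kappaE]. *)
Let kappa : R := gauss_flow_lim 0 0 0.

Lemma continuous_funB (f g : R -> R) : continuous f -> continuous g ->
  continuous (fun x => f x - g x).
Proof. by move=> cf cg x; exact: cvgB (cf x) (cg x). Qed.

Lemma cvgn_norm (v : nat -> R) (l : R) : v n @[n --> \oo] --> l ->
  `|v n| @[n --> \oo] --> `|l|.
Proof. by move=> vl; apply: cvg_norm. Qed.

Lemma cvgn_le (v w : nat -> R) (l m : R) : v n @[n --> \oo] --> l ->
  w n @[n --> \oo] --> m -> (forall n, v n <= w n) -> l <= m.
Proof.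
move=> vl wm vw; rewrite -(cvg_lim _ vl)// -(cvg_lim _ wm)//.
by apply: ler_lim; [apply/cvg_ex; exists l|apply/cvg_ex; exists m|exact: nearW].
Qed.

Lemma gauss_flow_lim0 t : gauss_flow_lim 0 0 t = expR t * gauss_coef (expR (2 * t)) 0 0 :> R.
Proof. by rewrite /gauss_flow_lim mulr0 expr0n /= !mul0r add0r. Qed.

Lemma gauss_flow_lim_eq k p s t : gauss_flow_lim k p s = gauss_flow_lim k p t :> R.
Proof.
by have [st|/ltW ts] := leP s t; [rewrite (gauss_flow_lim_const k p st)|rewrite (gauss_flow_lim_const k p ts)].
Qed.

(** The Lipschitz bound costs |c| |y|, that is |c| exp (- t) w in the natural scale w = exp t |y| of
    the Gaussian; the remaining w is at most exp (w^2 / 2), paid by half of the exponent. *)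
Lemma gauss_cos_term_diff c p t y :
  `|expR (- (expR (2 * t) * y ^+ 2)) * (cos (c * y + p) - cos p)| <=
  `|c| * expR (- t) * expR (- (expR (2 * t) / 2 * y ^+ 2)).
Proof.
rewrite normrM gtr0_norm ?expR_gt0//.
pose w := expR t * `|y|.
have w2 : expR (2 * t) * y ^+ 2 = w ^+ 2.
  by rewrite /w exprMn real_normK ?num_real// -expRM_natl.
have h1 : `|cos (c * y + p) - cos p| <= `|c| * expR (- t) * w.
  apply: (le_trans (cos_lipschitz _ _)); rewrite addrK normrM /w.
  by rewrite mulrA -(mulrA `|c|) -expRD addNr expR0 mulr1.
have h2 : w <= expR (w ^+ 2 / 2).
  by apply: le_trans (expR_ge1Dx _); have := sqr_ge0 (w - 1); rewrite sqrrB; lra.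
apply: (@le_trans _ _ (expR (- w ^+ 2) * (`|c| * expR (- t) * expR (w ^+ 2 / 2)))).
  rewrite w2 ler_wpM2l ?expR_ge0//; apply: (le_trans h1).
  by rewrite ler_wpM2l// mulr_ge0 ?expR_ge0.
have -> : expR (2 * t) / 2 * y ^+ 2 = w ^+ 2 / 2 by rewrite -w2; ring.
rewrite mulrCA ler_wpM2l ?mulr_ge0 ?expR_ge0// -expRD ler_expR.
by lra.
Qed.

Lemma gauss_coef_diff k p t :
  `|gauss_coef (expR (2 * t)) k p - cos p * gauss_coef (expR (2 * t)) 0 0| <=
  `|2 * pi * k%:~R| * expR (- t) * gauss_coef (expR (2 * t) / 2) 0 0.
Proof.
set a := expR (2 * t); set c := 2 * pi * k%:~R.
have a0 : 0 < a by exact: expR_gt0.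
have a20 : 0 < a / 2 by rewrite divr_gt0.
have cz b (u : R) : b * cos (2 * pi * 0%:~R * u + 0) = b by rewrite mulr0 mul0r addr0 cos0 mulr1.
have cg b : 0 < b -> continuous (fun u => gauss_sum b u * cos (2 * pi * 0%:~R * u + 0)).
  exact: continuous_gauss_cos.
have ck : continuous (fun u => gauss_sum a u * cos (c * u + p)) by exact: continuous_gauss_cos.
have E (u : R) (j : int) : cos (c * (u + j%:~R) + p) = cos (c * u + p).
  rewrite -[RHS](cosD2piz _ (k * j)); congr cos; rewrite intrM /c; ring.
rewrite /gauss_coef -!int01Z; [|exact: cg|exact: cg].
rewrite -int01B//; last by apply: continuous_funM; [exact: continuous_fun_cst|exact: cg].
have pw u : `|gauss_sum a u * cos (c * u + p) - cos p * (gauss_sum a u * cos (2 * pi * 0%:~R * u + 0))| <=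
    `|c| * expR (- t) * (gauss_sum (a / 2) u * cos (2 * pi * 0%:~R * u + 0)).
  rewrite !cz.
  have c1 : zsum (fun j => expR (- (a * (u + j%:~R) ^+ 2)) * (cos (c * (u + j%:~R) + p) - cos p)) N @[N --> \oo] -->
      gauss_sum a u * cos (c * u + p) - cos p * gauss_sum a u.
    have -> : (fun N => zsum (fun j => expR (- (a * (u + j%:~R) ^+ 2)) * (cos (c * (u + j%:~R) + p) - cos p)) N) =
       (fun N => zsum (fun j => expR (- (a * (u + j%:~R) ^+ 2))) N * (cos (c * u + p) - cos p)).
      by apply/funext => N; rewrite /zsum mulr_suml; apply: eq_bigr => j _; rewrite E.
    have -> : gauss_sum a u * cos (c * u + p) - cos p * gauss_sum a u = gauss_sum a u * (cos (c * u + p) - cos p) by ring.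
    by apply: cvgM; [exact: gauss_sum_cvg|exact: cvg_cst].
  have c2 : zsum (fun j => `|c| * expR (- t) * expR (- (a / 2 * (u + j%:~R) ^+ 2))) N @[N --> \oo] -->
      `|c| * expR (- t) * gauss_sum (a / 2) u.
    under eq_fun do rewrite zsumZ.
    by apply: cvgM; [exact: cvg_cst|exact: gauss_sum_cvg].
  apply: (cvgn_le (cvgn_norm c1) c2) => N; apply: zsum_norm_le => j; exact: gauss_cos_term_diff.
have cl : continuous (fun u => gauss_sum a u * cos (c * u + p) - cos p * (gauss_sum a u * cos (2 * pi * 0%:~R * u + 0))).
  apply: continuous_funB; first exact: ck.
  by apply: continuous_funM; [exact: continuous_fun_cst|exact: cg].
have cr : continuous (fun u => `|c| * expR (- t) * (gauss_sum (a / 2) u * cos (2 * pi * 0%:~R * u + 0))).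
  by apply: continuous_funM; [exact: continuous_fun_cst|exact: cg].
rewrite ler_norml -mulN1r -int01Z//; apply/andP; split; apply: int01_le => //.
- by apply: continuous_funM => //; exact: continuous_fun_cst.
- by move=> u _; have := pw u; rewrite ler_norml mulN1r => /andP[].
- by move=> u _; have := pw u; rewrite ler_norml => /andP[].
Qed.

Lemma flow_remove_factor (J z c e t : R) : 0 <= t ->
  `|J * expR (- (c ^+ 2 / 4 * expR (- 2 * t))) - z| <= e * expR (- t) ->
  `|J - z| <= (e + `|J| * (c ^+ 2 / 4)) * expR (- t).
Proof.
move=> t0; set y := c ^+ 2 / 4 * expR (- 2 * t) => h1.
have c40 : 0 <= c ^+ 2 / 4 by apply: divr_ge0; [exact: sqr_ge0|exact: ler0n].
have y0 : 0 <= y by apply: mulr_ge0; [exact: c40|exact: expR_ge0].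
have yt : y <= c ^+ 2 / 4 * expR (- t) by apply: ler_wpM2l; [exact: c40|rewrite ler_expR; lra].
have h2 : `|J - J * expR (- y)| <= `|J| * y.
  have h : `|1 - expR (- y)| <= y.
    rewrite ger0_norm; first by have := expR_ge1Dx (- y); lra.
    by rewrite subr_ge0 expR_le1 oppr_le0.
  have -> : J - J * expR (- y) = J * (1 - expR (- y)) by rewrite mulrBr mulr1.
  by rewrite normrM; apply: ler_wpM2l; [exact: normr_ge0|exact: h].
have -> : J - z = (J - J * expR (- y)) + (J * expR (- y) - z) by ring.
apply: (le_trans (ler_normD _ _)).
have := ler_wpM2l (normr_ge0 J) yt.
by lra.
Qed.

(** The value does not depend on t, and for large t the Gaussian concentrates at the origin, where
    the cosine is cos p. The error is [K * expR (- t)] for every t >= 0, hence zero. *)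
Lemma gauss_flow_limE k p : gauss_flow_lim k p 0 = kappa * cos p.
Proof.
set J := gauss_flow_lim k p 0; pose c : R := 2 * pi * k%:~R.
pose K := `|c| * `|kappa| * expR (ln 2 / 2) + `|J| * (c ^+ 2 / 4).
have K0 : 0 <= K.
  apply: addr_ge0; first by apply: mulr_ge0; [exact: mulr_ge0|exact: expR_ge0].
  by apply: mulr_ge0 => //; rewrite divr_ge0 ?sqr_ge0.
suff H t : 0 <= t -> `|J - kappa * cos p| <= K * expR (- t).
  apply/eqP; rewrite -subr_eq0 -normr_le0 leNgt; apply/negP => D0.
  set D := `|J - kappa * cos p| in D0 H.
  (* At this time exp t >= 1 + K / D, which contradicts D <= K exp (- t). *)
  have /H : 0 <= K / D by rewrite divr_ge0// ltW.
  rewrite expRN ler_pdivlMr ?expR_gt0// leNgt => /negP; apply.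
  apply: (@lt_le_trans _ _ (D * (1 + K / D))).
    by rewrite mulrDr mulr1 mulrCA mulfV ?gt_eqF// mulr1 ltrDr.
  by rewrite ler_pM2l// expR_ge1Dx.
move=> t0.
have Jt : expR t * gauss_coef (expR (2 * t)) k p = J * expR (- (c ^+ 2 / 4 * expR (- 2 * t))).
  rewrite /J (gauss_flow_lim_eq k p 0 t) /gauss_flow_lim -/c expRD expRN.
  by field; rewrite gt_eqF// expR_gt0.
have K1 : expR t * gauss_coef (expR (2 * t)) 0 0 = kappa.
  by rewrite -gauss_flow_lim0; exact: gauss_flow_lim_eq.
(* Halving the Gaussian parameter is the time shift by - ln 2 / 2, so the same constant [kappa]
   evaluates the wider Gaussian. *)
have K2 : gauss_coef (expR (2 * t) / 2) 0 0 = kappa * expR (ln 2 / 2) * expR (- t).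
  have -> : expR (2 * t) / 2 = expR (2 * (t - ln 2 / 2)).
    have -> : 2 * (t - ln 2 / 2) = 2 * t - ln 2 by field.
    by rewrite expRB lnK ?posrE.
  have := gauss_flow_lim0 (t - ln 2 / 2); rewrite (gauss_flow_lim_eq 0 0 _ 0) -/kappa => ->.
  move: (gauss_coef _ _ _) => g.
  have : expR (t - ln 2 / 2) * expR (ln 2 / 2) * expR (- t) = 1.
    by rewrite -!expRD subrK subrr expR0.
  move: (expR (t - _)) (expR (_ / 2)) (expR (- t)) => e1 e2 e3 E.
  by rewrite -[LHS]mulr1 -E; ring.
have h1 : `|J * expR (- (c ^+ 2 / 4 * expR (- 2 * t))) - kappa * cos p| <= `|c| * `|kappa| * expR (ln 2 / 2) * expR (- t).
  have := gauss_coef_diff k p t; rewrite K2 -/c; move: Jt K1.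
  have : expR t * expR (- t) = 1 by rewrite -expRD subrr expR0.
  have e1p : 0 < expR t by exact: expR_gt0.
  have e3p : 0 < expR (- t) by exact: expR_gt0.
  have e2p : 0 < expR (ln 2 / 2) :> R by exact: expR_gt0.
  move: e1p e3p e2p (normr_ge0 c).
  move: (gauss_coef (expR (2 * t)) k p) (gauss_coef (expR (2 * t)) 0 0) (J * expR _) kappa.
  move: (expR t) (expR (- t)) (expR (ln 2 / 2)) `|c| (cos p) => e1 e3 e2 c' C x1 y1 j1 k1.
  move=> e10 e30 e20 c0 e13 <- <- B.
  have -> : e1 * x1 - e1 * y1 * C = e1 * (x1 - C * y1) by ring.
  rewrite normrM (gtr0_norm e10); apply: (le_trans (ler_wpM2l (ltW e10) B)).
  have -> : e1 * (c' * e3 * (e1 * y1 * e2 * e3)) = (e1 * e3) * (c' * (e1 * y1) * e2 * e3) by ring.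
  by rewrite e13 mul1r ler_wpM2r ?(ltW e30)// ler_wpM2r ?(ltW e20)// ler_wpM2l// ler_norm.
exact: (flow_remove_factor t0 h1).
Qed.

Lemma gauss_coefE a k p : 0 < a ->
  gauss_coef a k p = kappa / Num.sqrt a * (theta_weight (4 * a)^-1 k * cos p).
Proof.
move=> a0; pose t := ln a / 2.
have at2 : expR (2 * t) = a by rewrite /t mulrCA mulfV// mulr1 lnK.
have sqa : Num.sqrt a = expR t.
  by rewrite -at2 -[2]/(2%:R) expRM_natl sqrtr_sqr ger0_norm// expR_ge0.
have at2' : expR (- 2 * t) = a^-1 by rewrite mulNr expRN at2.
have := gauss_flow_limE k p; rewrite (gauss_flow_lim_eq k p 0 t) /gauss_flow_lim at2 at2'.
rewrite /theta_weight => H; rewrite mulrAC mulrCA -H sqa expRD.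
have -> : (2 * pi * k%:~R) ^+ 2 / 4 / a = 4 * pi ^+ 2 * k%:~R ^+ 2 / (4 * a) by field; rewrite gt_eqF.
rewrite expRN; field.
by rewrite !gt_eqF ?expR_gt0.
Qed.

Lemma continuous_theta_cos s c p : 0 < s -> continuous (fun u => theta s u * cos (c * u + p)).
Proof.
move=> s0; apply: continuous_funM; last first.
  move=> u; apply: (@continuous_comp _ _ _ (fun u : R => c * u + p) cos); last exact: continuous_cos.
  by apply: cvgD; [apply: cvgM; [exact: cvg_cst|exact: cvg_id]|exact: cvg_cst].
apply: (continuous_zsum_lim (F := fun j u => theta_weight s j * cos (2 * pi * (j%:~R * u)))).
  move=> j; apply: continuous_funM; first exact: continuous_fun_cst.
  move=> u; apply: (@continuous_comp _ _ _ (fun u : R => 2 * pi * (j%:~R * u)) cos); last exact: continuous_cos.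
  by apply: cvgM; [exact: cvg_cst|apply: cvgM; [exact: cvg_cst|exact: cvg_id]].
move=> M; exists 1, (expR (- (4 * pi ^+ 2 * s))); split; first exact: theta_ratio.
by move=> j u _; exact: theta_term_le.
Qed.

Lemma int01_cosM (j k : int) p :
  int01 (fun u => cos (2 * pi * (j%:~R * u)) * cos (2 * pi * k%:~R * u + p)) =
  2^-1 * cos p * (j == - k)%:R + 2^-1 * cos p * (j == k)%:R.
Proof.
have := box_avg_waveM (const_mx j : 'rV_1) (const_mx k : 'rV_1) 0 p.
rewrite /= /slice.
rewrite (eq_int01 (g := fun u => cos (2 * pi * (j%:~R * u)) * cos (2 * pi * k%:~R * u + p))); last first.
  move=> u; rewrite /wave !big_ord1 !mxE; case: splitP => // i _; rewrite !mxE addr0.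
  by congr (_ * cos (_ + _)); rewrite mulrA.
move=> ->; rewrite add0r sub0r cosN; congr (_ * _%:R + _ * _%:R).
  case: eqP => [/matrixP /(_ 0 0)|ne]; first by rewrite !mxE => ->; rewrite eqxx.
  by case: eqP => // E; case: ne; apply/matrixP => i i'; rewrite !mxE.
case: eqP => [/matrixP /(_ 0 0)|ne]; first by rewrite !mxE => ->; rewrite eqxx.
by case: eqP => // E; case: ne; apply/matrixP => i i'; rewrite !mxE.
Qed.

Lemma theta_coef s (k : int) p : 0 < s ->
  int01 (fun u => theta s u * cos (2 * pi * k%:~R * u + p)) = theta_weight s k * cos p.
Proof.
move=> s0.
pose F (j : int) (u : R) := theta_weight s j * cos (2 * pi * (j%:~R * u)) * cos (2 * pi * k%:~R * u + p).
have cc (j : int) : continuous (fun u => cos (2 * pi * (j%:~R * u)) * cos (2 * pi * k%:~R * u + p)).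
  apply: continuous_funM => u.
    apply: (@continuous_comp _ _ _ (fun u : R => 2 * pi * (j%:~R * u)) cos); last exact: continuous_cos.
    by apply: cvgM; [exact: cvg_cst|apply: cvgM; [exact: cvg_cst|exact: cvg_id]].
  apply: (@continuous_comp _ _ _ (fun u : R => 2 * pi * k%:~R * u + p) cos); last exact: continuous_cos.
  by apply: cvgD; [apply: cvgM; [exact: cvg_cst|exact: cvg_id]|exact: cvg_cst].
have FE j : F j = fun u => theta_weight s j * (cos (2 * pi * (j%:~R * u)) * cos (2 * pi * k%:~R * u + p)).
  by apply/funext => u; rewrite /F mulrA.
have cF j : continuous (F j).
  by rewrite FE; apply: continuous_funM => //; exact: continuous_fun_cst.
have lE u : limn (zsum (F ^~ u)) = theta s u * cos (2 * pi * k%:~R * u + p).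
  apply/cvg_lim => //.
  have -> : zsum (F ^~ u) = fun N => zsum (fun j => theta_weight s j * cos (2 * pi * (j%:~R * u))) N * cos (2 * pi * k%:~R * u + p).
    by apply/funext => N; rewrite /zsum mulr_suml.
  by apply: cvgM; [exact: theta_cvg|exact: cvg_cst].
have cl : continuous (fun u => limn (zsum (F ^~ u))).
  rewrite (_ : (fun _ => _) = fun u => theta s u * cos (2 * pi * k%:~R * u + p)); first exact: continuous_theta_cos.
  by apply/funext => u; rewrite lE.
have Fb j u : 0 <= u < 1 -> `|F j u| <= 1 * expR (- (4 * pi ^+ 2 * s)) ^+ `|j|%N.
  move=> _; rewrite /F normrM; apply: le_trans (theta_term_le u j s0).
  by rewrite ler_piMr// cos_max.
have := int01_zsum_lim cF cl (theta_ratio s0) Fb.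
rewrite (eq_int01 (g := fun u => theta s u * cos (2 * pi * k%:~R * u + p))); last by move=> u; rewrite lE.
move=> H; rewrite -(cvg_lim _ H)//; apply/cvg_lim => //.
apply: cvg_near_cst; exists `|k|%N => // N /= kN.
rewrite /zsum (eq_bigr (fun j => (theta_weight s j * (2^-1 * cos p)) * (j == - k)%:R + (theta_weight s j * (2^-1 * cos p)) * (j == k)%:R)); last first.
  by move=> j _; rewrite FE int01Z// int01_cosM; ring.
rewrite big_split/= !sum_delta ?uniq_zrange// !mem_zrange abszN kN /= theta_weightN.
by field.
Qed.

Lemma gauss_sum_periodic a u : 0 < a -> gauss_sum a (u + 1) = gauss_sum a u.
Proof.
move=> a0; apply/eqP; rewrite -subr_eq0 -normr_le0.
pose f (j : int) := expR (- (a * (u + j%:~R) ^+ 2)).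
have c1 : zsum (fun j => f (j + 1)) N @[N --> \oo] --> gauss_sum a (u + 1).
  have := @gauss_sum_cvg R a (u + 1) a0.
  rewrite (_ : (fun N => zsum (fun j => f (j + 1)) N) = zsum (fun j => expR (- (a * (u + 1 + j%:~R) ^+ 2))))//.
  by apply/funext => N; apply: eq_bigr => j _; rewrite /f intrD (addrC j%:~R) addrA.
have c2 : zsum f N @[N --> \oo] --> gauss_sum a u := @gauss_sum_cvg R a u a0.
have c3 : `|zsum (fun j => f (j + 1)) N - zsum f N| @[N --> \oo] --> `|gauss_sum a (u + 1) - gauss_sum a u|.
  by apply: cvgn_norm; exact: cvgB.
set q := expR (- (a / 2)); have q01 := gauss_ratio a0; rewrite -/q in q01.
have q1 : `|q| < 1 by rewrite ger0_norm; case/andP: q01.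
have c4 : 2 * expR (a * u ^+ 2) * q ^+ N @[N --> \oo] --> 2 * expR (a * u ^+ 2) * 0.
  by apply: cvgM; [exact: cvg_cst|exact: cvg_expr].
rewrite mulr0 in c4; apply: (cvgn_le c3 c4) => N /=; rewrite zsum_telescope.
apply: (le_trans (ler_normB _ _)).
have h1 := gauss_term_le u (N%:Z + 1) (ltW a0); have h2 := gauss_term_le u (- N%:Z) (ltW a0).
rewrite abszN /= -/q in h1 h2.
have h3 : q ^+ (N + 1)%N <= q ^+ N.
  by case/andP: q01 => q0 q1'; rewrite addn1 exprS ler_piMl ?exprn_ge0// ltW.
have := ler_wpM2l (expR_ge0 (a * u ^+ 2)) h3.
by rewrite /f; lra.
Qed.

Lemma theta_periodic s u : theta s (u + 1) = theta s u.
Proof.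
rewrite /theta; congr (limn _); apply/funext => N; apply: eq_bigr => j _.
have -> : 2 * pi * (j%:~R * (u + 1)) = 2 * pi * (j%:~R * u) + 2 * pi * j%:~R by ring.
by rewrite cosD2piz.
Qed.

(** Both sides are continuous and 1-periodic with the same Fourier coefficients; completeness of the
    waves in dimension one does the rest. *)
Lemma gauss_sum_theta a u : 0 < a -> gauss_sum a u = kappa / Num.sqrt a * theta (4 * a)^-1 u.
Proof.
move=> a0; set C := kappa / Num.sqrt a; set s := (4 * a)^-1.
have s0 : 0 < s by rewrite invr_gt0 mulr_gt0.
pose G u := C * theta s u - gauss_sum a u.
have cG : continuous G.
  have c1 := @continuous_theta_cos s 0 0 s0; have c2 := @continuous_gauss_cos R a 0 0 a0.
  rewrite (_ : G = fun u => C * (theta s u * cos (0 * u + 0)) - gauss_sum a u * cos (0 * u + 0)).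
    apply: continuous_funB; last exact: c2.
    by apply: continuous_funM; [exact: continuous_fun_cst|exact: c1].
  by apply/funext => x; rewrite mul0r addr0 cos0 !mulr1.
pose f (x : 'rV[R]_1) := G (x 0 0).
have cf : continuous f.
  move=> x; apply: (@continuous_comp _ _ _ (fun x : 'rV[R]_1 => x 0 0) G); last exact: cG.
  exact: coord_continuous.
have pf : Defs.periodic f.
  move=> x i; rewrite /f !mxE (ord1 i) eqxx /G theta_periodic.
  by rewrite gauss_sum_periodic.
suff : f (const_mx u) = 0.
  by rewrite /f mxE /G => /eqP; rewrite subr_eq0 => /eqP.
apply: (wave_orth_eq0 (continuous_periodic_unif_cont cf pf) pf (continuous_periodic_bounded cf pf)).
move=> m p /=; rewrite /slice.
rewrite (eq_int01 (g := fun u => C * (theta s u * cos (2 * pi * (m 0 0)%:~R * u + p)) - gauss_sum a u * cos (2 * pi * (m 0 0)%:~R * u + p))); last first.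
  move=> v; rewrite /f /wave big_ord1 !mxE; case: splitP => // i _; rewrite !mxE.
  by rewrite mulrBl mulrA mulrA.
rewrite int01B; [|by apply: continuous_funM; [exact: continuous_fun_cst|exact: continuous_theta_cos]|exact: continuous_gauss_cos].
rewrite int01Z ?theta_coef//; last exact: continuous_theta_cos.
by rewrite -/(gauss_coef a (m 0 0) p) gauss_coefE// subrr.
Qed.

Lemma theta0_ge1 s : 0 < s -> 1 <= theta s 0.
Proof.
move=> s0; have c1 : (fun _ : nat => 1 : R) n @[n --> \oo] --> (1 : R) by exact: cvg_cst.
apply: (cvgn_le c1 (@theta_cvg R s 0 s0)).
elim => [|N IH].
  by rewrite zsum0 /theta_weight expr0n /= mulr0 mul0r oppr0 expR0 mul0r mulr0 cos0 mulr1.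
rewrite zsumS; apply: (le_trans IH); rewrite lerDr.
by rewrite !mulr0 cos0 !mulr1 addr_ge0// ltW// theta_weight_gt0.
Qed.

(** At a = pi the Gaussian sum and the theta series agree term by term, so the factor between them
    is 1. This evaluates the Gaussian integral from self-duality. *)
Lemma kappaE : kappa = Num.sqrt pi.
Proof.
have pi0 := pi_gt0 R.
have := gauss_sum_theta 0 pi0.
have -> : gauss_sum pi 0 = theta (4 * pi)^-1 0 :> R.
  rewrite /gauss_sum /theta; congr (limn _); apply/funext => N; apply: eq_bigr => j _.
  rewrite !mulr0 cos0 mulr1 add0r /theta_weight; congr expR; congr (- _).
  have p4 : 4 * pi != 0 :> R by rewrite mulf_neq0// gt_eqF.
  by rewrite -[LHS](mulfK p4); congr (_ / _); ring.
have s0 : 0 < (4 * pi)^-1 :> R by rewrite invr_gt0 mulr_gt0.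
have T0 : 0 < theta (4 * pi)^-1 0 :> R by apply: lt_le_trans (theta0_ge1 s0).
have S0 : 0 < Num.sqrt pi :> R by rewrite sqrtr_gt0.
move=> H; have : (kappa / Num.sqrt pi - 1) * theta (4 * pi)^-1 0 = 0.
  by rewrite mulrBl -H mul1r subrr.
move/eqP; rewrite mulf_eq0 (gt_eqF T0) orbF subr_eq0 => /eqP h.
by rewrite -[RHS]mul1r -h divfK// gt_eqF.
Qed.

Theorem poisson_summation s u : 0 < s ->
  theta s u = (Num.sqrt (4 * pi * s))^-1 * gauss_sum (4 * s)^-1 u.
Proof.
move=> s0; have pi0 := pi_gt0 R.
have a0 : 0 < (4 * s)^-1 by rewrite invr_gt0 mulr_gt0.
rewrite (gauss_sum_theta u a0) kappaE.
have -> : (4 * (4 * s)^-1)^-1 = s by field; rewrite gt_eqF.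
have -> : 4 * pi * s = pi / (4 * s)^-1 by rewrite invrK; ring.
rewrite sqrtrM ?ltW// sqrtrV ?ltW//.
have h1 : Num.sqrt pi != 0 :> R by rewrite gt_eqF// sqrtr_gt0.
have h2 : Num.sqrt (4 * s)^-1 != 0 :> R by rewrite gt_eqF// sqrtr_gt0.
by field; rewrite h1 h2.
Qed.

End poisson.

(** * Bounds on theta functions *)

Section theta_bounds.
Context {R : realType}.
Implicit Types (s u x eta : R).

(** The heat kernel of the real line on the diagonal, that is, the term j = 0 of the dual series at
    u = 0. *)
Definition gauss_peak s : R := (Num.sqrt (4 * pi * s))^-1.

Lemma theta_norm_le s u : 0 < s -> `|theta s u| <= theta s 0.
Proof.
move=> s0; apply: cvgn_le (cvgn_norm (@theta_cvg R s u s0)) (@theta_cvg R s 0 s0) _ => N.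
apply: zsum_norm_le => j; rewrite !mulr0 cos0 mulr1 normrM gtr0_norm ?theta_weight_gt0//.
by rewrite ler_piMr ?cos_max// ltW// theta_weight_gt0.
Qed.

Lemma zsum_ge0_term0 (F : int -> R) N : (forall j, 0 <= F j) -> F 0 <= zsum F N.
Proof.
move=> F0; elim: N => [|N IH]; first by rewrite zsum0.
by rewrite zsumS; have := F0 N.+1%:Z; have := F0 (- N.+1%:Z); lra.
Qed.

(** Adding theta s 0 turns every term into a weight times 1 + cos, which is nonnegative, and the
    term j = 0 is 2. *)
Lemma theta_ge s u : 0 < s -> 2 - theta s 0 <= theta s u.
Proof.
move=> s0; rewrite lerBlDr.
have c := cvgD (@theta_cvg R s u s0) (@theta_cvg R s 0 s0).
have c2 : (fun _ : nat => 2 : R) n @[n --> \oo] --> (2 : R) by exact: cvg_cst.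
apply: cvgn_le c2 (c _) _ => N; rewrite -[leRHS]zsumD.
set F := (fun _ => _).
have -> : 2 = F 0.
  by rewrite /F /theta_weight expr0n /= mulr0 mul0r oppr0 expR0 mul0r !mulr0 cos0; ring.
apply: zsum_ge0_term0 => j; rewrite /F !mulr0 cos0 -mulrDr mulr_ge0 ?expR_ge0// -lerBlDr sub0r cos_geN1.
Qed.

Lemma pi_sqr_ge4 : 4 <= pi ^+ 2 :> R.
Proof. by have h := @pi_ge2 R; rewrite expr2; nra. Qed.

Lemma theta0_le_ratio s : 0 < s ->
  theta s 0 - 1 <= 4 * expR (- (4 * pi ^+ 2 * s)) / (1 - expR (- (4 * pi ^+ 2 * s))).
Proof.
move=> s0; set q := expR _.
have q01 : 0 <= q < 1 by exact: theta_ratio.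
have := zsum_lim_tail 1 q01 (fun j => theta_term_le 0 j s0).
rewrite -/(theta s 0) zsumS zsum0 !mulr0 cos0 !mulr1 theta_weightN.
have -> : theta_weight s 0 = 1 by rewrite /theta_weight expr0n /= mulr0 mul0r oppr0 expR0.
have -> : theta_weight s 1 = q by rewrite /theta_weight expr1n mulr1.
move=> /ler_normlP[_ h].
have qq : q <= q / (1 - q).
  by case/andP: q01 => q0 q1; rewrite ler_peMr// invf_ge1 ?subr_gt0//; lra.
rewrite expr1 in h; rewrite (_ : 4 * q / (1 - q) = 4 * (q / (1 - q))); last by rewrite mulrA.
by move: h; rewrite (_ : 2 / (1 - q) * q = 2 * (q / (1 - q))); [lra|rewrite mulrAC -mulrA].
Qed.

(** The geometric bound equals 4 / (exp a - 1) <= 4 / a with a = 4 pi^2 s >= 16 s. For small s it is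
    far from sharp, but it is used there only against exponentially small factors. *)
Lemma theta0_le s : 0 < s -> theta s 0 <= 1 + (4 * s)^-1.
Proof.
move=> s0; have := theta0_le_ratio s0; set a := 4 * pi ^+ 2 * s => h.
have a0 : 0 < a by rewrite !mulr_gt0 ?exprn_gt0 ?pi_gt0.
have -> : theta s 0 = 1 + (theta s 0 - 1) by ring.
rewrite lerD2l; apply: le_trans h _.
have e1 : 1 < expR a by rewrite expR_gt1.
have ea := expR_ge1Dx a.
have -> : 4 * expR (- a) / (1 - expR (- a)) = 4 / (expR a - 1).
  by rewrite expRN; field; rewrite subr_eq0 !gt_eqF//= expR_gt0.
have s4 : 0 < 4 * s by lra.
rewrite -ler_pdivlMl// -invfM lef_pV2 ?posrE; [|by lra|by lra].
apply: (@le_trans _ _ a); last by lra.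
have : 4 * s * 4 <= 4 * s * pi ^+ 2 by rewrite ler_pM2l// pi_sqr_ge4.
by rewrite /a; lra.
Qed.

Lemma theta0_exp s : 1 <= s -> theta s 0 - 1 <= 8 * expR (- s).
Proof.
move=> s1; have s0 : 0 < s by lra.
apply: le_trans (theta0_le_ratio s0) _.
set q := expR _.
have sa : s <= 4 * pi ^+ 2 * s by have := pi_sqr_ge4; nra.
have qs : q <= expR (- s) by rewrite ler_expR lerN2.
have q2 : q <= 2^-1.
  apply: (le_trans qs); rewrite expRN lef_pV2 ?posrE ?expR_gt0//.
  by have := expR_ge1Dx s; lra.
rewrite ler_pdivrMr; last by lra.
have := expR_gt0 (- s); nra.
Qed.

Lemma theta_ge_half s u : 1 <= s -> 2^-1 <= theta s u.
Proof.
move=> s1; have s0 : 0 < s by lra.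
have := theta_ge u s0; have := theta0_le s0.
have : (4 * s)^-1 <= 4^-1 by rewrite lef_pV2 ?posrE; lra.
by lra.
Qed.

Lemma gauss_sum_ge0 a u : 0 < a -> 0 <= gauss_sum a u.
Proof.
move=> a0; have c2 : (fun _ : nat => 0 : R) n @[n --> \oo] --> (0 : R) by exact: cvg_cst.
apply: cvgn_le c2 (@gauss_sum_cvg R _ u a0) _ => N.
by apply: sumr_ge0 => j _; exact: expR_ge0.
Qed.

Lemma gauss_peak_gt0 s : 0 < s -> 0 < gauss_peak s.
Proof. by move=> s0; rewrite invr_gt0 sqrtr_gt0 !mulr_gt0 ?pi_gt0. Qed.

Lemma theta_ge0 s u : 0 < s -> 0 <= theta s u.
Proof.
move=> s0; rewrite poisson_summation// mulr_ge0 ?invr_ge0 ?sqrtr_ge0//.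
by apply: gauss_sum_ge0; rewrite invr_gt0; lra.
Qed.

Lemma gauss_peak2 s : 0 < s -> gauss_peak s = Num.sqrt 2 * gauss_peak (2 * s).
Proof.
move=> s0; rewrite /gauss_peak (_ : 4 * pi * (2 * s) = 2 * (4 * pi * s)); last by ring.
rewrite [Num.sqrt (2 * (4 * pi * s))]sqrtrM// invfM mulrA divff ?mul1r//.
Qed.

Lemma inv8 s : 0 < s -> (4 * (2 * s))^-1 = (4 * s)^-1 / 2.
Proof. by move=> s0; field; lra. Qed.

(** After Poisson summation each Gaussian exponent is split in two: one half yields the factor in
    eta, the other is the dual series of theta at time 2 s, and sqrt 2 is the ratio of the
    prefactors. *)
Lemma theta_far s u eta : 0 < s -> 0 <= eta -> (forall k : int, eta <= `|u + k%:~R|) ->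
  theta s u <= Num.sqrt 2 * expR (- (eta ^+ 2 / (8 * s))) * theta (2 * s) 0.
Proof.
move=> s0 eta0 far; set a := (4 * s)^-1.
have a0 : 0 < a by rewrite invr_gt0; lra.
have a20 : 0 < a / 2 by lra.
have -> : eta ^+ 2 / (8 * s) = a / 2 * eta ^+ 2 by rewrite /a; field; lra.
apply: (@le_trans _ _ (Num.sqrt 2 * expR (- (a / 2 * eta ^+ 2)) * theta (2 * s) u)); last first.
  rewrite ler_wpM2l ?mulr_ge0 ?sqrtr_ge0 ?expR_ge0//.
  by apply: le_trans (ler_norm _) _; apply: theta_norm_le; lra.
rewrite !poisson_summation//; last by lra.
rewrite -!/(gauss_peak _) (gauss_peak2 s0) inv8// -/a.
rewrite (_ : _ * _ * (_ * _) = Num.sqrt 2 * gauss_peak (2 * s) *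
  (expR (- (a / 2 * eta ^+ 2)) * gauss_sum (a / 2) u)); last by ring.
rewrite ler_wpM2l ?mulr_ge0 ?sqrtr_ge0 ?(ltW (gauss_peak_gt0 _))//; first by lra.
have c : expR (- (a / 2 * eta ^+ 2)) * zsum (fun j : int => expR (- (a / 2 * (u + j%:~R) ^+ 2))) N
    @[N --> \oo] --> expR (- (a / 2 * eta ^+ 2)) * gauss_sum (a / 2) u.
  by apply: cvgM; [exact: cvg_cst|exact: gauss_sum_cvg].
apply: cvgn_le (@gauss_sum_cvg R _ u a0) c _ => N.
rewrite -zsumZ; apply: ler_zsum => j; rewrite -expRD ler_expR.
have : eta ^+ 2 <= (u + j%:~R) ^+ 2.
  by rewrite -(real_normK (num_real (u + _))) ler_sqr ?nnegrE.
by move=> /(ler_wpM2l (ltW a20)); lra.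
Qed.

Lemma zsum_at0 N : zsum (fun j : int => (j == 0)%:R) N = 1 :> R.
Proof.
elim: N => [|N IH]; first by rewrite zsum0.
rewrite zsumS IH; have -> : (N.+1%:Z == 0) = false by lia.
by rewrite oppr_eq0 /= !add0r.
Qed.

(** The splitting of [theta_far] for the terms with j nonzero, which lie at distance at least 1 from
    the origin. *)
Lemma theta0_peak s : 0 < s -> 0 <= theta s 0 - gauss_peak s <=
  Num.sqrt 2 * expR (- (8 * s)^-1) * theta (2 * s) 0.
Proof.
move=> s0; set a := (4 * s)^-1.
have a0 : 0 < a by rewrite invr_gt0; lra.
have a20 : 0 < a / 2 by lra.
have -> : (8 * s)^-1 = a / 2 by rewrite /a; field; lra.
rewrite !poisson_summation//; last by lra.
rewrite -!/(gauss_peak _) inv8// -/a.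
have -> : Num.sqrt 2 * expR (- (a / 2)) * (gauss_peak (2 * s) * gauss_sum (a / 2) 0) =
    gauss_peak s * (expR (- (a / 2)) * gauss_sum (a / 2) 0).
  by rewrite (gauss_peak2 s0); ring.
rewrite (_ : gauss_peak s * gauss_sum a 0 - gauss_peak s = gauss_peak s * (gauss_sum a 0 - 1)); last by ring.
have p0 := gauss_peak_gt0 s0.
rewrite pmulr_rge0// subr_ge0 ler_pM2l//; apply/andP; split.
  have c2 : (fun _ : nat => 1 : R) n @[n --> \oo] --> (1 : R) by exact: cvg_cst.
  apply: cvgn_le c2 (@gauss_sum_cvg R _ 0 a0) _ => N.
  have E : 1 = expR (- (a * (0 + 0%:~R) ^+ 2)) by rewrite addr0 expr0n /= mulr0 oppr0 expR0.
  rewrite [leLHS]E.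
  by apply: (zsum_ge0_term0 (F := fun j => expR (- (a * (0 + j%:~R) ^+ 2)))) => j; exact: expR_ge0.
rewrite lerBlDr.
have c : expR (- (a / 2)) * zsum (fun j : int => expR (- (a / 2 * (0 + j%:~R) ^+ 2))) N + 1
    @[N --> \oo] --> expR (- (a / 2)) * gauss_sum (a / 2) 0 + 1.
  apply: cvgD; last exact: cvg_cst.
  by apply: cvgM; [exact: cvg_cst|exact: gauss_sum_cvg].
apply: cvgn_le (@gauss_sum_cvg R _ 0 a0) c _ => N.
rewrite -zsumZ -[X in _ <= _ + X](zsum_at0 N) -zsumD; apply: ler_zsum => j.
have [->|j0] := eqVneq j 0.
  by rewrite addr0 expr0n /= !mulr0 oppr0 expR0 lerDr mulr_ge0 ?expR_ge0.
rewrite addr0 -expRD ler_expR add0r.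
have : 1 <= j%:~R ^+ 2 :> R by rewrite -natr_absz_sqr ler1n expn_gt0 absz_gt0 j0.
by move=> /(ler_wpM2l (ltW a20)); lra.
Qed.

Lemma expr1D_le_expR n x : 0 <= x -> (1 + x) ^+ n <= n`!%:R * expR 1 * expR x.
Proof.
move=> x0; have x1 : 0 <= 1 + x by lra.
case: n => [|n].
  by rewrite expr0 fact0 mul1r -expRD; have := expR_ge1Dx (1 + x); lra.
have := expR_ge1Dxn n x1; rewrite -mulrA -expRD => h.
rewrite -ler_pdivrMl ?ltr0n ?fact_gt0// mulrC; apply: le_trans h.
by rewrite lerDr.
Qed.

Lemma exprB_bounds n (a b : R) : 0 <= b -> b <= a -> 1 <= a ->
  0 <= a ^+ n - b ^+ n <= n%:R * (a - b) * a ^+ n.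
Proof.
move=> b0 ba a1; elim: n => [|n /andP[IH0 IH]]; first by rewrite !expr0 subrr !mul0r lexx.
have a0 : 0 <= a by lra.
have bn : b ^+ n <= a ^+ n by rewrite lerXn2r ?nnegrE.
have ab0 : 0 <= a - b by lra.
have -> : a ^+ n.+1 - b ^+ n.+1 = a * (a ^+ n - b ^+ n) + (a - b) * b ^+ n by rewrite !exprS; ring.
have bn0 : 0 <= b ^+ n by rewrite exprn_ge0.
rewrite addr_ge0 ?mulr_ge0//=.
have h1 := ler_wpM2l a0 IH.
have h2 : (a - b) * b ^+ n <= (a - b) * (a * a ^+ n).
  by rewrite ler_wpM2l//; apply: (le_trans bn); rewrite ler_peMl// (le_trans bn0).
have -> : n.+1%:R * (a - b) * a ^+ n.+1 = a * (n%:R * (a - b) * a ^+ n) + (a - b) * (a * a ^+ n).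
  by rewrite exprS -natr1; ring.
exact: lerD.
Qed.

Lemma expRN_le n x : 0 <= x -> expR (- x) <= n`!%:R * expR 1 / (1 + x) ^+ n.
Proof.
move=> x0; have x1 : 0 < (1 + x) ^+ n by rewrite exprn_gt0; lra.
by rewrite expRN ler_pdivlMr// ler_pdivrMl ?expR_gt0// mulrC expr1D_le_expR.
Qed.

Lemma pi_le_4 : pi <= 4 :> R.
Proof. by have := @pihalf_lt2 R; lra. Qed.

Lemma gauss_peak_ge s : 0 < s -> 1 <= gauss_peak s * (4 * (1 + s)).
Proof.
move=> s0; rewrite /gauss_peak ler_pdivlMl; last by rewrite sqrtr_gt0 !mulr_gt0 ?pi_gt0.
rewrite mulr1 -[leRHS]ger0_norm; last by lra.
rewrite -sqrtr_sqr ler_wsqrtr//.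
have := pi_le_4; have := @pi_gt0 R; nra.
Qed.

Lemma gauss_peak_le1 s : 1 <= s -> gauss_peak s <= 1.
Proof.
move=> s1; rewrite invf_le1; last by rewrite sqrtr_gt0 !mulr_gt0 ?pi_gt0//; lra.
by rewrite -{1}sqrtr1 ler_wsqrtr//; have := @pi_ge2 R; nra.
Qed.

Lemma sqrt2_le2 : Num.sqrt 2 <= 2 :> R.
Proof. by rewrite -{2}[2]ger0_norm// -sqrtr_sqr ler_wsqrtr//; lra. Qed.

Section powers.
Variable d : nat.

Let C1 : R := d%:R * (2 * 2 ^+ d * (d.+1`!%:R * expR 1)).
Let K1 : R := d%:R * 8 * 2 ^+ d.

Let C1_ge0 : 0 <= C1.
Proof. by rewrite /C1 !mulr_ge0 ?exprn_ge0 ?expR_ge0. Qed.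
Let K1_ge0 : 0 <= K1.
Proof. by rewrite /K1 !mulr_ge0 ?exprn_ge0. Qed.

Lemma theta0_pow_peak s : 0 < s -> 0 <= theta s 0 ^+ d - gauss_peak s ^+ d <= C1.
Proof.
move=> s0; have /andP[p0 p1] := theta0_peak s0.
have g0 := gauss_peak_gt0 s0; have t1 := theta0_ge1 s0.
have gt : gauss_peak s <= theta s 0 by lra.
have /andP[-> h] := exprB_bounds d (ltW g0) gt t1; apply: (le_trans h).
have s20 : 0 < 2 * s by lra.
set x := (8 * s)^-1 in p1 *; have x0 : 0 < x by rewrite invr_gt0; lra.
have h1 : theta (2 * s) 0 <= 1 + x.
  by have := theta0_le s20; rewrite (_ : 4 * (2 * s) = 8 * s); last by ring.
have h2 : theta s 0 <= 2 * (1 + x).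
  by have := theta0_le s0; rewrite (_ : (4 * s)^-1 = 2 * x); [lra|rewrite /x; field; lra].
have h3 : theta s 0 ^+ d <= 2 ^+ d * (1 + x) ^+ d.
  by rewrite -exprMn lerXn2r ?nnegrE//; lra.
rewrite /C1 -mulrA ler_wpM2l//.
apply: (@le_trans _ _ (2 * expR (- x) * (1 + x) * (2 ^+ d * (1 + x) ^+ d))).
  apply: ler_pM => //; first by apply: exprn_ge0; lra.
  apply: (le_trans p1); apply: ler_pM; rewrite ?mulr_ge0 ?sqrtr_ge0 ?expR_ge0 ?theta_ge0//.
  by rewrite ler_wpM2r ?expR_ge0// sqrt2_le2.
rewrite (_ : _ * _ * _ * _ = 2 * 2 ^+ d * (expR (- x) * (1 + x) ^+ d.+1)); last by rewrite exprS; ring.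
rewrite ler_wpM2l ?mulr_ge0 ?exprn_ge0//.
rewrite expRN ler_pdivrMl ?expR_gt0// mulrC; exact: expr1D_le_expR (ltW x0).
Qed.

Lemma theta0_pow_exp s : 1 <= s -> 0 <= theta s 0 ^+ d - 1 <= K1 * expR (- s).
Proof.
move=> s1; have s0 : 0 < s by lra.
have t1 := theta0_ge1 s0.
have := exprB_bounds d ler01 t1 t1; rewrite expr1n => /andP[-> h]; apply: (le_trans h).
rewrite /K1 -!mulrA ler_wpM2l//.
have -> : 8 * (2 ^+ d * expR (- s)) = 8 * expR (- s) * 2 ^+ d by ring.
apply: ler_pM; [lra|by apply: exprn_ge0; lra|exact: theta0_exp|].
rewrite lerXn2r ?nnegrE//; first lra.
have := theta0_le s0; have : (4 * s)^-1 <= 1 by rewrite invf_le1; lra.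
lra.
Qed.

(** For s <= 1 the difference is bounded by [C1]. For s > 1 both parts are small separately, the
    peak because gauss_peak^d <= gauss_peak^4 = (4 pi s)^-2, which is where d >= 4 enters. *)
Lemma theta0_pow_approx : (4 <= d)%N -> exists2 C : R, 0 < C &
  forall s, 0 < s -> `|theta s 0 ^+ d - 1 - gauss_peak s ^+ d| <= C / (1 + s) ^+ 2.
Proof.
move=> d4; exists (4 * (C1 + 1) + K1 * (2 * expR 1) + 1).
  by have := mulr_ge0 K1_ge0 (ltW (@expR_gt0 R 1)); have := C1_ge0; lra.
move=> s s0; have s2 : 0 < (1 + s) ^+ 2 by rewrite exprn_gt0; lra.
have Ke := mulr_ge0 K1_ge0 (ltW (@expR_gt0 R 1)).
rewrite ler_pdivlMr//; have [s1|s1] := leP s 1.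
  have /andP[a b] := theta0_pow_peak s0.
  apply: (@le_trans _ _ ((C1 + 1) * 4)); last by lra.
  apply: ler_pM => //; [lra| |by rewrite expr2; nra].
  by apply/ler_normlP; split; lra.
have /andP[a b] := theta0_pow_exp (ltW s1).
have g0 : 0 <= gauss_peak s ^+ d by rewrite exprn_ge0 ?ltW ?gauss_peak_gt0.
have g1 : gauss_peak s ^+ d <= ((1 + s) ^+ 2)^-1.
  apply: (@le_trans _ _ (gauss_peak s ^+ 4)).
    by rewrite ler_wiXn2l ?gauss_peak_le1 ?ltW ?gauss_peak_gt0.
  rewrite /gauss_peak exprVn lef_pV2 ?posrE//; last by rewrite exprn_gt0// sqrtr_gt0 !mulr_gt0 ?pi_gt0.
  rewrite (exprM _ 2 2) sqr_sqrtr; last by rewrite !mulr_ge0 ?pi_ge0// ltW.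
  rewrite lerXn2r ?nnegrE ?mulr_ge0 ?pi_ge0//; have := @pi_ge2 R; nra.
have e1 := expRN_le 2 (ltW s0); rewrite (_ : 2`! = 2%N)// in e1.
rewrite -ler_pdivlMr//.
apply: (@le_trans _ _ (K1 * (2 * expR 1 / (1 + s) ^+ 2) + ((1 + s) ^+ 2)^-1)).
  have := ler_wpM2l K1_ge0 e1.
  by move: b g1 g0 a; clear; move=> *; apply/ler_normlP; split; lra.
have : 0 <= ((1 + s) ^+ 2)^-1 by rewrite invr_ge0 ltW.
set w := ((1 + s) ^+ 2)^-1 => w0.
by rewrite -subr_ge0 (_ : _ - _ = 4 * (C1 + 1) * w); [rewrite !mulr_ge0//; have := C1_ge0; lra|ring].
Qed.

(** The cube in the denominator is what the fourth cumulant needs: it compensates three powers of j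
    beyond j ~ L^2. *)
Lemma theta0_pow_le : exists2 C : R, 0 < C &
  forall s, 0 < s -> theta s 0 ^+ d - 1 <= C * gauss_peak s ^+ d / (1 + s) ^+ 3.
Proof.
pose A1 := 8 * (C1 * 8 ^+ d + 1); pose A2 := K1 * ((d + 3)`!%:R * expR 1) * 4 ^+ d.
have A1_gt0 : 0 < A1.
  by have := mulr_ge0 C1_ge0 (exprn_ge0 d (ler0n R 8)); rewrite /A1; lra.
have A2_ge0 : 0 <= A2 by rewrite /A2 !mulr_ge0 ?exprn_ge0 ?expR_ge0.
exists (A1 + A2); first lra.
move=> s s0; have s3 : 0 < (1 + s) ^+ 3 by rewrite exprn_gt0; lra.
have g0 : 0 < gauss_peak s ^+ d by rewrite exprn_gt0 ?gauss_peak_gt0.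
(* The peak decays only polynomially, so bounded or exponentially small quantities can be rewritten
   as multiples of it. *)
have gs : 1 <= gauss_peak s ^+ d * (4 ^+ d * (1 + s) ^+ d).
  by rewrite -!exprMn exprn_ege1// gauss_peak_ge.
rewrite ler_pdivlMr// [leRHS]mulrDl; have [s1|s1] := leP s 1.
  have /andP[a b] := theta0_pow_peak s0.
  have t1 : 1 <= theta s 0 ^+ d by rewrite exprn_ege1// theta0_ge1.
  have g8 : 1 <= gauss_peak s ^+ d * 8 ^+ d.
    rewrite (_ : 8 = 4 * 2) ?exprMn; last by ring.
    apply: (le_trans gs); rewrite ler_pM2l// ler_pM2l ?exprn_gt0//.
    by rewrite lerXn2r ?nnegrE; lra.
  apply: (@le_trans _ _ (A1 * gauss_peak s ^+ d)); last by rewrite lerDl mulr_ge0// ltW.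
  apply: (@le_trans _ _ ((C1 * (gauss_peak s ^+ d * 8 ^+ d) + gauss_peak s ^+ d) * 8)).
    apply: ler_pM; [lra|exact: ltW| |].
      by have := ler_wpM2l C1_ge0 g8; lra.
    have : (1 + s) ^+ 3 <= 2 ^+ 3 by rewrite lerXn2r ?nnegrE; lra.
    by rewrite (_ : 2 ^+ 3 = 8) //; ring.
  by rewrite /A1 le_eqVlt; apply/orP; left; apply/eqP; ring.
have /andP[a b] := theta0_pow_exp (ltW s1).
apply: (@le_trans _ _ (A2 * gauss_peak s ^+ d)); last by rewrite lerDr mulr_ge0 ?ltW.
rewrite -ler_pdivlMr//; apply: (le_trans b).
rewrite ler_pdivlMr//.
have x1 := ler_wpM2l K1_ge0 (expr1D_le_expR (d + 3) (ltW s0)).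
rewrite -mulrA -[leLHS]mul1r; apply: le_trans (ler_wpM2r _ gs) _.
  by rewrite mulr_ge0// mulr_ge0 ?expR_ge0// ltW.
rewrite expRN; have e0 := expR_gt0 s.
rewrite [leLHS](_ : _ = gauss_peak s ^+ d * 4 ^+ d / expR s * (K1 * (1 + s) ^+ (d + 3))); last first.
  rewrite exprD; generalize ((1 + s) ^+ d) ((1 + s) ^+ 3) (gauss_peak s ^+ d) ((4 : R) ^+ d) (expR s)^-1 K1.
  by move=> *; ring.
apply: le_trans (ler_wpM2l _ x1) _; first by rewrite !mulr_ge0 ?(ltW g0) ?exprn_ge0 ?invr_ge0 ?(ltW e0).
rewrite le_eqVlt; apply/orP; left; apply/eqP; rewrite /A2; field; exact: lt0r_neq0.
Qed.

(** Here the peak is at least 2, so subtracting 1 costs at most half of its power. *)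
Lemma theta0_pow_ge s : (4 <= d)%N -> 0 < s -> 16 * pi * s <= 1 ->
  gauss_peak s ^+ d / 2 <= theta s 0 ^+ d - 1.
Proof.
move=> d4 s0 s1; have /andP[a _] := theta0_pow_peak s0.
suff : 2 <= gauss_peak s ^+ d by lra.
have g2 : 2 <= gauss_peak s.
  rewrite /gauss_peak -[2]invrK lef_pV2 ?posrE ?invr_gt0//; last by rewrite sqrtr_gt0 !mulr_gt0 ?pi_gt0.
  rewrite -[leRHS]ger0_norm ?invr_ge0// -sqrtr_sqr ler_wsqrtr// exprVn.
  by rewrite (_ : 2 ^+ 2 = 4); [lra|ring].
apply: (le_trans g2); rewrite -{1}[gauss_peak s]expr1 ler_weXn2l//; lia + lra.
Qed.

Lemma theta_prod_ge s (u : 'I_d -> R) : 1 <= s -> 2 ^- d <= \prod_i theta s (u i).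
Proof.
move=> s1; rewrite -exprVn -{1}(card_ord d) -prodr_const.
by apply: ler_prod => i _; rewrite invr_ge0 ler0n theta_ge_half.
Qed.

(** One distant coordinate suffices: with x = eta^2 / (8 s), its factor carries exp (- x), while all
    d factors together blow up at most like (1 + x)^d as s tends to 0. *)
Lemma theta_prod_far eta : 0 < eta -> exists2 C : R, 0 < C &
  forall s (u : 'I_d -> R) i0, 0 < s -> (forall k : int, eta <= `|u i0 + k%:~R|) ->
    \prod_i theta s (u i) <= C.
Proof.
move=> eta0; pose q := 1 + 2 / eta ^+ 2.
have e2 : 0 < eta ^+ 2 by rewrite exprn_gt0.
have q1 : 1 <= q by rewrite lerDl divr_ge0// ltW.
exists (2 * q ^+ d * (d`!%:R * expR 1)).
  by rewrite !mulr_gt0 ?exprn_gt0 ?expR_gt0 ?ltr0n ?fact_gt0//; lra.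
move=> s u i0 s0 far.
set x := eta ^+ 2 / (8 * s); have x0 : 0 < x by rewrite divr_gt0//; lra.
have qx : 1 + (4 * s)^-1 <= q * (1 + x).
  rewrite /q (_ : (4 * s)^-1 = 2 / eta ^+ 2 * x); last by rewrite /x; field; rewrite !gt_eqF.
  have : 0 <= 2 / eta ^+ 2 by rewrite divr_ge0// ltW.
  by set w := 2 / eta ^+ 2; lra.
have s20 : 0 < 2 * s by lra.
have hi0 : theta s (u i0) <= 2 * expR (- x) * (q * (1 + x)).
  apply: (le_trans (theta_far s0 (ltW eta0) far)).
  apply: ler_pM; rewrite ?mulr_ge0 ?sqrtr_ge0 ?expR_ge0 ?theta_ge0//.
    by rewrite ler_wpM2r ?expR_ge0// sqrt2_le2.
  apply: (le_trans (theta0_le s20)); apply: le_trans qx; rewrite lerD2l lef_pV2 ?posrE; lra.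
rewrite (bigD1 i0)//=.
apply: (@le_trans _ _ (2 * expR (- x) * (q * (1 + x)) * \prod_(i | i != i0) (q * (1 + x)))).
  apply: ler_pM; rewrite ?theta_ge0//; first by apply: prodr_ge0 => i _; exact: theta_ge0.
  apply: ler_prod => i _; rewrite theta_ge0//=.
  apply: le_trans (ler_norm _) (le_trans (theta_norm_le _ s0) (le_trans (theta0_le s0) qx)).
have -> : 2 * expR (- x) * (q * (1 + x)) * \prod_(i | i != i0) (q * (1 + x)) =
    2 * expR (- x) * (q * (1 + x)) ^+ d.
  have -> : (q * (1 + x)) ^+ d = \prod_(i < d) (q * (1 + x)) by rewrite prodr_const card_ord.
  by rewrite [in RHS](bigD1 i0)//= [RHS]mulrA.
rewrite exprMn [leLHS](_ : _ = 2 * q ^+ d * (expR (- x) * (1 + x) ^+ d)); last first.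
  by rewrite mulrACA.
rewrite ler_pM2l; last by rewrite !mulr_gt0 ?exprn_gt0//; lra.
rewrite expRN ler_pdivrMl ?expR_gt0// mulrC; exact: expr1D_le_expR (ltW x0).
Qed.

End powers.

End theta_bounds.

(** * Compound Poisson distributions *)

Section compound_weights.
Context {R : realType}.
Implicit Types (a b : nat -> R) (h : nat -> R).

(** The series exp (c X^(i+1)) cut after M + 1 terms; low coefficients of products do not see the
    cut, so polynomials replace power series. *)
Definition exp_poly (M i : nat) (c : R) : {poly R} :=
  \sum_(k < M.+1) (c ^+ k / k`!%:R) *: 'X^(i.+1 * k).

Definition weight_poly a n M : {poly R} := \prod_(i < n) exp_poly M i (a i).

(* The probability that a sum of independent variables (i+1) Poisson(a i) equals m, without the factor exp (- \sum_i a i). *)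
Definition compound_weight a (m : nat) : R := (weight_poly a m m)`_m.

(** The recursion obtained from the logarithmic derivative of exp (sum_i a_i X^(i+1)); it determines
    the weights. *)
Definition weight_rec a h K := h 0%N = 1 /\
  forall k, (k < K)%N -> k.+1%:R * h k.+1 = \sum_(i < k.+1) i.+1%:R * a i * h (k - i)%N.

Lemma weight_rec_unique a h h' K : weight_rec a h K -> weight_rec a h' K ->
  forall k, (k <= K)%N -> h k = h' k.
Proof.
move=> [h0 hS] [h'0 h'S] k; elim/ltn_ind: k => -[_ _|k IH kK]; first by rewrite h0 h'0.
have k0 : k.+1%:R != 0 :> R by rewrite pnatr_eq0.
apply: (mulfI k0); rewrite hS// h'S//; apply: eq_bigr => i _.
by rewrite IH//; lia.
Qed.

Lemma exp_poly_deriv M i c : exists Q : {poly R},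
  (exp_poly M i c)^`() = (i.+1%:R * c) *: 'X^i * exp_poly M i c + 'X^M * Q.
Proof.
exists (- (i.+1%:R * c * (c ^+ M / M`!%:R)) *: 'X^(i + i * M)).
rewrite {1}/exp_poly big_ord_recl /= muln0 !expr0 fact0 divr1 scale1r derivD -(@polyC1 R) derivC.
rewrite add0r raddf_sum /=.
have -> : exp_poly M i c = \sum_(k < M) (c ^+ k / k`!%:R) *: 'X^(i.+1 * k) + (c ^+ M / M`!%:R) *: 'X^(i.+1 * M).
  by rewrite /exp_poly big_ord_recr.
rewrite mulrDr -addrA [X in _ + X](_ : _ = 0) ?addr0; last first.
  move: (c ^+ M / M`!%:R) (i.+1%:R * c) => y x.
  rewrite scaleNr mulrN -scalerAl -scalerAr -exprD scalerA -scalerAr -exprD.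
  by rewrite (_ : (i + i.+1 * M = M + (i + i * M))%N) ?subrr//; lia.
rewrite mulr_sumr; apply: eq_bigr => k _.
rewrite derivZ derivXn /bump leq0n add1n mulnS addSn /=.
rewrite -scalerAl -scalerAr -exprD scalerA -scalerMnr scalerMnl; congr (_ *: _).
rewrite -mulr_natr factS natrM exprS -addSn -mulnS natrM.
have f0 : (k : nat)`!%:R != 0 :> R by rewrite pnatr_eq0 -lt0n fact_gt0.
have k0 : (k : nat).+1%:R != 0 :> R by rewrite pnatr_eq0.
by move: f0 k0; move: (_`!%:R) (k.+1%:R) => f g f0 g0; field; rewrite f0 g0.
Qed.

(** The exact series would satisfy this equation without remainder; cutting costs a multiple of X^M,
    invisible to the coefficients below M. *)
Lemma weight_poly_deriv a n M : exists Q : {poly R},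
  (weight_poly a n M)^`() = (\poly_(i < n) (i.+1%:R * a i)) * weight_poly a n M + 'X^M * Q.
Proof.
elim: n => [|n [Q IH]].
  by exists 0; rewrite /weight_poly big_ord0 poly_def big_ord0 -(@polyC1 R) derivC; ring.
have [Q' E'] := exp_poly_deriv M n (a n).
exists (Q * exp_poly M n (a n) + weight_poly a n M * Q').
have -> : weight_poly a n.+1 M = weight_poly a n M * exp_poly M n (a n).
  by rewrite /weight_poly big_ord_recr.
by rewrite derivM IH E' !poly_def big_ord_recr /=; ring.
Qed.

Lemma coef_exp_poly0 M i c : (exp_poly M i c)`_0 = 1.
Proof.
rewrite /exp_poly big_ord_recl /= muln0 expr0 fact0 divr1 scale1r coefD coef1 /= coef_sum big1 ?addr0//.
by move=> k _; rewrite coefZ coefXn /bump leq0n add1n mulnS addSn /= mulr0.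
Qed.

Lemma sum_ord_cut (F : nat -> R) n m : (forall i, (n <= i < m)%N -> F i = 0) ->
  \sum_(i < m) F i = \sum_(i < n | (i < m)%N) F i.
Proof.
move=> F0; rewrite (big_ord_widen_cond (maxn n m) (fun i => (i < m)%N) F (leq_maxl n m)).
rewrite (big_ord_widen (maxn n m) F (leq_maxr n m)) [LHS](bigID (fun i : 'I_(maxn n m) => (i < n)%N))/=.
by rewrite [X in _ + X]big1 ?addr0// => i /andP[im ni]; apply: F0; rewrite im leqNgt ni.
Qed.

Lemma weight_poly_rec a n M K : (K <= M)%N -> (forall i, (n <= i < K)%N -> a i = 0) ->
  weight_rec a (fun k => (weight_poly a n M)`_k) K.
Proof.
move=> KM a0; split.
  rewrite /weight_poly -horner_coef0 horner_prod big1// => i _.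
  by rewrite horner_coef0 coef_exp_poly0.
move=> k kK; have [Q E] := weight_poly_deriv a n M.
have := coef_deriv (weight_poly a n M) k; rewrite E coefD coefXnM (leq_trans kK KM) addr0 coefM => e.
rewrite mulr_natl -e; apply: eq_bigr => i _; rewrite coef_poly.
case: ltnP => // ni; rewrite a0 ?mulr0//.
by rewrite ni; have := ltn_ord i; lia.
Qed.

(** The cut in [compound_weight a k] changes with k, so a larger cut must first be seen to give the
    same coefficient. This follows from uniqueness of the recursion, in a strong induction that
    proves both facts together. *)
Lemma compound_weight_rec a K : weight_rec a (compound_weight a) K.
Proof.
have E m k : (k <= m)%N -> (weight_poly a m m)`_k = compound_weight a k.
  move=> km; apply: (@weight_rec_unique a _ _ k) => //.
    by apply: weight_poly_rec => // i; lia.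
  suff H : forall j, (j <= k)%N -> weight_rec a (compound_weight a) j by exact: H.
  clear m km; elim/ltn_ind: k => k IH j jk.
  split; first by rewrite /compound_weight /weight_poly big_ord0 coef1.
  move=> l lj; rewrite {1}/compound_weight.
  have [_ ->//] := @weight_poly_rec a l.+1 l.+1 l.+1 (leqnn _) (fun i => ltac:(lia)).
  apply: eq_bigr => i _; congr (_ * _).
  apply: (@weight_rec_unique a _ _ (l - i)%N) => //.
    by apply: weight_poly_rec => //; lia.
  by apply: (IH l) => //; lia.
split; first by rewrite /compound_weight /weight_poly big_ord0 coef1.
move=> l _; rewrite {1}/compound_weight.
have [_ ->//] := @weight_poly_rec a l.+1 l.+1 l.+1 (leqnn _) (fun i => ltac:(lia)).
by apply: eq_bigr => i _; rewrite E//; lia.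
Qed.

Lemma compound_weightE a h K : weight_rec a h K ->
  forall k, (k <= K)%N -> h k = compound_weight a k.
Proof. by move=> H k kK; apply: (weight_rec_unique H) kK; exact: compound_weight_rec. Qed.

Lemma compound_weight_ge0 a m : (forall i, 0 <= a i) -> 0 <= compound_weight a m.
Proof.
move=> a0; elim/ltn_ind: m => -[_|m IH]; first by rewrite (compound_weight_rec a 0).1 ler01.
have := (compound_weight_rec a m.+1).2 m (ltnSn m) => E.
have : 0 <= m.+1%:R * compound_weight a m.+1.
  by rewrite E; apply: sumr_ge0 => i _; rewrite !mulr_ge0// IH//; lia.
by rewrite pmulr_rge0// ltr0n.
Qed.

(* A family of rates 1/j turns the weights into their partial sums: generating functions get multiplied by 1/(1-x). *)
Lemma compound_weight_harmonic a b N : (forall i, (i < N)%N -> a i = b i + i.+1%:R^-1) ->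
  forall m, (m <= N)%N -> compound_weight a m = \sum_(i < m.+1) compound_weight b i.
Proof.
move=> ab; set h := compound_weight b; pose G m := \sum_(i < m.+1) h i.
have GS m : G m.+1 = G m + h m.+1 by rewrite /G big_ord_recr.
have hrec k : k.+1%:R * h k.+1 = \sum_(i < k.+1) i.+1%:R * b i * h (k - i)%N.
  by apply: (compound_weight_rec b k.+1).2.
have h0 : h 0%N = 1 by apply: (compound_weight_rec b 0).1.
have G0 : G 0%N = 1 by rewrite /G big_ord_recr big_ord0 /= add0r.
have conv k : \sum_(i < k.+1) i.+1%:R * b i * G (k - i)%N = \sum_(l < k.+1) l.+1%:R * h l.+1.
  elim: k => [|k IH].
    by rewrite !big_ord_recr !big_ord0 /= !add0r subn0 hrec big_ord_recr big_ord0 /= add0r subn0 h0 G0.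
  rewrite [RHS]big_ord_recr /= -IH hrec big_ord_recr /= subnn [X in _ = _ + X]big_ord_recr /= subnn.
  rewrite G0 h0 addrA; congr (_ + _); rewrite -big_split /=; apply: eq_bigr => i _.
  by rewrite subSn ?GS -?mulrDr//; have := ltn_ord i; lia.
have sumG k : k.+1%:R * G k.+1 = \sum_(l < k.+1) l.+1%:R * h l.+1 + \sum_(i < k.+1) G i.
  elim: k => [|k IH]; first by rewrite GS !big_ord_recr !big_ord0 /= G0; ring.
  by rewrite GS !(big_ord_recr k.+1) /= addrACA -IH -[k.+2%:R]natr1; ring.
have Grec : weight_rec a G N.
  split=> [|k kN]; first exact: G0.
  rewrite sumG -conv; have -> : \sum_(i < k.+1) G i = \sum_(i < k.+1) G (k - i)%N.
    by rewrite (reindex_inj rev_ord_inj).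
  rewrite -big_split /=; apply: eq_bigr => i _.
  rewrite ab; last by have := ltn_ord i; lia.
  have i0 : (i : nat).+1%:R != 0 :> R by rewrite pnatr_eq0.
  by rewrite mulrDr mulfV// mulrDl mul1r.
by move=> m mN; rewrite -(compound_weightE Grec mN).
Qed.

End compound_weights.

(** * Total mass of the compound weights *)

Section normalization.
Context {R : realType}.

Lemma exp_partial_sum_le (c : R) n : 0 <= c -> \sum_(k < n) c ^+ k / k`!%:R <= expR c.
Proof.
move=> c0; have -> : \sum_(k < n) c ^+ k / k`!%:R = series (exp_coeff c) n.
  by rewrite /series /= big_mkord.
apply: nondecreasing_cvgn_le; last exact: is_cvg_series_exp_coeff.
by apply: nondecreasing_series => k _ _; exact: exp_coeff_ge0.
Qed.

Lemma exp_partial_sum_cvg (c : R) : \sum_(k < n) c ^+ k / k`!%:R @[n --> \oo] --> expR c.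
Proof.
have -> : (fun n => \sum_(k < n) c ^+ k / k`!%:R) = series (exp_coeff c).
  by apply/funext => n; rewrite /series /= big_mkord.
exact: is_cvg_series_exp_coeff.
Qed.

Lemma cvg_sum_seq (I : Type) (r : seq I) (u : I -> nat -> R) (l : I -> R) :
  (forall i, u i n @[n --> \oo] --> l i) ->
  \sum_(i <- r) u i n @[n --> \oo] --> \sum_(i <- r) l i.
Proof.
move=> ul; elim: r => [|i r IH].
  by rewrite big_nil; under eq_fun do rewrite big_nil; exact: cvg_cst.
by rewrite big_cons; under eq_fun do rewrite big_cons; exact: cvgD.
Qed.

Lemma exp_poly_horner1 M i (c : R) : (exp_poly M i c).[1] = \sum_(k < M.+1) c ^+ k / k`!%:R.
Proof.
rewrite /exp_poly horner_sum; apply: eq_bigr => k _.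
by rewrite hornerZ hornerXn expr1n mulr1.
Qed.

(** Nonnegativity of the smaller polynomial is included, which makes the relation stable under
    products. *)
Definition coef_le (p q : {poly R}) := forall k, 0 <= p`_k <= q`_k.

Lemma coef_le_mul p p' q q' : coef_le p p' -> coef_le q q' -> coef_le (p * q) (p' * q').
Proof.
move=> H H' k; rewrite !coefM; apply/andP; split.
  by apply: sumr_ge0 => i _; rewrite mulr_ge0// ?(andP (H _)).1 ?(andP (H' _)).1.
apply: ler_sum => i _; have /andP[a b] := H i; have /andP[c e] := H' (k - i)%N.
exact: ler_pM.
Qed.

Lemma exp_poly_coef_le M M' i (c : R) : 0 <= c -> (M <= M')%N ->
  coef_le (exp_poly M i c) (exp_poly M' i c).
Proof.
move=> c0 MM' k; rewrite /exp_poly !coef_sum.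
have pos n : 0 <= ((c ^+ n / n`!%:R) *: 'X^(i.+1 * n) : {poly R})`_k.
  by rewrite coefZ coefXn !mulr_ge0 ?exprn_ge0 ?invr_ge0.
rewrite sumr_ge0//=.
rewrite (big_ord_widen M'.+1 (fun n => ((c ^+ n / n`!%:R) *: 'X^(i.+1 * n) : {poly R})`_k))//.
by rewrite big_mkcond /=; apply: ler_sum => j _; case: ifP.
Qed.

Variables (b : nat -> R) (N : nat).
Hypotheses (b_ge0 : forall i, 0 <= b i) (b_eq0 : forall i, (N <= i)%N -> b i = 0).

Lemma weight_poly_coef_le M M' : (M <= M')%N ->
  coef_le (weight_poly b N M) (weight_poly b N M').
Proof.
move=> MM'; rewrite /weight_poly; apply: (big_rec2 coef_le).
  by move=> k; rewrite coef1 lexx andbT ler0n.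
by move=> i p q _ pq; apply: coef_le_mul => //; exact: exp_poly_coef_le.
Qed.

Lemma weight_poly_coef M k : (k <= M)%N -> (weight_poly b N M)`_k = compound_weight b k.
Proof.
move=> kM; apply: (compound_weightE (K := M)) kM.
by apply: weight_poly_rec => // i /andP[Ni _]; exact: b_eq0.
Qed.

Lemma weight_poly_horner1 M :
  (weight_poly b N M).[1] = \prod_(i < N) \sum_(k < M.+1) b i ^+ k / k`!%:R.
Proof. by rewrite /weight_poly horner_prod; apply: eq_bigr => i _; exact: exp_poly_horner1. Qed.

Lemma horner1_wide (p : {poly R}) n : (size p <= n)%N -> p.[1] = \sum_(k < n) p`_k.
Proof.
by move=> pn; rewrite (horner_coef_wide _ pn); apply: eq_bigr => k _; rewrite expr1n mulr1.
Qed.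

Lemma compound_weight_sum_le M : \sum_(m < M) compound_weight b m <= expR (\sum_(i < N) b i).
Proof.
apply: (@le_trans _ _ (weight_poly b N M).[1]).
  rewrite (horner1_wide (leq_maxr M _)).
  rewrite (big_ord_widen _ (fun m => compound_weight b m) (leq_maxl M (size (weight_poly b N M)))).
  rewrite big_mkcond /=; apply: ler_sum => m _; case: ifP => [mM|_].
    by rewrite weight_poly_coef// ltnW.
  by have /andP[] := weight_poly_coef_le (leqnn M) m.
rewrite weight_poly_horner1 expR_sum; apply: ler_prod => i _; apply/andP; split.
  by apply: sumr_ge0 => k _; rewrite mulr_ge0 ?exprn_ge0 ?invr_ge0.
exact: exp_partial_sum_le.
Qed.

(** The value of [weight_poly b N M] at 1 links two truncations: it is a product of exponential
    partial sums and at most a longer partial sum of the weights. The converse bound is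
    [compound_weight_sum_le]. *)
Lemma compound_weight_sum_cvg :
  \sum_(m < M) compound_weight b m @[M --> \oo] --> expR (\sum_(i < N) b i).
Proof.
set S := fun M : nat => \sum_(m < M) compound_weight b m.
have Snd : nondecreasing_seq S.
  apply/nondecreasing_seqP => M; rewrite /S big_ord_recr /= lerDl.
  exact: compound_weight_ge0.
have Sc : cvgn S.
  apply: nondecreasing_is_cvgn => //; exists (expR (\sum_(i < N) b i)) => _ [M _ <-].
  exact: compound_weight_sum_le.
suff -> : expR (\sum_(i < N) b i) = limn S by [].
apply/eqP; rewrite eq_le; apply/andP; split; last first.
  by apply: limr_le => //; apply: nearW => M; exact: compound_weight_sum_le.
have c1 : \prod_(i < N) \sum_(k < M.+1) b i ^+ k / k`!%:R @[M --> \oo] --> expR (\sum_(i < N) b i).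
  rewrite expR_sum; apply: cvg_prod_seq => i.
  by have := @exp_partial_sum_cvg (b i); rewrite -(cvg_shiftS _).
have c2 : (fun _ : nat => limn S) n @[n --> \oo] --> limn S by exact: cvg_cst.
apply: cvgn_le c1 c2 _ => M; rewrite -weight_poly_horner1 (horner1_wide (leqnn _)).
apply: le_trans (nondecreasing_cvgn_le Snd Sc (size (weight_poly b N M))).
apply: ler_sum => k _; rewrite -(weight_poly_coef (leq_maxr M k)).
by have /andP[] := weight_poly_coef_le (leq_maxl M k) k.
Qed.

End normalization.

(** * Moments, and bounds on the distribution function *)

Section moments.
Context {R : realType} (b : nat -> R) (N : nat).
Hypotheses (b_ge0 : forall i, 0 <= b i) (b_eq0 : forall i, (N <= i)%N -> b i = 0).

Let h := compound_weight b.

Definition cumulant r : R := \sum_(i < N) i.+1%:R ^+ r * b i.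

Definition compound_pmf m : R := expR (- \sum_(i < N) b i) * compound_weight b m.
Let q := compound_pmf.

(* Limits of partial sums: Stein's recursion yields the convergence of each moment series
   from that of the previous ones, without summability estimates. *)
Definition has_mean (f : nat -> R) (l : R) := \sum_(m < M) q m * f m @[M --> \oo] --> l.

Lemma compound_pmf_ge0 m : 0 <= q m.
Proof. by rewrite mulr_ge0 ?expR_ge0//; exact: compound_weight_ge0. Qed.

Lemma has_mean1 : has_mean (fun=> 1) 1.
Proof.
rewrite /has_mean -[X in _ --> X](expRxMexpNx_1 (- \sum_(i < N) b i)) opprK.
have -> : (fun M => \sum_(m < M) q m * 1) =
    (fun M => expR (- \sum_(i < N) b i) * \sum_(m < M) h m).
  by apply/funext => M; rewrite mulr_sumr; apply: eq_bigr => m _; rewrite mulr1.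
by apply: cvgM; [exact: cvg_cst|exact: compound_weight_sum_cvg].
Qed.

Lemma has_meanD f g l l' : has_mean f l -> has_mean g l' ->
  has_mean (fun m => f m + g m) (l + l').
Proof.
move=> fl gl; rewrite /has_mean.
have -> : (fun M => \sum_(m < M) q m * (f m + g m)) =
    (fun M => \sum_(m < M) q m * f m + \sum_(m < M) q m * g m).
  by apply/funext => M; rewrite -big_split /=; apply: eq_bigr => m _; rewrite mulrDr.
exact: cvgD.
Qed.

Lemma has_meanZ c f l : has_mean f l -> has_mean (fun m => c * f m) (c * l).
Proof.
move=> fl; rewrite /has_mean.
have -> : (fun M => \sum_(m < M) q m * (c * f m)) = (fun M => c * \sum_(m < M) q m * f m).
  by apply/funext => M; rewrite mulr_sumr; apply: eq_bigr => m _; rewrite mulrCA.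
by apply: cvgM => //; exact: cvg_cst.
Qed.

Lemma has_mean_cst c : has_mean (fun=> c) c.
Proof. by rewrite -[X in has_mean _ X]mulr1 -[X in has_mean (fun=> X)]mulr1; exact: has_meanZ has_mean1. Qed.

Lemma has_mean_le f g l l' : has_mean f l -> has_mean g l' -> (forall m, f m <= g m) -> l <= l'.
Proof.
move=> fl gl fg; apply: cvgn_le fl gl _ => M.
by apply: ler_sum => m _; rewrite ler_wpM2l ?compound_pmf_ge0.
Qed.

Arguments has_mean_cst c : clear implicits.
Arguments has_meanZ c {f l}.

(* The size-biased form of the compound Poisson law. *)
Lemma has_mean_stein (f l : nat -> R) :
  (forall i, has_mean (fun m => f (m + i.+1)%N) (l i)) ->
  has_mean (fun m => m%:R * f m) (\sum_(i < N) i.+1%:R * b i * l i).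
Proof.
move=> fl; rewrite /has_mean -(cvg_shiftS _).
have -> : (fun M => \sum_(m < M.+1) q m * (m%:R * f m)) =
    (fun M => \sum_(i < N) i.+1%:R * b i * \sum_(m < M - i) q m * f (m + i.+1)%N).
  (* The new term m = M + 1, expanded by the weight recursion, is what the shifted sums with i <= M
     gain when their range grows by one; for i > M truncated subtraction keeps the range empty. *)
  apply/funext; elim => [|M IH].
    rewrite big_ord_recr big_ord0 /= mul0r mulr0 addr0 big1// => i _.
    by rewrite sub0n big_ord0 mulr0.
  rewrite [LHS]big_ord_recr /= IH; pose e := expR (- \sum_(i < N) b i).
  have -> : q M.+1 * (M.+1%:R * f M.+1) =
      \sum_(i < N | (i < M.+1)%N) i.+1%:R * b i * q (M - i)%N * f M.+1.
    have -> : q M.+1 * (M.+1%:R * f M.+1) = e * (M.+1%:R * compound_weight b M.+1) * f M.+1.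
      by rewrite /q /compound_pmf -/e; ring.
    rewrite (compound_weight_rec b M.+1).2// mulr_sumr mulr_suml.
    rewrite (sum_ord_cut (n := N) (F := fun i => e * (i.+1%:R * b i * compound_weight b (M - i)) * f M.+1)).
      by apply: eq_bigr => i _; rewrite /q /compound_pmf -/e; ring.
    by move=> i /andP[Ni _]; rewrite b_eq0//; ring.
  rewrite [X in _ + X]big_mkcond -big_split /=; apply: eq_bigr => i _.
  case: ltnP => iM.
    rewrite subSn// big_ord_recr /= (_ : (M - i + i.+1 = M.+1)%N); last by lia.
    by ring.
  by rewrite addr0 (_ : (M.+1 - i = M - i)%N)//; lia.
apply: cvg_sum_seq => i; apply: cvgM; first exact: cvg_cst.
rewrite -(cvg_shiftn i); under eq_fun do rewrite addnK.
exact: fl i.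
Qed.

Lemma has_mean_eq f g l l' : has_mean f l -> (forall m, f m = g m) -> l = l' -> has_mean g l'.
Proof. by move=> fl fg <-; rewrite (_ : g = f)//; apply/funext => m; rewrite fg. Qed.

(** Shifted moments up to order three are polynomials of degree at most 3 in the jump i + 1;
    averaging them against the size-biased rates turns their coefficients into multiples of the
    first four cumulants. *)
Lemma has_mean_stein_poly f c0 c1 c2 c3 :
  (forall i, has_mean (fun m => f (m + i.+1)%N)
     (c0 + c1 * i.+1%:R + c2 * i.+1%:R ^+ 2 + c3 * i.+1%:R ^+ 3)) ->
  has_mean (fun m => m%:R * f m)
    (c0 * cumulant 1 + c1 * cumulant 2 + c2 * cumulant 3 + c3 * cumulant 4).
Proof.
move=> H; apply: (has_mean_eq (has_mean_stein H)) => //.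
rewrite /cumulant !mulr_sumr -!big_split /=; apply: eq_bigr => i _; ring.
Qed.

Let k1 := cumulant 1.
Let k2 := cumulant 2.
Let k3 := cumulant 3.
Let k4 := cumulant 4.

Lemma has_mean_id : has_mean (fun m => m%:R) k1.
Proof.
have H : has_mean (fun m => m%:R * 1) (1 * k1 + 0 * k2 + 0 * k3 + 0 * k4).
  apply: (@has_mean_stein_poly (fun=> 1)) => i.
  by apply: (has_mean_eq has_mean1) => //; ring.
by apply: (has_mean_eq H) => [m|]; ring.
Qed.

Lemma has_mean_pow2 : has_mean (fun m => m%:R ^+ 2) (k1 ^+ 2 + k2).
Proof.
have H : has_mean (fun m => m%:R * m%:R) (k1 * k1 + 1 * k2 + 0 * k3 + 0 * k4).
  apply: (@has_mean_stein_poly (fun m => m%:R)) => i.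
  apply: (has_mean_eq (has_meanD has_mean_id (has_mean_cst i.+1%:R))) => [m|].
    by rewrite natrD.
  by ring.
by apply: (has_mean_eq H) => [m|]; ring.
Qed.

Lemma has_mean_pow3 : has_mean (fun m => m%:R ^+ 3) (k1 ^+ 3 + 3 * k1 * k2 + k3).
Proof.
have H : has_mean (fun m => m%:R * m%:R ^+ 2)
    ((k1 ^+ 2 + k2) * k1 + 2 * k1 * k2 + 1 * k3 + 0 * k4).
  apply: (@has_mean_stein_poly (fun m => m%:R ^+ 2)) => i.
  apply: (has_mean_eq (has_meanD (has_meanD has_mean_pow2
    (has_meanZ (2 * i.+1%:R) has_mean_id)) (has_mean_cst (i.+1%:R ^+ 2)))) => [m|].
    by rewrite natrD; ring.
  by ring.
by apply: (has_mean_eq H) => [m|]; ring.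
Qed.

Lemma has_mean_pow4 : has_mean (fun m => m%:R ^+ 4)
  (k1 ^+ 4 + 6 * k1 ^+ 2 * k2 + 4 * k1 * k3 + 3 * k2 ^+ 2 + k4).
Proof.
have H : has_mean (fun m => m%:R * m%:R ^+ 3)
    ((k1 ^+ 3 + 3 * k1 * k2 + k3) * k1 + 3 * (k1 ^+ 2 + k2) * k2 + 3 * k1 * k3 + 1 * k4).
  apply: (@has_mean_stein_poly (fun m => m%:R ^+ 3)) => i.
  apply: (has_mean_eq (has_meanD (has_meanD (has_meanD has_mean_pow3
    (has_meanZ (3 * i.+1%:R) has_mean_pow2)) (has_meanZ (3 * i.+1%:R ^+ 2) has_mean_id))
    (has_mean_cst (i.+1%:R ^+ 3)))) => [m|].
    by rewrite natrD; ring.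
  by ring.
by apply: (has_mean_eq H) => [m|]; ring.
Qed.

Lemma has_mean_dist2 a : has_mean (fun m => (m%:R - a) ^+ 2) (k2 + (a - k1) ^+ 2).
Proof.
apply: (has_mean_eq (has_meanD (has_meanD has_mean_pow2 (has_meanZ (- (2 * a)) has_mean_id))
  (has_mean_cst (a ^+ 2)))) => [m|]; ring.
Qed.

Arguments has_mean_dist2 a : clear implicits.

Lemma has_mean_central4 : has_mean (fun m => (m%:R - k1) ^+ 4) (3 * k2 ^+ 2 + k4).
Proof.
apply: (has_mean_eq (has_meanD (has_meanD (has_meanD (has_meanD has_mean_pow4
  (has_meanZ (- (4 * k1)) has_mean_pow3)) (has_meanZ (6 * k1 ^+ 2) has_mean_pow2))
  (has_meanZ (- (4 * k1 ^+ 3)) has_mean_id)) (has_mean_cst (k1 ^+ 4)))) => [m|]; ring.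
Qed.

Definition compound_cdf m : R := \sum_(i < m.+1) q i.

Let positive_part (M m : nat) : R := if (m < M)%N then M%:R - m%:R else 0.

Lemma sum_compound_cdf M : \sum_(m < M) compound_cdf m = \sum_(m < M) q m * (M%:R - m%:R).
Proof.
elim: M => [|M IH]; first by rewrite !big_ord0.
rewrite big_ord_recr /= IH /compound_cdf !(big_ord_recr M) /= addrA -big_split /= -natr1.
congr (_ + _); last by ring.
by apply: eq_bigr => m _; ring.
Qed.

Lemma has_mean_finite (f : nat -> R) M : (forall m, (M <= m)%N -> f m = 0) ->
  has_mean f (\sum_(m < M) q m * f m).
Proof.
move=> f0; rewrite /has_mean -(cvg_shiftn M).
have -> : (fun n : nat => \sum_(m < n + M) q m * f m) = (fun=> \sum_(m < M) q m * f m).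
  apply/funext => n; rewrite (sum_ord_cut (n := M) (F := fun m => q m * f m)).
    by apply: eq_bigl => m; have := ltn_ord m; lia.
  by move=> m /andP[Mm _]; rewrite f0// mulr0.
exact: cvg_cst.
Qed.

Lemma has_mean_positive_part M : has_mean (positive_part M) (\sum_(m < M) compound_cdf m).
Proof.
apply: (has_mean_eq (@has_mean_finite (positive_part M) M _)) => //.
  by move=> m Mm; rewrite /positive_part ltnNge Mm.
by rewrite sum_compound_cdf; apply: eq_bigr => m _; rewrite /positive_part ltn_ord.
Qed.

Arguments has_mean_positive_part M : clear implicits.

Lemma compound_cdf_le1 m : compound_cdf m <= 1.
Proof.
pose f i : R := (i < m.+1)%N%:R.
have f0 i : (m.+1 <= i)%N -> f i = 0 by move=> mi; rewrite /f ltnNge mi.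
have -> : compound_cdf m = \sum_(i < m.+1) q i * f i.
  by apply: eq_bigr => i _; rewrite /f ltn_ord mulr1.
apply: has_mean_le (has_mean_finite f0) has_mean1 _ => i.
by rewrite /f; case: ltnP.
Qed.

Lemma compound_cdf_ge0 m : 0 <= compound_cdf m.
Proof. by apply: sumr_ge0 => i _; exact: compound_pmf_ge0. Qed.

Lemma compound_cdf_ge_exp m : expR (- \sum_(i < N) b i) <= compound_cdf m.
Proof.
rewrite /compound_cdf big_ord_recl /= /q /compound_pmf (compound_weight_rec b 0).1 mulr1 lerDl.
by apply: sumr_ge0 => i _; exact: compound_pmf_ge0.
Qed.

(** With w = m - k1, the pointwise bound - w <= s / 2 + w^2 / (2 s) replaces the Cauchy-Schwarz
    inequality; at s = sqrt k2 its right side has mean s. *)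
Lemma sum_compound_cdf_le M : 0 < k2 ->
  \sum_(m < M) compound_cdf m <= `|M%:R - k1| + Num.sqrt k2.
Proof.
move=> v0; set D := `|_|; set s := Num.sqrt k2.
have s0 : 0 < s by rewrite sqrtr_gt0.
have ss : k2 = s ^+ 2 by rewrite sqr_sqrtr// ltW.
have H := has_meanD (has_mean_cst (D + s / 2)) (has_meanZ (2 * s)^-1 (has_mean_dist2 k1)).
rewrite [leRHS](_ : _ = D + s / 2 + (2 * s)^-1 * (k2 + (k1 - k1) ^+ 2)); last first.
  by rewrite subrr ss; field; exact: lt0r_neq0.
apply: (has_mean_le (has_mean_positive_part M) H) => m.
have D0 : 0 <= D by exact: normr_ge0.
have MD : M%:R - k1 <= D by exact: ler_norm.
set w := m%:R - k1.
have i0 : 0 < (2 * s)^-1 by rewrite invr_gt0; lra.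
have w1 : - w <= s / 2 + (2 * s)^-1 * w ^+ 2.
  rewrite -subr_ge0 (_ : _ - _ = (2 * s)^-1 * (w + s) ^+ 2); last by field; exact: lt0r_neq0.
  by rewrite mulr_ge0 ?sqr_ge0// ltW.
have w2 : 0 <= s / 2 + (2 * s)^-1 * w ^+ 2.
  by have := mulr_ge0 (ltW i0) (sqr_ge0 w); lra.
rewrite /positive_part; case: ifP => _; last by lra.
have -> : M%:R - m%:R = (M%:R - k1) - w by rewrite /w; ring.
by lra.
Qed.

(** With w = m - k1, the positive part of - w is (|w| - w) / 2, and w has mean zero. The scale s =
    lam sqrt k2 with lam^2 = (3 + K) / 2 is chosen so that the quartic correction, of mean 3 k2^2 +
    k4 up to its factor, takes at most half of the quadratic gain. *)
Lemma sum_compound_cdf_ge K M : 0 < k2 -> 0 <= K -> k4 <= K * k2 ^+ 2 ->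
  Num.sqrt k2 / (4 * Num.sqrt ((3 + K) / 2)) - `|M%:R - k1| <= \sum_(m < M) compound_cdf m.
Proof.
move=> v0 K0 k4K; set D := `|_|; set lam := Num.sqrt ((3 + K) / 2); pose s := lam * Num.sqrt k2.
have r0 : 0 < Num.sqrt k2 by rewrite sqrtr_gt0.
have l0 : 0 < lam by rewrite sqrtr_gt0; lra.
have rr : k2 = Num.sqrt k2 ^+ 2 by rewrite sqr_sqrtr// ltW.
have ll : lam ^+ 2 = (3 + K) / 2 by rewrite sqr_sqrtr; lra.
have s0 : 0 < s by rewrite mulr_gt0.
have s3 : 0 < (8 * s ^+ 3)^-1 by rewrite invr_gt0 mulr_gt0 ?exprn_gt0.
have i0 : 0 < (2 * s)^-1 by rewrite invr_gt0; lra.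
have H := has_meanD (has_meanD (has_meanD (has_meanZ (2 * s)^-1 (has_mean_dist2 k1))
  (has_meanZ (- (8 * s ^+ 3)^-1) has_mean_central4))
  (has_meanZ (- 2^-1) (has_meanD has_mean_id (has_mean_cst (- k1))))) (has_mean_cst (- D)).
set L := _ + _ in H.
apply: (@le_trans _ _ L).
  have -> : L = (2 * s)^-1 * k2 - (8 * s ^+ 3)^-1 * (3 * k2 ^+ 2 + k4) - D by rewrite /L; ring.
  rewrite lerD2r.
  have : (8 * s ^+ 3)^-1 * (3 * k2 ^+ 2 + k4) <= (8 * s ^+ 3)^-1 * (2 * lam ^+ 2 * k2 ^+ 2).
    by rewrite ler_pM2l// ll; lra.
  have -> : (8 * s ^+ 3)^-1 * (2 * lam ^+ 2 * k2 ^+ 2) = Num.sqrt k2 / (4 * lam).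
    by rewrite {1}rr /s; field; rewrite !lt0r_neq0.
  have -> : (2 * s)^-1 * k2 = Num.sqrt k2 / (4 * lam) + Num.sqrt k2 / (4 * lam).
    by rewrite {1}rr /s; field; rewrite !lt0r_neq0.
  by lra.
apply: has_mean_le H (has_mean_positive_part M) _ => m.
have D0 : 0 <= D by exact: normr_ge0.
have MD : k1 - M%:R <= D by rewrite /D distrC ler_norm.
rewrite (_ : m%:R + - k1 = m%:R - k1)//; set w := m%:R - k1.
have mw : M%:R - m%:R = (M%:R - k1) - w by rewrite /w; ring.
(* |w| >= w^2 / s - w^4 / (4 s^3): the second and fourth moments bound E|w| from below. *)
have main : (2 * s)^-1 * w ^+ 2 - (8 * s ^+ 3)^-1 * w ^+ 4 <= `|w| / 2.
  pose t := `|w| / s.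
  have t0 : 0 <= t by rewrite divr_ge0// ltW.
  have wt : `|w| = t * s by rewrite /t divfK// lt0r_neq0.
  have e2 : w ^+ 2 = (t * s) ^+ 2 by rewrite -wt real_normK// num_real.
  have -> : w ^+ 4 = (w ^+ 2) ^+ 2 by rewrite -exprM.
  rewrite e2 wt.
  have -> : (2 * s)^-1 * (t * s) ^+ 2 - (8 * s ^+ 3)^-1 * ((t * s) ^+ 2) ^+ 2 =
      s / 2 * (t ^+ 2 - t ^+ 4 / 4) by field; exact: lt0r_neq0.
  have -> : t * s / 2 = s / 2 * t by ring.
  rewrite ler_pM2l; last by lra.
  rewrite -subr_ge0 (_ : _ - _ = t * (1 - t + t ^+ 3 / 4)); last by field.
  rewrite mulr_ge0//.
  (* A certificate of positivity for t >= 0; 6/5 is a rational point near the minimizer 2 / sqrt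
     3. *)
  have : 4 * (1 - t + t ^+ 3 / 4) = (t - 6 / 5) ^+ 2 * (t + 12 / 5) + 8 / 25 * t + 68 / 125.
    by field.
  have h3 : 0 <= (t - 6 / 5) ^+ 2 * (t + 12 / 5) by rewrite mulr_ge0 ?sqr_ge0//; lra.
  by lra.
rewrite /positive_part; have [w0|w0] := leP 0 w.
  rewrite ger0_norm// in main.
  case: ltnP => [mM|_]; last by lra.
  have : (m%:R : R) <= M%:R by rewrite ler_nat ltnW.
  by lra.
rewrite ltr0_norm// in main.
case: ltnP => [_|Mm]; first by rewrite mw; lra.
have : (M%:R : R) <= m%:R by rewrite ler_nat.
by lra.
Qed.

(* Cauchy-Schwarz applied to the positive part of M + 1 - m. *)
Lemma compound_cdf_ge M : 0 < \sum_(m < M.+1) compound_cdf m ->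
  3 / 4 * (\sum_(m < M.+1) compound_cdf m) ^+ 2 <=
  compound_cdf M * (k2 + (M.+1%:R - k1) ^+ 2).
Proof.
set A := \sum_(m < M.+1) _ => A0; set Q := k2 + _.
have Q0 : 0 <= Q.
  by apply: has_mean_le (has_mean_cst 0) (has_mean_dist2 M.+1%:R) _ => m; exact: sqr_ge0.
pose f m : R := (m < M.+1)%N%:R.
have f0 i : (M.+1 <= i)%N -> f i = 0 by move=> mi; rewrite /f ltnNge mi.
have fE : compound_cdf M = \sum_(i < M.+1) q i * f i.
  by apply: eq_bigr => i _; rewrite /f ltn_ord mulr1.
have CS c : 0 < c -> A <= c / 2 * compound_cdf M + (2 * c)^-1 * Q.
  move=> c0; rewrite fE.
  apply: (has_mean_le (has_mean_positive_part M.+1) (has_meanD (has_meanZ (c / 2) (has_mean_finite f0))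
    (has_meanZ (2 * c)^-1 (has_mean_dist2 M.+1%:R)))) => m.
  have i0 : 0 < (2 * c)^-1 by rewrite invr_gt0; lra.
  rewrite /f /positive_part; case: ifP => _; last first.
    by rewrite mulr0 add0r mulr_ge0 ?sqr_ge0// ltW.
  rewrite mulr1 -subr_ge0 (_ : _ - _ = (2 * c)^-1 * (m%:R - M.+1%:R + c) ^+ 2).
    by rewrite mulr_ge0 ?sqr_ge0// ltW.
  by rewrite -natr1; field; exact: lt0r_neq0.
have [Q1|] := ltP 0 Q; last first.
  move=> Q1; have Qz : Q = 0 by lra.
  have [c c0] : exists2 c : R, 0 < c & c * compound_cdf M < A.
    exists (A / 2); first lra.
    by have := compound_cdf_le1 M; nra.
  have := CS (2 * c); rewrite Qz mulr0 addr0 => /(_ ltac:(lra)).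
  have -> : 2 * c / 2 = c by field.
  by lra.
have Ai : A != 0 by exact: lt0r_neq0.
(* This [c] turns the term with Q into A / 4, the origin of the factor 3/4, and requires no
   positivity of the distribution function. *)
have := CS (2 * Q / A) _; rewrite divr_gt0//; last by lra.
move=> /(_ isT).
have -> : (2 * (2 * Q / A))^-1 * Q = A / 4 by field; rewrite Ai lt0r_neq0.
have -> : 2 * Q / A / 2 * compound_cdf M = compound_cdf M * Q / A by field.
rewrite -lerBlDr ler_pdivlMr// => AQ.
by rewrite expr2; lra.
Qed.

End moments.

(** * The particle number of the loop soup *)

Lemma big_setU_disjoint_measure {R : realType} disp (T : measurableType disp)
    (mu : {measure set T -> \bar R}) (I : eqType) (r : seq I) (F : I -> set T) :
  uniq r -> (forall i, measurable (F i)) -> (forall i j, F i `&` F j !=set0 -> i = j) ->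
  mu (\big[setU/set0]_(i <- r) F i) = (\sum_(i <- r) mu (F i))%E.
Proof.
move=> + mF tF; elim: r => [|i r IH] /=; first by rewrite !big_nil measure0.
move=> /andP[ir ur]; rewrite !big_cons measureU//.
- by congr (_ + _)%E; exact: IH.
- by elim/big_ind: (\big[_/_]_(_ <- _) _) => // A B mA mB; exact: measurableU.
rewrite -subset0 => x [Fx]; elim: r ir {ur IH} => [|j r IH]; first by rewrite big_nil.
rewrite inE negb_or big_cons => /andP[/eqP ij ir] [Fjx|]; last exact: IH.
by apply: ij; apply: tF; exists x.
Qed.

Lemma sum_by_count (T : Type) (len : T -> nat) (s : seq T) m : all (fun w => (len w <= m)%N) s ->
  (\sum_(w <- s) len w = \sum_(i < m) i.+1 * count (fun w => len w == i.+1) s)%N.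
Proof.
elim: s => [_|w s IH /= /andP[wm sm]].
  by rewrite big_nil big1// => i _; rewrite muln0.
rewrite big_cons IH//.
have -> : (\sum_(i < m) i.+1 * ((len w == i.+1) + count (fun w => len w == i.+1) s) =
    \sum_(i < m) i.+1 * (len w == i.+1) + \sum_(i < m) i.+1 * count (fun w => len w == i.+1) s)%N.
  by rewrite -big_split; apply: eq_bigr => i _; rewrite mulnDr.
congr (_ + _)%N.
case: (len w) wm => [|l lm]; first by rewrite big1// => i _; rewrite muln0.
rewrite (bigD1 (Ordinal lm))//= eqxx muln1 big1 ?addn0// => i il.
rewrite eqSS; case: eqP => [E|]; last by rewrite muln0.
by case/eqP: il; apply: val_inj; rewrite /= E.
Qed.

Section soup.
Context {R : realType} {d : nat} (S : torus_spectrum R d) (L : {posnum R}) (beta : R).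
Hypotheses (d_gt0 : (0 < d)%N) (beta_gt0 : 0 < beta).

(** The integrand is prescribed on the fundamental domain only, which is where the bridge mass is
    known. *)
Lemma box_integral_torus_cst n (f : 'rV[R]_n -> \bar R) (c : R) :
  (forall x, torus L x -> f x = c%:E) -> box_integral L f = (c * L%:num ^+ n)%:E.
Proof.
elim: n f => [|n IH] f fc /=.
  by rewrite fc ?expr0 ?mulr1// => -[].
have E a : 0 <= a < L%:num ->
    box_integral L (fun v : 'rV[R]_n => f (row_mx (const_mx a : 'rV[R]_1) v)) = (c * L%:num ^+ n)%:E.
  move=> aL; apply: IH => x xL; apply: fc => i.
  by have [k ->|->] := unliftP ord0 i; rewrite ?row_mx_tail ?row_mx_head.
transitivity (\int[lebesgue_measure]_(a in `[0%R, L%:num[%classic) (cst (c * L%:num ^+ n)%:E) a)%E.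
  by apply: eq_integral => a; rewrite inE /= in_itv /= => aL; rewrite E.
rewrite integral_cst//.
rewrite /= lebesgue_measure_itv /= lte_fin gt0.
by rewrite oppr0 adde0 -EFinM exprSr mulrA.
Qed.

Definition loop_rate (i : nat) : R :=
  theta (beta * i.+1%:R * L%:num ^- 2) 0 ^+ d / i.+1%:R.

Lemma bridge_mass (W : brownian_bridge S L) (x : 'rV[R]_d) j : (0 < j)%N -> torus L x ->
  bridge W x x (beta * j%:R) setT = (L%:num ^- d * theta (beta * j%:R * L%:num ^- 2) 0 ^+ d)%:E.
Proof.
move=> j0 xL; have t0 : 0 < beta * j%:R by rewrite mulr_gt0 ?ltr0n.
have := bridgeP W (t := beta * j%:R) (l := [::]) xL xL.
rewrite /= andbT => /(_ t0) -> //; rewrite subr0 heat_kernel_theta//; congr (_ * _)%:E.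
under eq_bigr do rewrite subrr mul0r.
by rewrite prodr_const card_ord.
Qed.

Lemma loop_intensity_length (W : brownian_bridge S L) N (J : pred nat) :
  loop_intensity W N [set w : loop d L beta | J (loop_length w)] =
  (\sum_(i < N | J i.+1) loop_rate i)%:E.
Proof.
rewrite /loop_intensity big_add1 /= big_mkord [in RHS]big_mkcond /= -sumEFin.
apply: eq_bigr => i _.
have L0 : L%:num ^+ d != 0 by rewrite expf_neq0 ?gt_eqF.
case: ifP => Ji.
  rewrite (@box_integral_torus_cst _ _ (L%:num ^- d * theta (beta * i.+1%:R * L%:num ^- 2) 0 ^+ d)).
    by rewrite -EFinM /loop_rate; congr _%:E; rewrite [X in _ * X]mulrAC mulVf// mul1r mulrC.
  move=> x xL; rewrite -(@bridge_mass W x i.+1)//; congr (bridge _ _ _ _ _).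
  by apply/seteqP; split.
rewrite (@box_integral_torus_cst _ _ 0) ?mul0r ?mule0// => x xL.
rewrite [X in bridge _ _ _ _ X](_ : _ = set0) ?measure0//.
by apply/seteqP; split => // w /=; rewrite /loop_length /= Ji.
Qed.

Lemma measurable_loops_length (J : pred nat) :
  measurable_loops [set w : loop d L beta | J (loop_length w)].
Proof.
move=> j; have [Jj|Jj] := boolP (J j).
  by rewrite [X in measurable X](_ : _ = setT)//; apply/seteqP; split.
by rewrite [X in measurable X](_ : _ = set0)//; apply/seteqP; split => // w /=; rewrite /loop_length /= (negbTE Jj).
Qed.

Lemma compound_weight_sum (a : nat -> R) m : compound_weight a m =
  \sum_(f : {ffun 'I_m -> 'I_m.+1} | (\sum_(i < m) i.+1 * f i == m)%N) \prod_(i < m) (a i ^+ f i / (f i)`!%:R).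
Proof.
rewrite /compound_weight /weight_poly /exp_poly bigA_distr_bigA /= coef_sum [RHS]big_mkcond /=.
apply: eq_bigr => f _.
have -> : \prod_(i < m) ((a i ^+ f i / (f i)`!%:R) *: 'X^(i.+1 * f i)) =
    (\prod_(i < m) (a i ^+ f i / (f i)`!%:R)) *: 'X^(\sum_(i < m) i.+1 * f i) :> {poly R}.
  under eq_bigr do rewrite -mul_polyC.
  by rewrite big_split /= -rmorph_prod prodrXr mul_polyC.
by rewrite coefZ coefXn eq_sym; case: eqP => _; rewrite ?mulr1 ?mulr0.
Qed.

(** The event is a disjoint union over occupation numbers [f] of the lengths 1, ..., m, with no loop
    longer than m. Independence gives a product of Poisson probabilities; the empty class
    contributes the exponential of the remaining rates, so that the normalization runs over all N
    lengths. *)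
Lemma particle_probE N (X : loop_soup S L beta N) m : (m <= N)%N ->
  particle_prob X m = expR (- \sum_(i < N) loop_rate i) * compound_weight loop_rate m.
Proof.
move=> mN.
(* The last class collects all lengths above m. Length 0 is in no class, as it does not change the
   particle number. *)
pose J (i : 'I_m.+1) : pred nat := fun j => if (i < m)%N then j == i.+1 else (m < j)%N.
pose A (i : 'I_m.+1) : set (loop d L beta) := [set w | J i (loop_length w)].
pose k (f : {ffun 'I_m -> 'I_m.+1}) (i : 'I_m.+1) : nat :=
  if insub (val i) is Some i' then f i' else 0%N.
pose E f := [set o : soup_space X | forall i, count (mem (A i)) (soup_loops o) = k f i].
have cA i o : count (mem (A i)) (soup_loops (l := X) o) = count (fun w => J i (loop_length w)) (soup_loops o).
  by apply: eq_count => w /=; apply/idP/idP; rewrite inE.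
have kl f (i : 'I_m) : k f (widen_ord (leqnSn m) i) = f i.
  by rewrite /k insubT /=; [exact: ltn_ord|move=> p; congr (nat_of_ord (f _)); exact: val_inj].
have km f : k f ord_max = 0%N by rewrite /k insubF //= ltnn.
have tA : trivIset setT A.
  move=> i j _ _ [w [/=]]; rewrite /A /= /J; have := ltn_ord i; have := ltn_ord j.
  move: (loop_length w) => l jm im H1 H2; apply: val_inj => /=.
  by move: H1 H2; case: (ltnP i m) => hi; case: (ltnP j m) => hj H1 H2; lia.
have mE f : measurable (E f).
  rewrite (_ : E f = \bigcap_(i in [set: 'I_m.+1]) [set o | count (mem (A i)) (soup_loops o) = k f i]).
    apply: fin_bigcap_measurable => // i _; apply: soup_measurable; exact: measurable_loops_length.
  by apply/seteqP; split => o /= h i; [move=> _; exact: h|exact: h].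
have tE f g : E f `&` E g !=set0 -> f = g.
  move=> [om [Ef Eg]]; apply/ffunP => i; apply: val_inj; rewrite /= -!kl.
  by rewrite -Ef -Eg.
pose r := [seq f : {ffun 'I_m -> 'I_m.+1} <- index_enum {ffun 'I_m -> 'I_m.+1} | (\sum_(i < m) i.+1 * f i == m)%N].
have EU : [set o : soup_space X | particle_number o = m] = \big[setU/set0]_(f <- r) E f.
  rewrite -bigcup_seq; apply/seteqP; split => o /=.
    rewrite /particle_number => sm.
    have om : all (fun w => (loop_length w <= m)%N) (soup_loops o).
      apply/allP => w wo; rewrite -sm (big_rem w wo) /=; exact: leq_addr.
    have sc := sum_by_count om; rewrite sm in sc.
    have cm (i : 'I_m) : (count (fun w : loop d L beta => loop_length w == i.+1) (soup_loops o) < m.+1)%N.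
      rewrite ltnS {2}sc (bigD1 i)//=; apply: leq_trans (leq_addr _ _); exact: leq_pmull.
    exists [ffun i => Ordinal (cm i)].
      rewrite /= mem_filter mem_index_enum andbT; apply/eqP; rewrite [RHS]sc.
      by apply: eq_bigr => i _; rewrite ffunE.
    move=> i; rewrite cA; have := ltn_ord i; rewrite ltnS leq_eqVlt => /orP[/eqP im|im].
      have -> : i = ord_max by exact: val_inj.
      rewrite km; apply/eqP; rewrite -leqn0 leqNgt -has_count; apply/hasPn => w wo.
      by rewrite /J /= ltnn -leqNgt; exact: (allP om).
    have -> : i = widen_ord (leqnSn m) (Ordinal im) by exact: val_inj.
    by rewrite kl ffunE /= /J /= im.
  move=> [f]; rewrite /= mem_filter => /andP[/eqP fm _] Ef.
  rewrite /particle_number (@sum_by_count _ _ _ m).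
    rewrite -[RHS]fm; apply: eq_bigr => i _; congr (_ * _)%N.
    by rewrite -(kl f i) -Ef cA; apply: eq_count => w; rewrite /J /= ltn_ord.
  apply/allP => w wo; rewrite leqNgt; apply/negP => mw.
  have := Ef ord_max; rewrite km cA => /eqP; rewrite -leqn0 leqNgt -has_count => /hasP; apply.
  by exists w => //; rewrite /J /= ltnn.
rewrite /particle_prob EU big_setU_disjoint_measure//; last by rewrite filter_uniq// index_enum_uniq.
pose rate i := \sum_(l < N | J i l.+1) loop_rate l.
have PE f : soup_prob X (E f) = (\prod_(i < m.+1) poisson (rate i) (k f i))%:E.
  rewrite soup_poisson//; last by move=> i; exact: measurable_loops_length.
  by congr _%:E; apply: eq_bigr => i _; rewrite loop_intensity_length.
rewrite (eq_bigr (fun f => (\prod_(i < m.+1) poisson (rate i) (k f i))%:E)); last by move=> f _; exact: PE.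
rewrite sumEFin /= big_filter compound_weight_sum mulr_sumr; apply: eq_bigr => f _.
have rl (i : 'I_m) : rate (widen_ord (leqnSn m) i) = loop_rate i.
  rewrite /rate /J /= ltn_ord (bigD1 (Ordinal (leq_trans (ltn_ord i) mN)))//= big1 ?addr0//.
  by move=> l /andP[/eqP [li] /eqP]; case; apply: val_inj.
have rm : rate ord_max = \sum_(l < N | ~~ (l < m)%N) loop_rate l.
  by apply: eq_bigl => l; rewrite /J /= ltnn ltnS leqNgt.
rewrite big_ord_recr /= km rm (eq_bigr (fun i : 'I_m => expR (- loop_rate i) * (loop_rate i ^+ f i / (f i)`!%:R))).
  rewrite big_split /= -expR_sum sumrN /poisson expr0 fact0 divr1 mulr1 mulrAC -expRD; congr (expR _ * _).
  rewrite -opprD [in RHS](bigID (fun l : 'I_N => (l < m)%N)) /=; congr (- (_ + _)).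
  by rewrite (big_ord_widen _ loop_rate mN).
by move=> i _; rewrite kl rl /poisson mulrA.
Qed.

End soup.

(** * Cumulants at the critical density *)

Section elementary_sums.
Context {R : realType}.
Implicit Types (A x : R).

Lemma ln_le_subr1 x : 0 < x -> ln x <= x - 1.
Proof. by move=> x0; have := expR_ge1Dx (ln x); rewrite lnK ?posrE//; lra. Qed.

Lemma sum_inv_sqr_le A n : 0 < A ->
  \sum_(i < n) ((A + i.+1%:R) ^+ 2)^-1 <= A^-1 - (A + n%:R)^-1.
Proof.
move=> A0; elim: n => [|n IH]; first by rewrite big_ord0 addr0 subrr.
rewrite big_ord_recr /=; apply: le_trans (lerD IH (lexx _)) _.
have n0 : 0 <= n%:R :> R by rewrite ler0n.
rewrite -natr1; set x := A + n%:R; have x0 : 0 < x by rewrite /x; lra.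
rewrite addrA -/x -addrA lerD2l -subr_ge0.
rewrite (_ : _ - _ = (x * (x + 1) ^+ 2)^-1).
  by rewrite invr_ge0 mulr_ge0 ?sqr_ge0// ltW.
by field; rewrite !lt0r_neq0//; lra.
Qed.

Lemma sum_inv_sqr_le2 n : \sum_(i < n) (i.+1%:R ^+ 2)^-1 <= 2 :> R.
Proof.
case: n => [|n]; first by rewrite big_ord0.
rewrite big_ord_recl /= expr1n invr1.
have := @sum_inv_sqr_le 1 n ltr01; rewrite invr1 => H.
have : 0 <= (1 + n%:R)^-1 :> R by rewrite invr_ge0 addr_ge0.
rewrite (eq_bigr (fun i : 'I_n => ((1 + i.+1%:R) ^+ 2)^-1)); first by lra.
by move=> i _; rewrite /bump leq0n add1n -[i.+2%:R]natr1 addrC.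
Qed.

Lemma harmonic_ge n : ln n.+1%:R <= \sum_(i < n) i.+1%:R^-1 :> R.
Proof.
elim: n => [|n IH]; first by rewrite big_ord0 ln1.
rewrite big_ord_recr /=; have n0 : 0 < n.+1%:R :> R by rewrite ltr0n.
have -> : n.+2%:R = n.+1%:R * (1 + n.+1%:R^-1) :> R.
  by rewrite mulrDr mulr1 divff ?lt0r_neq0// natr1.
have x0 : 0 < 1 + n.+1%:R^-1 :> R by rewrite addr_gt0// invr_gt0.
rewrite lnM ?posrE//; apply: lerD => //.
by apply: le_trans (ln_le_subr1 x0) _; rewrite addrC addKr.
Qed.

Lemma harmonic_le n : \sum_(i < n.+1) i.+1%:R^-1 <= 1 + ln n.+1%:R :> R.
Proof.
elim: n => [|n IH]; first by rewrite big_ord_recr big_ord0 /= ln1 invr1; lra.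
rewrite big_ord_recr /=; apply: le_trans (lerD IH (lexx _)) _.
have n1 : 0 < n.+1%:R :> R by rewrite ltr0n.
have n2 : 0 < n.+2%:R :> R by rewrite ltr0n.
have q0 : 0 < n.+1%:R / n.+2%:R :> R by rewrite divr_gt0.
have := ln_le_subr1 q0; rewrite ln_div ?posrE//.
have -> : n.+1%:R / n.+2%:R - 1 = - n.+2%:R^-1 :> R.
  by rewrite -[n.+2%:R]natr1; move: (n.+1%:R : R) n1 => j j0; field; rewrite lt0r_neq0//; lra.
by move: (ln n.+1%:R) (ln n.+2%:R) (n.+2%:R^-1) => x y z; lra.
Qed.

(* x |-> ln (x / (A + x)) is a primitive of A / (x (A + x)). *)
Lemma sum_log_le A n : 0 < A ->
  \sum_(i < n) A / (i.+1%:R * (A + i.+1%:R)) <= 1 + ln (A + 1).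
Proof.
move=> A0; case: n => [|n]; first by rewrite big_ord0 addr_ge0// ln_ge0; lra.
suff H : \sum_(i < n.+1) A / (i.+1%:R * (A + i.+1%:R)) <=
    1 + ln (A + 1) + ln (n.+1%:R / (A + n.+1%:R)).
  apply: (le_trans H); rewrite gerDl; apply: le_trans (ln_le_subr1 _) _.
    by rewrite divr_gt0 ?addr_gt0.
  by rewrite subr_le0 ler_pdivrMr ?addr_gt0// mul1r lerDr ltW.
elim: n => [|n IH].
  rewrite big_ord_recr big_ord0 /= add0r !mul1r lnV ?posrE ?addr_gt0// addrK.
  by rewrite ler_pdivrMr ?addr_gt0//; lra.
rewrite big_ord_recr /=; apply: le_trans (lerD IH (lexx _)) _.
have n1 : 0 < n.+1%:R :> R by rewrite ltr0n.
rewrite -[n.+2%:R]natr1; set j := n.+1%:R : R in n1 *.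
have u0 : 0 < (j * (A + (j + 1))) / ((j + 1) * (A + j)) by rewrite divr_gt0 ?mulr_gt0//; lra.
have E : ln ((j + 1) / (A + (j + 1))) = ln (j / (A + j)) - ln ((j * (A + (j + 1))) / ((j + 1) * (A + j))).
  rewrite -ln_div ?posrE//; last by rewrite divr_gt0//; lra.
  by congr ln; field; rewrite !lt0r_neq0//; lra.
rewrite E [leRHS]addrA lerD2l lerNr.
apply: le_trans (ln_le_subr1 u0) _.
rewrite -subr_ge0 (_ : _ - _ = A / ((j + 1) * (A + (j + 1)) * (A + j))).
  by rewrite divr_ge0 ?mulr_ge0//; lra.
by field; rewrite !lt0r_neq0//; lra.
Qed.

Lemma sum_inv_sqrt_cube_le n : \sum_(i < n) (Num.sqrt i.+1%:R ^+ 3)^-1 <= 3 :> R.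
Proof.
case: n => [|n]; first by rewrite big_ord0.
(* The subtracted term is the tail of the integral of x^(-3/2), which makes the induction close. *)
suff H : \sum_(i < n.+1) (Num.sqrt i.+1%:R ^+ 3)^-1 <= 3 - 2 / Num.sqrt n.+1%:R :> R.
  by apply: (le_trans H); rewrite gerBl divr_ge0// sqrtr_ge0.
elim: n => [|n IH].
  by rewrite big_ord_recr big_ord0 /= add0r sqrtr1 expr1n invr1; lra.
rewrite big_ord_recr /=; apply: le_trans (lerD IH (lexx _)) _.
set a := Num.sqrt n.+1%:R; set c := Num.sqrt n.+2%:R.
have a0 : 0 < a by rewrite sqrtr_gt0 ltr0n.
have c0 : 0 < c by rewrite sqrtr_gt0 ltr0n.
have a2 : a ^+ 2 = n.+1%:R by rewrite sqr_sqrtr.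
have c2 : c ^+ 2 = a ^+ 2 + 1 by rewrite a2 natr1 sqr_sqrtr.
have ac : a <= c by rewrite ler_wsqrtr// ler_nat.
rewrite -subr_ge0 (_ : _ - _ = (2 * c ^+ 2 * (c - a) - a) / (a * c ^+ 3)); last by field; rewrite !lt0r_neq0.
rewrite divr_ge0 ?(mulr_ge0 (ltW a0) (exprn_ge0 3 (ltW c0)))//.
have ca : (c - a) * (c + a) = 1 by rewrite -subr_sqr c2; ring.
have d0 : 0 <= c - a by lra.
have : a <= c ^+ 2 * (c - a) * 2.
  have e1 : c ^+ 2 * (c - a) * (2 * c) >= c ^+ 2.
    have h1 : 1 <= (c - a) * (2 * c) by rewrite -[leLHS]ca ler_wpM2l// mulr_natl mulr2n lerD2l.
    by rewrite -mulrA -[leLHS]mulr1 ler_wpM2l ?sqr_ge0.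
  have : a * c <= c ^+ 2 by rewrite expr2 ler_wpM2r// ltW.
  move=> e2; rewrite -(ler_pM2r c0); lra.
lra.
Qed.

End elementary_sums.

(** * The critical density as a zeta series *)

Section critical_sums.
Context {R : realType} (d : nat) (beta : R).
Hypotheses (d_ge4 : (4 <= d)%N) (beta_gt0 : 0 < beta).

Let q0 : R := (Num.sqrt (4 * pi * beta))^-1 ^+ d.
Let q0_gt0 : 0 < q0.
Proof. by rewrite exprn_gt0// invr_gt0 sqrtr_gt0 !mulr_gt0 ?pi_gt0. Qed.

Lemma gauss_peak_scale (L : R) i : 0 < L ->
  gauss_peak (beta * i.+1%:R * L ^- 2) ^+ d = q0 * L ^+ d * (Num.sqrt i.+1%:R)^-1 ^+ d.
Proof.
move=> L0; rewrite /gauss_peak /q0 -!exprMn; congr (_ ^+ _).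
have -> : 4 * pi * (beta * i.+1%:R * L ^- 2) = (4 * pi * beta) * (i.+1%:R * L^-1 ^+ 2).
  by rewrite exprVn; ring.
rewrite sqrtrM; last by rewrite !mulr_ge0 ?pi_ge0// ltW.
rewrite [Num.sqrt (i.+1%:R * _)]sqrtrM// sqrtr_sqr ger0_norm ?invr_ge0 ?ltW//.
by rewrite !invfM invrK; ring.
Qed.

Lemma powRN_half (x : R) : 0 <= x -> x `^ (- (d%:R / 2)) = (Num.sqrt x)^-1 ^+ d.
Proof.
move=> x0; rewrite powRN mulrC powRrM powR12_sqrt// powR_mulrn ?sqrtr_ge0//.
by rewrite exprVn.
Qed.

Lemma inv_sqrt_pow_le i : (Num.sqrt i.+1%:R)^-1 ^+ d <= (i.+1%:R ^+ 2)^-1 :> R.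
Proof.
have s0 : 0 < Num.sqrt i.+1%:R :> R by rewrite sqrtr_gt0 ltr0n.
apply: (@le_trans _ _ ((Num.sqrt i.+1%:R)^-1 ^+ 4)).
  rewrite ler_wiXn2l// ?invr_ge0 ?(ltW s0)// invf_le1// -{1}sqrtr1 ler_wsqrtr// ler1n//.
by rewrite exprVn (exprM _ 2 2) sqr_sqrtr.
Qed.

Lemma zeta_cvg : \sum_(k < n) (Num.sqrt k.+1%:R)^-1 ^+ d @[n --> \oo] --> zeta (d%:R / 2 : R).
Proof.
rewrite /zeta.
have -> : (fun n => \sum_(k < n) (k.+1%:R : R) `^ (- (d%:R / 2))) =
    (fun n => \sum_(k < n) (Num.sqrt k.+1%:R)^-1 ^+ d).
  by apply/funext => n; apply: eq_bigr => k _; rewrite powRN_half.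
apply: nondecreasing_is_cvgn.
  apply/nondecreasing_seqP => n; rewrite big_ord_recr /= lerDl exprn_ge0// invr_ge0 sqrtr_ge0//.
exists 2 => _ [n _ <-]; apply: le_trans (sum_inv_sqr_le2 n).
by apply: ler_sum => i _; exact: inv_sqrt_pow_le.
Qed.

Lemma zeta_ge1 : 1 <= zeta (d%:R / 2 : R).
Proof.
have c1 : (fun _ : nat => 1 : R) n @[n --> \oo] --> (1 : R) by exact: cvg_cst.
have c2 : \sum_(k < n.+1) (Num.sqrt k.+1%:R)^-1 ^+ d @[n --> \oo] --> zeta (d%:R / 2 : R).
  by rewrite (cvg_shiftS (fun n => \sum_(k < n) (Num.sqrt k.+1%:R)^-1 ^+ d)); exact: zeta_cvg.
apply: cvgn_le c1 c2 _ => n; rewrite big_ord_recl /= sqrtr1 invr1 expr1n lerDl.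
by apply: sumr_ge0 => i _; rewrite exprn_ge0// invr_ge0 sqrtr_ge0.
Qed.

Lemma rho_cE : rho_c d beta = q0 * zeta (d%:R / 2).
Proof. by rewrite /rho_c powRN_half// !mulr_ge0 ?pi_ge0// ltW. Qed.

Lemma rho_c_gt0 : 0 < rho_c d beta.
Proof. by rewrite rho_cE mulr_gt0//; apply: lt_le_trans zeta_ge1. Qed.

(** At the critical density N is the full series q0 L^d sum_j j^(-d/2), so the difference is its
    tail beyond j = N, at most q0 L^d / N = q0 / rho_c. *)
Lemma critical_tail (L : R) N : 0 < L -> rho_c d beta * L ^+ d = N%:R ->
  0 <= N%:R - \sum_(i < N) gauss_peak (beta * i.+1%:R * L ^- 2) ^+ d <= q0 / rho_c d beta.
Proof.
move=> L0 E; have Ld : 0 < L ^+ d by rewrite exprn_gt0.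
have N0 : 0 < N%:R :> R by rewrite -E mulr_gt0// rho_c_gt0.
pose r i : R := (Num.sqrt i.+1%:R)^-1 ^+ d.
have rp i : 0 <= r i by rewrite exprn_ge0// invr_ge0 sqrtr_ge0.
have -> : \sum_(i < N) gauss_peak (beta * i.+1%:R * L ^- 2) ^+ d = q0 * L ^+ d * \sum_(i < N) r i.
  by rewrite mulr_sumr; apply: eq_bigr => i _; rewrite gauss_peak_scale.
have -> : N%:R = q0 * L ^+ d * zeta (d%:R / 2) by rewrite -E rho_cE; ring.
rewrite -mulrBr.
have qL : 0 < q0 * L ^+ d by rewrite mulr_gt0.
have c : \sum_(k < n) r (N + k)%N @[n --> \oo] --> zeta (d%:R / 2) - \sum_(i < N) r i.
  have := zeta_cvg; rewrite -(cvg_shiftn N) => H.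
  have -> : (fun n : nat => \sum_(k < n) r (N + k)%N) = (fun n => \sum_(k < n + N) r k - \sum_(i < N) r i).
    apply/funext => n; rewrite addnC big_split_ord /= [X in X - _]addrC addrK; exact: eq_bigr.
  by apply: cvgB => //; exact: cvg_cst.
have c0 : (fun _ : nat => 0 : R) n @[n --> \oo] --> (0 : R) by exact: cvg_cst.
have c1 : (fun _ : nat => N%:R^-1 : R) n @[n --> \oo] --> (N%:R^-1 : R) by exact: cvg_cst.
apply/andP; split.
  by rewrite pmulr_rge0//; apply: cvgn_le c0 c _ => n; exact: sumr_ge0.
rewrite -ler_pdivlMl// (_ : (q0 * L ^+ d)^-1 * (q0 / rho_c d beta) = N%:R^-1); last first.
  by rewrite -E; field; rewrite !lt0r_neq0// rho_c_gt0.
apply: cvgn_le c c1 _ => n.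
apply: (@le_trans _ _ (\sum_(i < n) ((N%:R + i.+1%:R) ^+ 2)^-1)).
  apply: ler_sum => i _; apply: le_trans (inv_sqrt_pow_le _) _.
  by rewrite -natrD addnS.
apply: le_trans (sum_inv_sqr_le n N0) _.
by rewrite gerBl invr_ge0 addr_ge0// ltW.
Qed.

End critical_sums.

(** * Mean, variance and fourth cumulant of the nonzero modes *)

Section cumulant_estimates.
Context {R : realType} (d : nat) (beta : R).
Hypotheses (d_ge4 : (4 <= d)%N) (beta_gt0 : 0 < beta).
Implicit Types (L : R) (N : nat).

Let q0 : R := (Num.sqrt (4 * pi * beta))^-1 ^+ d.
Let q0_gt0 : 0 < q0.
Proof. by rewrite exprn_gt0// invr_gt0 sqrtr_gt0 !mulr_gt0 ?pi_gt0. Qed.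

(* The rates of the nonzero modes: removing the constant eigenfunction subtracts the rates 1/j. *)
Definition excited_rate L N (i : nat) : R :=
  if (i < N)%N then (theta (beta * i.+1%:R * L ^- 2) 0 ^+ d - 1) / i.+1%:R else 0.

Let s L i : R := beta * i.+1%:R * L ^- 2.
Let y L i : R := gauss_peak (s L i) ^+ d.

Lemma scale_gt0 L i : 0 < L -> 0 < s L i.
Proof. by move=> L0; rewrite !mulr_gt0// invr_gt0 exprn_gt0. Qed.

Lemma excited_rate_ge0 L N i : 0 < L -> 0 <= excited_rate L N i.
Proof.
move=> L0; rewrite /excited_rate; case: ifP => // _.
by rewrite divr_ge0// subr_ge0 exprn_ege1// theta0_ge1// scale_gt0.
Qed.

Lemma excited_rate_eq0 L N i : (N <= i)%N -> excited_rate L N i = 0.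
Proof. by rewrite /excited_rate leqNgt; case: ltnP. Qed.

Lemma cumulant_excited L N r : cumulant (excited_rate L N) N r.+1 =
  \sum_(i < N) i.+1%:R ^+ r * (theta (s L i) 0 ^+ d - 1).
Proof.
apply: eq_bigr => i _; rewrite /excited_rate ltn_ord exprSr -/(s L i).
by rewrite -mulrA [i.+1%:R * _]mulrC divfK// pnatr_eq0.
Qed.

Lemma inv1Dscale L i : 0 < L ->
  (1 + s L i)^-1 = L ^+ 2 / beta / (L ^+ 2 / beta + i.+1%:R).
Proof.
move=> L0; have L2 : 0 < L ^+ 2 by rewrite exprn_gt0.
have i0 : 0 < i.+1%:R :> R by rewrite ltr0n.
rewrite /s; move: (i.+1%:R : R) i0 (L ^+ 2) L2 => a a0 l l0.
have h1 : 0 < l + beta * a by rewrite addr_gt0 ?mulr_gt0.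
have -> : 1 + beta * a / l = (l + beta * a) / l by field; rewrite lt0r_neq0.
have -> : l / beta + a = (l + beta * a) / beta by field; rewrite lt0r_neq0.
by rewrite !invf_div mulrA divfK// lt0r_neq0.
Qed.

(** Two errors: the zeta tail, which is O(1), and the sum of C / (1 + s_j)^2 over j, which
    telescoping bounds by C L^2 / beta. *)
Lemma mean_excited : exists2 C : R, 0 < C & forall L N, 1 <= L ->
  rho_c d beta * L ^+ d = N%:R ->
  `|N%:R - cumulant (excited_rate L N) N 1| <= C * L ^+ 2.
Proof.
have [C C0 H] := @theta0_pow_approx R d d_ge4.
have rho0 := rho_c_gt0 d_ge4 beta_gt0.
have qr0 : 0 < q0 / rho_c d beta by rewrite divr_gt0.
exists (C / beta + q0 / rho_c d beta); first by rewrite addr_gt0 ?divr_gt0.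
move=> L N L1 E; have L0 : 0 < L by lra.
have /andP[t0 t1] := critical_tail d_ge4 beta_gt0 L0 E.
have L2 : 1 <= L ^+ 2 by rewrite exprn_ege1.
rewrite cumulant_excited.
rewrite (_ : _ - _ = (N%:R - \sum_(i < N) y L i) - \sum_(i < N) (theta (s L i) 0 ^+ d - 1 - y L i)); last first.
  rewrite [X in _ = _ - X]sumrB opprB addrA subrK; congr (_ - _).
  by apply: eq_bigr => i _; rewrite mul1r.
apply: (le_trans (ler_normB _ _)); rewrite ger0_norm// addrC mulrDl; apply: lerD; last first.
  by apply: (le_trans t1); rewrite ler_peMr// ltW.
apply: (le_trans (ler_norm_sum _ _ _)).
pose A := L ^+ 2 / beta; have A0 : 0 < A by rewrite divr_gt0 ?exprn_gt0.
apply: (@le_trans _ _ (\sum_(i < N) C * A ^+ 2 * ((A + i.+1%:R) ^+ 2)^-1)).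
  apply: ler_sum => i _; apply: (le_trans (H _ (scale_gt0 i L0))).
  by rewrite -exprVn inv1Dscale// -/A exprMn exprVn mulrA.
rewrite -mulr_sumr; apply: (@le_trans _ _ (C * A ^+ 2 * A^-1)).
  apply: ler_wpM2l; first by apply: mulr_ge0 (ltW C0) (sqr_ge0 _).
  apply: le_trans (sum_inv_sqr_le N A0) _.
  by rewrite gerBl invr_ge0 addr_ge0// ltW.
by rewrite expr2 mulrA mulfK ?lt0r_neq0// /A mulrA mulrAC.
Qed.

Definition variance_scale L : R := if d == 4%N then L ^+ 4 * ln L else L ^+ d.

(** For d = 4 the gain over L^4 is only ln L, hence a threshold exponential in B. *)
Lemma variance_scale_ge B : exists2 L0 : R, expR 1 <= L0 & forall L, L0 <= L ->
  B * L ^+ 4 <= variance_scale L.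
Proof.
exists (expR (Num.max 1 B)); first by rewrite ler_expR le_max lexx.
move=> L L0; have L1 : 0 < L by apply: lt_le_trans L0; exact: expR_gt0.
have Bl : B <= ln L.
  rewrite -(expRK B) ler_ln ?posrE ?expR_gt0//; apply: le_trans L0.
  by rewrite ler_expR le_max lexx orbT.
have L4 : 0 <= L ^+ 4 by rewrite exprn_ge0// ltW.
rewrite /variance_scale; case: eqP => [_|d4]; first by rewrite mulrC ler_wpM2l.
have BL : B <= L by apply: (le_trans Bl); have := ln_le_subr1 L1; lra.
have L1' : 1 <= L.
  have h : expR 0 <= expR (Num.max 1 B) by rewrite ler_expR le_max ler01.
  by rewrite expR0 in h; exact: le_trans h L0.
apply: (@le_trans _ _ (L ^+ 5)); first by rewrite exprS ler_wpM2r.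
by rewrite ler_weXn2l//; lia.
Qed.

Lemma critical_decayE L : 1 <= L -> critical_decay d L = L ^- d * Num.sqrt (variance_scale L).
Proof.
move=> L1; have L0 : 0 < L by lra.
rewrite /critical_decay /variance_scale; case: eqP => [->|_].
  rewrite sqrtrM ?exprn_ge0 ?(ltW L0)// (exprM _ 2 2) sqrtr_sqr ger0_norm ?sqr_ge0//.
  by rewrite mulrA; congr (_ * _); field; exact: lt0r_neq0.
rewrite (powRN_half d (ltW L0)) exprVn.
have -> : Num.sqrt (L ^+ d) = Num.sqrt L ^+ d.
  rewrite -[LHS]ger0_norm ?sqrtr_ge0// -{1}(sqr_sqrtr (ltW L0)) -exprM mulnC exprM sqrtr_sqr.
  by rewrite normr_id ger0_norm// exprn_ge0// sqrtr_ge0.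
have sL : Num.sqrt L != 0 by rewrite lt0r_neq0// sqrtr_gt0.
rewrite -{2}(sqr_sqrtr (ltW L0)) -exprM mulnC exprM expr2 invfM -mulrA mulVf ?mulr1//.
by rewrite expf_neq0.
Qed.

(** With A = L^2 / beta, for d = 4 the terms are q0 L^4 A / (j (A + j)): the damping cuts the
    harmonic sum at j ~ L^2 and produces the logarithm. For d >= 5 the series sum j^(1 - d/2) is at
    most sum j^(-3/2) and needs no damping. *)
Lemma weighted_peak_sum_le : exists2 L0 : R, 1 <= L0 & forall L N, L0 <= L ->
  \sum_(i < N) i.+1%:R * y L i / (1 + s L i) <= 4 * q0 * variance_scale L.
Proof.
(* Ensures 1 <= ln L and A + 1 <= L^3, so that 1 + ln (A + 1) <= 4 ln L. *)
exists (Num.max (expR 1) (beta^-1 + 1)); first by rewrite le_max -{1}expR0 ler_expR ler01.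
move=> L N; rewrite ge_max => /andP[Le Lb].
have L0 : 0 < L by apply: lt_le_trans Le; exact: expR_gt0.
have lnL : 1 <= ln L by rewrite -(expRK 1) ler_ln ?posrE ?expR_gt0.
have L1 : 1 <= L by apply: le_trans Le; rewrite -{1}expR0 ler_expR.
pose A := L ^+ 2 / beta; have A0 : 0 < A by rewrite divr_gt0 ?exprn_gt0.
have Ld : 0 < L ^+ d by rewrite exprn_gt0.
have term i : i.+1%:R * y L i / (1 + s L i) =
    q0 * L ^+ d * (i.+1%:R * (Num.sqrt i.+1%:R)^-1 ^+ d * (A / (A + i.+1%:R))).
  by rewrite inv1Dscale// /y gauss_peak_scale// -/q0 -/A; ring.
under eq_bigr do rewrite term.
rewrite -mulr_sumr /variance_scale.
have qL : 0 <= q0 * L ^+ d by rewrite mulr_ge0 ?ltW.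
have sq (i : nat) : Num.sqrt i.+1%:R ^+ 2 = i.+1%:R :> R by rewrite sqr_sqrtr.
have sp (i : nat) : 0 < Num.sqrt i.+1%:R :> R by rewrite sqrtr_gt0 ltr0n.
case: eqP => [d4|d4].
  rewrite (_ : 4 * q0 * _ = q0 * L ^+ d * (4 * ln L)); last by rewrite d4; ring.
  apply: ler_wpM2l => //.
  apply: (@le_trans _ _ (1 + ln (A + 1))).
    apply: le_trans (sum_log_le N A0); apply: ler_sum => i _.
    rewrite d4 exprVn (exprM _ 2 2) sq.
    have i0 : i.+1%:R != 0 :> R by rewrite pnatr_eq0.
    have Ai : A + i.+1%:R != 0 by rewrite lt0r_neq0// addr_gt0.
    rewrite le_eqVlt; apply/orP; left; apply/eqP.
    by move: (i.+1%:R : R) i0 Ai; move: (A) => A' a a0 h; field; rewrite a0 h.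
  have A1 : A + 1 <= L ^+ 3.
    have L2 : 1 <= L ^+ 2 by rewrite exprn_ege1.
    rewrite exprSr; apply: (@le_trans _ _ (L ^+ 2 * (beta^-1 + 1))).
      by rewrite mulrDr mulr1 lerD2l.
    by rewrite ler_wpM2l// ltW// exprn_gt0.
  have : ln (A + 1) <= ln (L ^+ 3) by rewrite ler_ln ?posrE ?exprn_gt0//; lra.
  rewrite lnXn// -mulr_natr => h.
  by apply: le_trans (lerD lnL h) _; lra.
rewrite (_ : 4 * q0 * _ = q0 * L ^+ d * 4); last by ring.
apply: ler_wpM2l => //.
apply: (@le_trans _ _ 3); last by lra.
apply: le_trans (sum_inv_sqrt_cube_le N); apply: ler_sum => i _.
apply: (@le_trans _ _ (i.+1%:R * (Num.sqrt i.+1%:R)^-1 ^+ d)).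
  rewrite ler_piMr ?mulr_ge0 ?exprn_ge0 ?invr_ge0 ?sqrtr_ge0//.
  by rewrite ler_pdivrMr ?addr_gt0// mul1r lerDl.
apply: (@le_trans _ _ (i.+1%:R * (Num.sqrt i.+1%:R)^-1 ^+ 5)).
  rewrite ler_wpM2l// ler_wiXn2l ?invr_ge0 ?sqrtr_ge0//; last by lia.
  by rewrite invf_le1// -{1}sqrtr1 ler_wsqrtr// ler1n.
rewrite -{1}sq exprVn le_eqVlt; apply/orP; left; apply/eqP.
by field; rewrite lt0r_neq0.
Qed.

Lemma scale_frac_le L i : 0 < L -> i.+1%:R / (1 + s L i) <= L ^+ 2 / beta.
Proof.
move=> L0; rewrite inv1Dscale//; set A := L ^+ 2 / beta.
have A0 : 0 < A by rewrite divr_gt0 ?exprn_gt0.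
by rewrite mulrCA ler_piMr ?(ltW A0)// ler_pdivrMr ?addr_gt0// mul1r lerDr ltW.
Qed.

(** One factor 1 / (1 + s) is kept for [weighted_peak_sum_le]. In the fourth cumulant the other two
    pair with j^2, and j / (1 + s) <= L^2 / beta supplies the factor L^4. *)
Lemma cumulants_excited_le : exists2 C : R, 0 < C & exists2 L0 : R, 1 <= L0 &
  forall L N, L0 <= L -> cumulant (excited_rate L N) N 2 <= C * variance_scale L /\
    cumulant (excited_rate L N) N 4 <= C * L ^+ 4 * variance_scale L.
Proof.
have [C C0 H] := @theta0_pow_le R d; have [L0 L01 HV] := weighted_peak_sum_le.
have C4 : 0 < C * (4 * q0) by rewrite !mulr_gt0.
have b2 : 0 < beta ^- 2 by rewrite invr_gt0 exprn_gt0.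
exists (C * (4 * q0) * (1 + beta ^- 2)); first by rewrite mulr_gt0// addr_gt0.
exists L0 => // L N L0L; have Lp : 0 < L by lra.
have V := HV L N L0L; have L4 : 0 < L ^+ 4 by rewrite exprn_gt0.
pose g i : R := i.+1%:R * y L i / (1 + s L i).
have y0 i : 0 <= y L i by rewrite exprn_ge0// ltW// gauss_peak_gt0// scale_gt0.
have s1 i : 1 <= 1 + s L i by rewrite lerDl ltW// scale_gt0.
have s0 i : 0 < 1 + s L i by rewrite (lt_le_trans ltr01).
have g0 i : 0 <= g i by rewrite /g divr_ge0 ?mulr_ge0// ltW.
have vs0 : 0 <= variance_scale L.
  have S0 : 0 <= \sum_(i < N) g i by apply: sumr_ge0 => i _; exact: g0.
  by have := le_trans S0 V; rewrite pmulr_rge0// mulr_gt0.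
have main r (K : R) : (forall i, i.+1%:R ^+ r / (1 + s L i) ^+ 3 <= K * (i.+1%:R / (1 + s L i))) -> 0 <= K ->
    cumulant (excited_rate L N) N r.+1 <= K * (C * (4 * q0) * variance_scale L).
  move=> Hr K0; rewrite cumulant_excited.
  apply: (@le_trans _ _ (\sum_(i < N) K * C * g i)).
    apply: ler_sum => i _; apply: (@le_trans _ _ (i.+1%:R ^+ r * (C * y L i / (1 + s L i) ^+ 3))).
      by rewrite ler_wpM2l ?exprn_ge0// H// scale_gt0.
    have := ler_wpM2r (mulr_ge0 (ltW C0) (y0 i)) (Hr i).
    rewrite /g; move: (y L i) (1 + s L i) (i.+1%:R : R) => yy b n; move: (n ^+ r) => a.
    rewrite (_ : a * (C * yy / b ^+ 3) = a / b ^+ 3 * (C * yy)); last by ring.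
    by rewrite (_ : K * C * (n * yy / b) = K * (n / b) * (C * yy)); last by ring.
  rewrite -mulr_sumr -!mulrA ler_wpM2l// ler_pM2l// mulrA; exact: V.
have E : 0 <= C * (4 * q0) * variance_scale L by rewrite mulr_ge0// ltW.
split.
  apply: (@le_trans _ _ (1 * (C * (4 * q0) * variance_scale L))).
    apply: main => // i; rewrite mul1r expr1 ler_wpM2l// lef_pV2 ?posrE ?exprn_gt0//.
    by rewrite -{1}[1 + _]expr1 ler_weXn2l.
  rewrite mul1r [leRHS](_ : _ = C * (4 * q0) * variance_scale L * (1 + beta ^- 2)); last by ring.
  rewrite ler_peMr//.
  by rewrite lerDl ltW.
apply: (@le_trans _ _ ((L ^+ 2 / beta) ^+ 2 * (C * (4 * q0) * variance_scale L))).
  apply: main; last by rewrite sqr_ge0.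
  move=> i; have h := scale_frac_le i Lp.
  have f0 : 0 <= i.+1%:R / (1 + s L i) by rewrite divr_ge0// ltW.
  rewrite (_ : _ / _ = (i.+1%:R / (1 + s L i)) ^+ 2 * (i.+1%:R / (1 + s L i))); last first.
    by rewrite -exprSr exprMn exprVn.
  by rewrite ler_wpM2r// lerXn2r ?nnegrE//; apply: le_trans h.
have -> : (L ^+ 2 / beta) ^+ 2 = L ^+ 4 * beta ^- 2 by rewrite exprMn exprVn -exprM.
have -> : C * (4 * q0) * (1 + beta ^- 2) * L ^+ 4 * variance_scale L =
    L ^+ 4 * (1 + beta ^- 2) * (C * (4 * q0) * variance_scale L) by ring.
by rewrite ler_wpM2r// ler_wpM2l ?(ltW L4)// lerDr.
Qed.

(** For d >= 5 the term j = 1 alone has order L^d. For d = 4 the terms up to n0 ~ L^2 / (16 pi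
    beta), where [theta0_pow_ge] applies, add up to L^4 times a harmonic sum of size at least ln
    L. *)
Lemma variance_excited_ge : exists2 c : R, 0 < c & exists2 L0 : R, 1 <= L0 &
  forall L N, L0 <= L -> rho_c d beta * L ^+ d = N%:R ->
    c * variance_scale L <= cumulant (excited_rate L N) N 2.
Proof.
have rho0 := rho_c_gt0 d_ge4 beta_gt0.
have p0 : 0 < 16 * pi * beta by rewrite !mulr_gt0 ?pi_gt0.
exists (q0 / 2); first by rewrite divr_gt0.
(* The second bound gives L <= L^2 / (16 pi beta), the third makes the cut n0 at most N when d =
   4. *)
exists (Num.max 1 (Num.max (16 * pi * beta) (16 * pi * beta * rho_c d beta)^-1)); first by rewrite le_max lexx.
move=> L N; rewrite !ge_max => /and3P[L1 La Lb] E.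
have L0 : 0 < L by lra.
have Ld : 0 < L ^+ d by rewrite exprn_gt0.
have L2 : 0 < L ^+ 2 by rewrite exprn_gt0.
have N0 : (0 < N)%N by rewrite -(ltr0n R) -E mulr_gt0.
rewrite cumulant_excited; under eq_bigr do rewrite expr1.
have pos i : 0 <= i.+1%:R * (theta (s L i) 0 ^+ d - 1).
  by rewrite mulr_ge0// subr_ge0 exprn_ege1// theta0_ge1// scale_gt0.
have low i : 16 * pi * s L i <= 1 -> i.+1%:R * (y L i / 2) <= i.+1%:R * (theta (s L i) 0 ^+ d - 1).
  by move=> h; rewrite ler_wpM2l// theta0_pow_ge// scale_gt0.
have yE i : y L i = q0 * L ^+ d * (Num.sqrt i.+1%:R)^-1 ^+ d by rewrite /y gauss_peak_scale.
have LL : L <= L ^+ 2 by rewrite expr2 ler_peMl// ltW.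
rewrite /variance_scale; case: eqP => [d4|_]; last first.
  case: N N0 E => // N _ _; rewrite big_ord_recl /=.
  apply: (@le_trans _ _ (1 * (y L 0 / 2))).
    by rewrite yE sqrtr1 invr1 expr1n; lra.
  apply: le_trans (low 0%N _) _.
    by rewrite /s mulr1 mulrA ler_pdivrMr// mul1r; apply: le_trans LL.
  by rewrite lerDl sumr_ge0.
pose x := L ^+ 2 / (16 * pi * beta); pose n0 := Num.truncn x.
have x0 : 0 <= x by rewrite divr_ge0 ?ltW.
have /andP[n0x xn0] := truncn_itv x0.
have Lx : L <= x by rewrite /x ler_pdivlMr// expr2 ler_wpM2l// ltW.
have n0N : (n0 <= N)%N.
  rewrite -(ler_nat R); apply: (le_trans n0x); rewrite -E d4 /x ler_pdivrMr//.
  have r4 : 0 < rho_c 4 beta by move: rho0; rewrite d4.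
  have r0 : 0 < 16 * pi * beta * rho_c 4 beta by rewrite mulr_gt0.
  have h : 1 <= 16 * pi * beta * rho_c 4 beta * L.
    by move: Lb; rewrite d4 -[_^-1]mulr1 ler_pdivrMl.
  rewrite (_ : rho_c 4 beta * L ^+ 4 * _ = 16 * pi * beta * rho_c 4 beta * L * L * L ^+ 2); last by ring.
  by rewrite ler_peMl ?(ltW L2)// mulr_ege1.
apply: (@le_trans _ _ (\sum_(i < n0) i.+1%:R * (theta (s L i) 0 ^+ d - 1))); last first.
  rewrite (big_ord_widen N (fun i => i.+1%:R * (theta (s L i) 0 ^+ d - 1)) n0N) big_mkcond /=.
  by apply: ler_sum => i _; case: ifP.
apply: (@le_trans _ _ (\sum_(i < n0) q0 / 2 * L ^+ 4 * i.+1%:R^-1)); last first.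
  apply: ler_sum => i _; apply: le_trans (low i _).
    have s4 : Num.sqrt i.+1%:R ^+ 4 = i.+1%:R ^+ 2 :> R by rewrite (exprM _ 2 2) sqr_sqrtr.
    rewrite yE d4 exprVn s4 le_eqVlt; apply/orP; left; apply/eqP.
    have i0 : i.+1%:R != 0 :> R by rewrite pnatr_eq0.
    by move: (i.+1%:R : R) i0 => a a0; field.
  rewrite /s !mulrA ler_pdivrMr// mul1r -ler_pdivlMl// mulrC -/x.
  by apply: le_trans n0x; rewrite ler_nat.
rewrite -mulr_sumr mulrA; apply: ler_wpM2l.
  by rewrite mulr_ge0 ?exprn_ge0 ?(ltW L0)// divr_ge0// ltW.
apply: le_trans (harmonic_ge n0); rewrite ler_ln ?posrE//.
by apply: (le_trans Lx); apply: ltW.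
Qed.

End cumulant_estimates.

(** * Partition function and density matrix *)

Section conclusion.
Context {R : realType} (d : nat) (beta : R).
Hypotheses (d_ge4 : (4 <= d)%N) (beta_gt0 : 0 < beta).

Let rate (L : R) N := excited_rate d beta L N.
Let F (L : R) N m : R := compound_cdf (rate L N) N m.

(** The summand L^2 / beta in the second estimate is the loss that the lower bound on the density
    matrix will subtract. *)
Lemma compound_cdf_estimates : exists2 c : R, 0 < c & exists2 C : R, 0 < C &
  exists2 L0 : R, 1 <= L0 & forall (L : R) N, L0 <= L -> rho_c d beta * L ^+ d = N%:R ->
  [/\ c <= F L N N,
      c * Num.sqrt (variance_scale d L) + L ^+ 2 / beta <= \sum_(m < N) F L N m &
      \sum_(m < N) F L N m <= C * Num.sqrt (variance_scale d L)].
Proof.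
have [Cm Cm0 Hm] := mean_excited d_ge4 beta_gt0.
have [Cu Cu0 [L1 L11 Hu]] := cumulants_excited_le d_ge4 beta_gt0.
have [c0 c00 [L2 L21 Hv]] := variance_excited_ge d_ge4 beta_gt0.
pose K := Cu / c0 ^+ 2; have K0 : 0 <= K by rewrite divr_ge0 ?sqr_ge0// ltW.
pose lam := Num.sqrt ((3 + K) / 2); have lam0 : 0 < lam by rewrite sqrtr_gt0; lra.
pose g := Num.sqrt c0 / (4 * lam).
have g0 : 0 < g by rewrite divr_gt0 ?sqrtr_gt0// mulr_gt0.
(* All errors of order L^2: [Cm] for the mean, [beta^-1] for the discarded short loops, 1 for
   passing from N to N + 1. *)
pose w := Cm + beta^-1 + 1.
have ib : 0 < beta^-1 by rewrite invr_gt0.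
have w0 : 0 < w by rewrite /w; lra.
(* Beyond this threshold w L^2 <= (g / 2) sqrt V, so half of the lower bound g sqrt V survives all
   errors. *)
have [L3 L3e HB] := variance_scale_ge d_ge4 beta_gt0 ((2 * w / g) ^+ 2).
have [L4 L4e HB1] := variance_scale_ge d_ge4 beta_gt0 1.
pose D := Cu + (g / 2) ^+ 2.
have D0 : 0 < D by rewrite addr_gt0// exprn_gt0// divr_gt0.
(* From [compound_cdf_ge], with A >= (g / 2) sqrt V and Q <= D V. There the sum includes m = N,
   hence the bounds at N + 1. *)
pose cF := 3 / 4 * (g / 2) ^+ 2 / D.
have g2 : 0 < (g / 2) ^+ 2 by rewrite exprn_gt0// divr_gt0.
have cF0 : 0 < cF by rewrite /cF divr_gt0// mulr_gt0//; lra.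
exists (Num.min cF (g / 2)); first by rewrite lt_min cF0 divr_gt0.
exists (g / 2 + Num.sqrt Cu); first by rewrite addr_gt0 ?sqrtr_gt0// divr_gt0.
exists (Num.max L1 (Num.max L2 (Num.max L3 L4))); first by rewrite le_max L11.
move=> L N; rewrite !ge_max => /and4P[LL1 LL2 LL3 LL4] E.
have Lge1 : 1 <= L by lra.
have L0 : 0 < L by lra.
have L2p : 1 <= L ^+ 2 by rewrite exprn_ege1.
have Lq : 0 < L ^+ 4 by rewrite exprn_gt0.
have [hu2 hu4] := Hu L N LL1; have hv := Hv L N LL2 E; have hm := Hm L N Lge1 E.
have hB := HB L LL3; have hB1 := HB1 L LL4; rewrite mul1r in hB1.
set V := variance_scale d L in hu2 hu4 hv hB hB1 *.
have V0 : 0 < V by lra.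
pose S := Num.sqrt V; have S0 : 0 < S by rewrite sqrtr_gt0.
have SS : S ^+ 2 = V by rewrite sqr_sqrtr// ltW.
have b_ge0 i := excited_rate_ge0 d beta_gt0 N i L0.
have b_eq0 i (Ni : (N <= i)%N) := excited_rate_eq0 d beta L Ni.
set k2 := cumulant _ _ 2 in hu2 hv; set k4 := cumulant _ _ 4 in hu4.
set k1 := cumulant _ _ 1 in hm.
have k20 : 0 < k2 by apply: lt_le_trans hv; rewrite mulr_gt0.
have k4K : k4 <= K * k2 ^+ 2.
  apply: (le_trans hu4); apply: (@le_trans _ _ (K * (c0 * V) ^+ 2)).
    rewrite /K (_ : Cu / c0 ^+ 2 * (c0 * V) ^+ 2 = Cu * V * V).
      by rewrite ler_wpM2r ?(ltW V0)// ler_wpM2l// ltW.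
    by move: (V) => v; field; exact: lt0r_neq0.
  by rewrite ler_wpM2l// lerXn2r ?nnegrE ?mulr_ge0 ?(ltW c00) ?(ltW V0) ?(ltW k20).
have wS : w * L ^+ 2 <= g / 2 * S.
  have q0 : 0 <= 2 * w / g * L ^+ 2 by rewrite mulr_ge0 ?sqr_ge0// divr_ge0 ?(ltW g0)// mulr_ge0// ltW.
  have : 2 * w / g * L ^+ 2 <= S.
    rewrite -[leLHS]ger0_norm// -sqrtr_sqr ler_wsqrtr//.
    by apply: le_trans hB; rewrite exprMn -exprM.
  have -> : w * L ^+ 2 = g / 2 * (2 * w / g * L ^+ 2) by field; exact: lt0r_neq0.
  by move=> h; rewrite ler_pM2l// divr_gt0.
have sqlow : g * S <= Num.sqrt k2 / (4 * lam).
  rewrite /g mulrAC ler_wpM2r ?invr_ge0 ?mulr_ge0 ?(ltW lam0)//.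
  by rewrite -sqrtrM ?(ltW c00)// ler_wsqrtr.
have squp : Num.sqrt k2 <= Num.sqrt Cu * S by rewrite -sqrtrM ?(ltW Cu0)// ler_wsqrtr.
have low := sum_compound_cdf_ge b_ge0 b_eq0 _ k20 K0 k4K.
have low1 := low N; have low2 := low N.+1.
have up := sum_compound_cdf_le b_ge0 b_eq0 N k20.
rewrite -/lam -/k1 in low1 low2; rewrite -/k1 -/k2 in up.
have bL : 0 < L ^+ 2 / beta by rewrite divr_gt0//; lra.
have ww : w * L ^+ 2 = Cm * L ^+ 2 + L ^+ 2 / beta + L ^+ 2 by rewrite /w; ring.
have CmL : 0 < Cm * L ^+ 2 by rewrite mulr_gt0//; lra.
have hm' : `|N.+1%:R - k1| <= Cm * L ^+ 2 + L ^+ 2.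
  rewrite -natr1 addrAC; apply: (le_trans (ler_normD _ _)); rewrite normr1; exact: lerD.
split.
- rewrite ge_min; apply/orP; left.
  set A := \sum_(m < N.+1) _ in low2.
  have Age : g / 2 * S <= A by lra.
  have gS : 0 < g / 2 * S by rewrite mulr_gt0// divr_gt0.
  have A0 : 0 < A by lra.
  have := compound_cdf_ge b_ge0 b_eq0 A0; rewrite -/A -/k1 -/k2 => h.
  set f := compound_cdf _ _ _ in h; rewrite /F /rate -/f.
  have f0 : 0 <= f by exact: compound_cdf_ge0.
  have Q : k2 + (N.+1%:R - k1) ^+ 2 <= D * V.
    rewrite /D mulrDl; apply: lerD => //; rewrite -SS -exprMn -real_normK ?num_real//.
    by rewrite lerXn2r ?nnegrE ?(ltW gS)//; lra.
  rewrite /cF ler_pdivrMr// -(ler_pM2r V0) -[leRHS]mulrA.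
  apply: (@le_trans _ _ (3 / 4 * A ^+ 2)).
    rewrite -[leLHS]mulrA; apply: ler_wpM2l; first by rewrite divr_ge0.
    by rewrite -SS -exprMn lerXn2r ?nnegrE ?(ltW gS) ?(ltW A0).
  by apply: (le_trans h); rewrite ler_wpM2l.
- apply: (@le_trans _ _ (g / 2 * S + L ^+ 2 / beta)).
    by rewrite lerD2r ler_wpM2r ?(ltW S0)// ge_min lexx orbT.
  by rewrite /F /rate; move: low1; set A := \sum_(m < N) _; lra.
- by rewrite /F /rate -/S mulrDl; move: up; set A := \sum_(m < N) _; lra.
Qed.

(** * The loop soup at the critical density *)

Section soup_at_criticality.
Context (S : torus_spectrum R d) (L : {posnum R}) (N : nat).
Hypothesis critical : rho_c d beta * L%:num ^+ d = N%:R.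

Let d_gt0 : (0 < d)%N.
Proof. exact: leq_trans d_ge4. Qed.

Lemma particle_prob_cdf (X : loop_soup S L beta N) m : (m <= N)%N ->
  particle_prob X m = expR (- \sum_(i < N) i.+1%:R^-1) * F L%:num N m.
Proof.
move=> mN; rewrite particle_probE//.
have rE i : (i < N)%N -> loop_rate (d := d) L beta i = rate L%:num N i + i.+1%:R^-1.
  by move=> iN; rewrite /loop_rate /rate /excited_rate iN mulrBl mul1r subrK.
rewrite (compound_weight_harmonic rE mN) (eq_bigr _ (fun (i : 'I_N) _ => rE i (ltn_ord i))).
rewrite big_split /= opprD expRD mulrAC mulrC; congr (_ * _).
by rewrite /F /compound_cdf mulr_sumr.
Qed.

Lemma critical_number_gt0 : (0 < N)%N.
Proof. by rewrite -(ltr0n R) -critical mulr_gt0 ?rho_c_gt0// exprn_gt0. Qed.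

Lemma exp_harmonic_bounds :
  expR (- 1) / (rho_c d beta * L%:num ^+ d) <= expR (- \sum_(i < N) i.+1%:R^-1) <=
    (rho_c d beta * L%:num ^+ d)^-1.
Proof.
rewrite critical; have := critical_number_gt0; case: (N) => // n _.
have n0 : 0 < n.+1%:R :> R by rewrite ltr0n.
apply/andP; split.
  rewrite -{1}[n.+1%:R]lnK ?posrE// -expRN -expRD ler_expR -opprD lerN2.
  exact: harmonic_le.
rewrite -[leRHS]lnK ?posrE ?invr_gt0// lnV ?posrE// ler_expR lerN2.
by apply: le_trans (harmonic_ge _); rewrite ler_ln ?posrE// ler_nat.
Qed.

(** For small L the asymptotic estimates say nothing, but Y = 0 already has enough probability:
    there are at most rho_c L0^d rates, and all times are at least beta / L0^2, so each rate is
    bounded. *)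
Lemma compound_cdf_ge_bounded (L0 : R) : L%:num <= L0 ->
  expR (- (rho_c d beta * L0 ^+ d * (1 + (4 * (beta / L0 ^+ 2))^-1) ^+ d)) <= F L%:num N N.
Proof.
move=> LL0; have Lp : 0 < L%:num by [].
have L0p : 0 < L0 by apply: lt_le_trans LL0.
have s0 : 0 < beta / L0 ^+ 2 by rewrite divr_gt0 ?exprn_gt0.
apply: le_trans (compound_cdf_ge_exp N (fun i => excited_rate_ge0 d beta_gt0 N i Lp) N).
rewrite ler_expR lerN2.
set T := (1 + _) ^+ d.
have T0 : 0 <= T by rewrite exprn_ge0// addr_ge0// invr_ge0 mulr_ge0// ltW.
apply: (@le_trans _ _ (N%:R * T)).
  have -> : N%:R * T = \sum_(i < N) T by rewrite sumr_const card_ord mulr_natl.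
  apply: ler_sum => i _; rewrite /excited_rate ltn_ord.
  have i1 : 1 <= i.+1%:R :> R by rewrite ler1n.
  have sp := @scale_gt0 R beta beta_gt0 L%:num i Lp.
  have t1 := @theta0_ge1 R _ sp.
  apply: (@le_trans _ _ (theta (beta * i.+1%:R * L%:num ^- 2) 0 ^+ d)).
    rewrite ler_pdivrMr ?(lt_le_trans ltr01)//.
    apply: (@le_trans _ _ (theta (beta * i.+1%:R * L%:num ^- 2) 0 ^+ d * 1)).
      by rewrite mulr1 gerBl.
    by rewrite ler_wpM2l// exprn_ge0// (le_trans ler01).
  rewrite lerXn2r ?nnegrE ?(le_trans ler01 t1)//.
    by rewrite addr_ge0// invr_ge0 mulr_ge0// ltW.
  apply: (le_trans (theta0_le sp)); rewrite lerD2l lef_pV2 ?posrE ?mulr_gt0//; last first.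
    by rewrite invr_gt0 exprn_gt0.
  rewrite ler_pM2l// ler_pM ?invr_ge0 ?exprn_ge0 ?(ltW L0p) ?(ltW beta_gt0)//.
    by rewrite ler_peMr// ltW.
  by rewrite lef_pV2 ?posrE ?exprn_gt0// lerXn2r ?nnegrE ?(ltW L0p).
rewrite ler_wpM2r// -critical ler_wpM2l ?(ltW (rho_c_gt0 d_ge4 beta_gt0))//.
by rewrite lerXn2r ?nnegrE ?(ltW L0p).
Qed.

(** If each of the d rescaled coordinates were within eps / d of an integer, a lattice translate
    would have norm at most eps L / sqrt d. *)
Lemma torus_dist_far (x y : 'rV[R]_d) (eps : R) : 0 < eps -> eps * L%:num < torus_dist L x y ->
  exists i, forall k : int, eps / d%:R <= `|(x 0 i - y 0 i) / L%:num + k%:~R|.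
Proof.
move=> eps0 far; apply: contrapT => /forallNP H.
have dp : 0 < d%:R :> R by rewrite ltr0n.
have {}H (i : 'I_d) : exists k : int, `|(x 0 i - y 0 i) / L%:num + k%:~R| < eps / d%:R.
  by have /existsNP[k /negP] := H i; rewrite -ltNge; exists k.
have [k Hk] := choice H.
move: far; apply/negP; rewrite -leNgt.
apply: (@le_trans _ _ (enorm (x - y - L%:num *: map_mx intr (\row_i (- k i))))).
  apply: ge_inf; first by exists 0 => _ [l _ <-]; exact: sqrtr_ge0.
  by exists (\row_i (- k i)).
have e0 : 0 <= eps * L%:num by rewrite mulr_ge0// ltW.
rewrite -[leRHS]ger0_norm// -sqrtr_sqr ler_wsqrtr//.
apply: (@le_trans _ _ (\sum_(i < d) (eps / d%:R * L%:num) ^+ 2)).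
  apply: ler_sum => i _; rewrite !mxE.
  have -> : x 0 i - y 0 i - L%:num * (- k i)%:~R = ((x 0 i - y 0 i) / L%:num + (k i)%:~R) * L%:num.
    by rewrite mulrNz mulrDl divfK// mulrN opprK [L%:num * _]mulrC.
  rewrite -real_normK ?num_real// normrM [X in _ * X]ger0_norm//.
  by rewrite lerXn2r ?nnegrE ?mulr_ge0 ?normr_ge0 ?invr_ge0 ?(ltW eps0) ?ler_wpM2r ?(ltW (Hk i))//.
rewrite sumr_const card_ord [leLHS](_ : _ = (eps * L%:num) ^+ 2 / d%:R); last first.
  by rewrite -mulr_natr; field; exact: lt0r_neq0.
by rewrite ler_pdivrMr// ler_peMr ?sqr_ge0// ler1n.
Qed.

Lemma sum_lt_le (A : R) n : 0 <= A -> \sum_(i < n) (i.+1%:R < A)%R%:R <= A.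
Proof.
(* The count is also at most n, which settles the step where the new index is still below A. *)
move=> A0; suff : \sum_(i < n) (i.+1%:R < A)%R%:R <= A /\ \sum_(i < n) (i.+1%:R < A)%R%:R <= n%:R :> R by case.
elim: n => [|n [IH1 IH2]]; first by rewrite big_ord0.
rewrite !big_ord_recr /=; case: ltP => h; split.
- by apply: le_trans (ltW h); rewrite -natr1 lerD2r.
- by rewrite -[leRHS]natr1 lerD2r.
- by rewrite addr0.
- by rewrite addr0 (le_trans IH2)// ler_nat.
Qed.

Lemma density_matrixE (X : loop_soup S L beta N) (x y : 'rV[R]_d) : density_matrix X x y =
  (\sum_(i < N) L%:num ^- d * (\prod_j theta (beta * i.+1%:R * L%:num ^- 2) ((x 0 j - y 0 j) / L%:num)) *
     F L%:num N (N - i.+1)) / F L%:num N N.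
Proof.
rewrite /density_matrix big_add1 /= big_mkord mulr_suml; apply: eq_bigr => i _.
rewrite !particle_prob_cdf ?leq_subr// heat_kernel_theta//; last by rewrite mulr_gt0.
by rewrite [_ * (expR _ * _)]mulrCA -mulf_div divff ?mul1r// lt0r_neq0// expR_gt0.
Qed.

(** For the lower bound only the r with beta r >= L^2 are kept, where the theta product is at least
    2^-d; fewer than L^2 / beta indices are dropped, each worth at most 1, and dividing by P(Y <= N)
    <= 1 only helps. *)
Lemma density_matrix_bounds (X : loop_soup S L beta N) (x y : 'rV[R]_d) (C c : R) :
  0 < c -> c <= F L%:num N N -> 0 <= C ->
  (forall i, \prod_j theta (beta * i.+1%:R * L%:num ^- 2) ((x 0 j - y 0 j) / L%:num) <= C) ->
  2 ^- d * L%:num ^- d * (\sum_(m < N) F L%:num N m - L%:num ^+ 2 / beta) <= density_matrix X x y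
    <= C / c * L%:num ^- d * \sum_(m < N) F L%:num N m.
Proof.
move=> c0 cF C0 pC; rewrite density_matrixE; have Lp : 0 < L%:num by [].
have b_ge0 i := excited_rate_ge0 d beta_gt0 N i Lp.
have b_eq0 i (Ni : (N <= i)%N) := excited_rate_eq0 d beta L%:num Ni.
have F0 m : 0 <= F L%:num N m by exact: compound_cdf_ge0.
have F1 m : F L%:num N m <= 1 by exact: compound_cdf_le1.
have FN : 0 < F L%:num N N by apply: lt_le_trans cF.
have Ld : 0 <= L%:num ^- d by rewrite invr_ge0 exprn_ge0.
have FE : \sum_(m < N) F L%:num N m = \sum_(i < N) F L%:num N (N - i.+1) by rewrite (reindex_inj rev_ord_inj).
have p0 i : 0 <= \prod_j theta (beta * i.+1%:R * L%:num ^- 2) ((x 0 j - y 0 j) / L%:num).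
  by apply: prodr_ge0 => j _; apply: theta_ge0; rewrite scale_gt0.
apply/andP; split.
  apply: (@le_trans _ _ (\sum_(i < N) L%:num ^- d * (\prod_j theta (beta * i.+1%:R * L%:num ^- 2) ((x 0 j - y 0 j) / L%:num)) *
     F L%:num N (N - i.+1))); last first.
    rewrite ler_peMr// ?invf_ge1//; apply: sumr_ge0 => i _; by rewrite !mulr_ge0.
  rewrite FE; apply: (@le_trans _ _ (2 ^- d * L%:num ^- d *
      (\sum_(i < N) (F L%:num N (N - i.+1) - (i.+1%:R < L%:num ^+ 2 / beta)%R%:R)))).
    rewrite ler_wpM2l ?mulr_ge0 ?invr_ge0 ?exprn_ge0// sumrB lerD2l lerN2.
    by apply: sum_lt_le; rewrite divr_ge0 ?exprn_ge0// ltW.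
  rewrite mulr_sumr; apply: ler_sum => i _.
  rewrite [X in X * _ <= _]mulrC -[leLHS]mulrA -[leRHS]mulrA ler_wpM2l//.
  case: ltP => h /=.
    apply: (@le_trans _ _ 0); last by rewrite mulr_ge0.
    by rewrite mulr_ge0_le0 ?invr_ge0 ?exprn_ge0// subr_le0.
  rewrite subr0 ler_wpM2r// theta_prod_ge//.
  by move: h; rewrite ler_pdivrMr// [_ * beta]mulrC ler_pdivlMr ?exprn_gt0// mul1r.
rewrite ler_pdivrMr// FE.
apply: (@le_trans _ _ (\sum_(i < N) C * L%:num ^- d * F L%:num N (N - i.+1))).
  by apply: ler_sum => i _; rewrite ler_wpM2r// mulrC ler_wpM2r.
rewrite -mulr_sumr; set s := \sum_(i < N) _; have s0 : 0 <= s by apply: sumr_ge0.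
rewrite (_ : C / c * _ * s * _ = C * L%:num ^- d * s * (F L%:num N N / c)); last by ring.
by rewrite ler_peMr ?mulr_ge0// ler_pdivlMr// mul1r.
Qed.

End soup_at_criticality.

End conclusion.

Theorem theorem5 (R : realType) (d : nat) (beta : R) (S : torus_spectrum R d) :
  (4 <= d)%N -> 0 < beta ->
  (exists2 C : R, 0 < C &
     forall (L : {posnum R}) (N : nat) (X : loop_soup S L beta N),
       rho_c d beta * L%:num ^+ d = N%:R ->
       C^-1 * L%:num ^- d <= particle_prob X N <= C * L%:num ^- d) /\
  (forall eps : R, 0 < eps ->
     exists2 C : R, 0 < C &
     exists L0 : R,
     forall (L : {posnum R}) (N : nat) (X : loop_soup S L beta N)
            (x y : 'rV[R]_d),
       L0 <= L%:num -> rho_c d beta * L%:num ^+ d = N%:R ->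
       torus L x -> torus L y -> eps * L%:num < torus_dist L x y ->
       comparable_by C (density_matrix X x y) (critical_decay d L%:num)).
Proof.
move=> d4 b0; have rho0 := rho_c_gt0 d4 b0.
have [c c0 [C C0 [L0 L01 est]]] := compound_cdf_estimates d4 b0.
split.
  (* The first claim concerns every L, so below L0 this constant replaces [c]. *)
  pose c2 := expR (- (rho_c d beta * L0 ^+ d * (1 + (4 * (beta / L0 ^+ 2))^-1) ^+ d)).
  have m0 : 0 < Num.min c c2 by rewrite lt_min c0 expR_gt0.
  set m := Num.min c c2 in m0.
  have e0 : 0 < expR 1 :> R := expR_gt0 1.
  have C10 : 0 < (rho_c d beta)^-1 by rewrite invr_gt0.
  have C20 : 0 < rho_c d beta * expR 1 / m by rewrite divr_gt0// mulr_gt0.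
  exists ((rho_c d beta)^-1 + rho_c d beta * expR 1 / m); first exact: addr_gt0.
  move=> L N X E; have Ld : 0 < L%:num ^+ d by rewrite exprn_gt0.
  have /andP[h1 h2] := exp_harmonic_bounds d4 b0 E.
  rewrite (particle_prob_cdf d4 b0 X (leqnn N)).
  have mF : m <= compound_cdf (excited_rate d beta L%:num N) N N.
    have [LL|LL] := leP L0 L%:num.
      by have [h _ _] := est _ _ LL E; rewrite ge_min h.
    by rewrite ge_min (compound_cdf_ge_bounded d4 b0 E (ltW LL)) orbT.
  have F1 : compound_cdf (excited_rate d beta L%:num N) N N <= 1.
    apply: compound_cdf_le1 => [i|i Ni]; first exact: excited_rate_ge0.
    exact: excited_rate_eq0.
  move: h1 h2 mF F1; set e := expR (- \sum_(i < N) _); set F := compound_cdf _ _ _ => h1 h2 mF F1.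
  apply/andP; split; last first.
    apply: (@le_trans _ _ (e * 1)); first by rewrite ler_wpM2l ?expR_ge0.
    rewrite mulr1; apply: (le_trans h2); rewrite invfM ler_wpM2r ?invr_ge0 ?(ltW Ld)//.
    by rewrite lerDl ltW.
  apply: (@le_trans _ _ (expR (- 1) / (rho_c d beta * L%:num ^+ d) * m)); last first.
    by apply: ler_pM => //; rewrite ?(ltW m0)// divr_ge0 ?expR_ge0// mulr_ge0 ?ltW.
  have -> : expR (- 1) / (rho_c d beta * L%:num ^+ d) * m = (rho_c d beta * expR 1 / m)^-1 / L%:num ^+ d.
    by rewrite expRN invf_div !invfM; ring.
  rewrite ler_wpM2r ?invr_ge0 ?(ltW Ld)// lef_pV2 ?posrE ?addr_gt0//.
  by rewrite lerDr ltW.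
move=> eps eps0.
have dp : 0 < d%:R :> R by rewrite ltr0n (leq_trans _ d4).
have [Ct Ct0 Ht] := @theta_prod_far R d (eps / d%:R) (divr_gt0 eps0 dp).
pose C1 := Ct / c * C; have C10 : 0 < C1 by rewrite mulr_gt0 ?divr_gt0.
pose c1 := 2 ^- d * c; have c10 : 0 < c1 by rewrite mulr_gt0// invr_gt0 exprn_gt0.
(* [C1] serves the upper and [c1] the lower bound on the density matrix; their combination dominates
   both constants required. *)
exists (C1 + c1^-1); first by rewrite addr_gt0 ?invr_gt0.
exists L0 => L N X x y LL E xL yL far.
have [hF hlow hup] := est _ _ LL E.
have [i0 Hi0] := torus_dist_far d4 eps0 far.
have Lp : 0 < L%:num by [].
have := density_matrix_bounds d4 b0 X c0 hF (ltW Ct0)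
  (fun i => Ht _ (fun j => (x 0 j - y 0 j) / L%:num) i0 (scale_gt0 b0 i Lp) Hi0).
move=> /andP[lo up].
rewrite critical_decayE//; last by apply: le_trans LL.
set s := Num.sqrt _ in hlow hup *; have s0 : 0 <= s by exact: sqrtr_ge0.
set g := density_matrix X x y in lo up *.
have Ld : 0 < L%:num ^- d by rewrite invr_gt0 exprn_gt0.
have g_le : g <= C1 * (L%:num ^- d * s).
  apply: (le_trans up); rewrite /C1 (_ : _ / _ * C * _ = Ct / c * L%:num ^- d * (C * s)); last by ring.
  by rewrite ler_wpM2l// mulr_ge0 ?(ltW Ld)// divr_ge0 ?ltW.
have g_ge : c1 * (L%:num ^- d * s) <= g.
  apply: le_trans lo; rewrite /c1 (_ : _ * c * _ = 2 ^- d * L%:num ^- d * (c * s)); last by ring.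
  rewrite ler_wpM2l ?mulr_ge0 ?invr_ge0 ?exprn_ge0//.
  by rewrite lerBrDr.
have Ls : 0 <= L%:num ^- d * s by rewrite mulr_ge0// ltW.
have g0 : 0 <= g by apply: le_trans g_ge; rewrite mulr_ge0// ltW.
rewrite /comparable_by; apply/andP; split.
  rewrite ler_pdivrMl ?addr_gt0 ?invr_gt0//; apply: (le_trans g_le).
  by rewrite ler_wpM2r// lerDl invr_ge0 ltW.
apply: (@le_trans _ _ (c1^-1 * g)); first by rewrite ler_pdivlMl.
by rewrite ler_wpM2r// lerDr ltW.
Qed.
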